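(* Let $T$ be a linear operator generated by an endomorphism $\tau$ of $(\Omega,\beta,\mu)$, let $S_nf=\frac1n\sum_{i=0}^{n-1}T^if$ and $f^*=\lim_{n\to\infty}S_nf$. 1. If $f\in L_p(\Omega,X)$, $p\ge 1$, then $$E(S_{n_1}f|F_{n_2})\rightarrow E(f^*|F_{\infty})$$ in the norm of $L_p(\Omega,X)$ as $n_1,n_2\to\infty$. Moreover $\|E(f^*|F_{\infty})\|_p\le\|f\|_p$. 2. Let $f\in L_p(\Omega,X)$, $p\ge1$, and suppose $\sup_n\|S_nf\|_X\in L_1$. Then $$E(S_{n_1}f|F_{n_2})\rightarrow E(f^*|F_{\infty})$$ almost everywhere as $n_1,n_2\to\infty$. Moreover $E(E(f^*|F_{\infty}))=Ef$.
   Context: $X$ is a reflexive Banach space with norm $\|\cdot\|_X$, and $(\Omega,\beta,\mu)$ is a finite measure space. For $1\le p<\infty$, $L_p(\Omega,X)$ is the Banach space of (strongly) measurable functions $f:\Omega\to X$ with finite norm $\|f\|_p=\left(\int_\Omega\|f(\omega)\|_X^p\,d\mu\right)^{1/p}$; $L_p$ denotes this space for $X=\mathbb R$. For $f$ with values in $X$, $\|f\|_X$ denotes the function $\omega\mapsto\|f(\omega)\|_X$. $E(f|F)$ is the conditional expectation of $f$ with respect to a $\sigma$-subalgebra $F\subset\beta$, and $Ef=\int_\Omega f\,d\mu$ is the (unconditional) expectation. $(F_n)_{n\ge1}$ is a monotone (increasing or decreasing) sequence of $\sigma$-subalgebras of $\beta$, with $F_n\uparrow F_\infty$ ($F_\infty$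 is generated by $\bigcup_nF_n$) or $F_n\downarrow F_\infty$ ($F_\infty=\bigcap_nF_n$). A linear operator $T:L_1(\Omega,X)\to L_1(\Omega,X)$ is generated by an endomorphism $\tau$ (a measure-preserving transformation of $(\Omega,\beta,\mu)$) if $Tf=f\circ\tau$. For such $T$ the limit $f^*=\lim_n S_nf$ exists in $L_p$-norm for $f \in L_p(\Omega,X)$ and almost everywhere in the norm of $X$. The limit as $n_1,n_2\to\infty$ means that both indices tend to infinity independently of each other. Almost everywhere convergence is with respect to the norm of $X$. *)

(* Defs.v *)
From mathcomp Require Import all_boot all_order all_algebra.
From mathcomp Require Import all_classical all_reals all_analysis.

Set Implicit Arguments.
Unset Strict Implicit.
Unset Printing Implicit Defensive.

Import Order.TTheory GRing.Theory Num.Theory.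
Import numFieldNormedType.Exports.

Local Open Scope classical_set_scope.
Local Open Scope ring_scope.

Section ReflexiveSpaces.
Context {R : realType} (X : normedModType R).

Definition dual_space : set (X -> R^o) :=
  [set l | linear l /\ continuous l].

(* Linear functionals on the dual that are bounded on its closed unit ball;
   the values of Phi outside dual_space are irrelevant. *)
Definition bidual_space : set ((X -> R^o) -> R) :=
  [set Phi |
    (forall (a : R) (l m : X -> R^o), dual_space l -> dual_space m ->
       Phi (a *: l + m) = a * Phi l + Phi m) /\
    (exists M : R, forall l : X -> R^o, dual_space l ->
       (forall x : X, `|x| <= 1 -> `|l x| <= 1) -> `|Phi l| <= M)].

Definition reflexive_space : Prop :=
  forall Phi, bidual_space Phi ->
    exists x : X, forall l : X -> R^o, dual_space l -> Phi l = l x.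

End ReflexiveSpaces.

Section BochnerSpaces.
Context {d : measure_display} {T : measurableType d} {R : realType}
  {X : completeNormedModType R}.
Variable mu : {finite_measure set T -> \bar R}.
Implicit Types (F : set (set T)) (f g l : T -> X) (p : R).

Definition simple_function F (s : T -> X) : Prop :=
  finite_set (range s) /\ forall x : X, F (s @^-1` [set x]).

Definition strongly_measurable F f : Prop :=
  exists s : nat -> T -> X, (forall n, simple_function F (s n)) /\
    forall w, s n w @[n --> \oo] --> f w.

Definition simple_integral (s : T -> X) : X :=
  \sum_(x \in range s) fine (mu (s @^-1` [set x])) *: x.

Definition has_bochner_integral f (v : X) : Prop :=
  strongly_measurable measurable f /\
  exists s : nat -> T -> X,
    [/\ forall n, simple_function measurable (s n),
        (\int[mu]_w `|f w - s n w|%:E)%E @[n --> \oo] --> 0%E &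
        simple_integral (s n) @[n --> \oo] --> v].

(* The default 0 is only used when f is not Bochner integrable. *)
Definition bochner_integral f : X := xget 0 (has_bochner_integral f).

(* Not f \_ A, which takes the value point of X (perhaps not 0) outside A. *)
Definition bochner_integral_on (A : set T) f : X :=
  bochner_integral (fun w => \1_A w *: f w).

Definition Lp_norm p f : \bar R := Lnorm mu p%:E (fun w => `|f w|%:E).

(* L_p(mu; X), as functions rather than classes modulo a.e. equality. *)
Definition Lp_space p : set (T -> X) :=
  [set f | strongly_measurable measurable f /\ (Lp_norm p f < +oo)%E].

Definition cvg_in_Lp {I : Type} p (u : I -> T -> X) (G : set_system I) l : Prop :=
  [/\ forall i, Lp_space p (u i), Lp_space p l &
      Lp_norm p (fun w => u i w - l w) @[i --> G] --> 0%E].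

Definition is_cond_exp F f g : Prop :=
  [/\ strongly_measurable F g,
      (\int[mu]_w `|g w|%:E < +oo)%E &
      forall A, F A -> bochner_integral_on A g = bochner_integral_on A f].

(* A chosen version of E(f | F); versions agree outside a null set. *)
Definition cond_exp f F : T -> X := xget (fun=> 0) (is_cond_exp F f).

End BochnerSpaces.

Section ErgodicMeans.
Context {d : measure_display} {T : measurableType d} {R : realType}
  {X : completeNormedModType R}.

Definition endomorphism (mu : {finite_measure set T -> \bar R}) (tau : T -> T)
    : Prop :=
  measurable_fun [set: T] tau /\
  forall A, measurable A -> mu (tau @^-1` A) = mu A.

Definition generated_operator (tau : T -> T) (f : T -> X) : T -> X :=
  f \o tau.

Definition ergodic_mean (tau : T -> T) (n : nat) (f : T -> X) : T -> X :=
  fun w => n%:R^-1 *: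
    \sum_(0 <= i < n) iter i (generated_operator tau) f w.

(* Pointwise limit in the norm of X; the library's lim is the constant point
   of X on the (null) set where the means diverge. *)
Definition ergodic_limit (tau : T -> T) (f : T -> X) : T -> X :=
  fun w => lim (ergodic_mean tau n f w @[n --> \oo]).

End ErgodicMeans.

Section Filtrations.
Context {d : measure_display} {T : measurableType d}.

Definition is_sub_sigma_algebra (F : set (set T)) : Prop :=
  sigma_algebra [set: T] F /\ F `<=` measurable.

Definition increases_to (F : nat -> set (set T)) (Foo : set (set T)) : Prop :=
  (forall n, F n `<=` F n.+1) /\ Foo = <<s \bigcup_n F n >>.

Definition decreases_to (F : nat -> set (set T)) (Foo : set (set T)) : Prop :=
  (forall n, F n.+1 `<=` F n) /\ Foo = \bigcap_n F n.

End Filtrations.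

(* Main.v *)
From HB Require Import structures.
Require Import Defs.
From mathcomp Require Import all_boot all_order all_algebra.
From mathcomp Require Import all_classical all_reals all_analysis.
From mathcomp Require Import measurable_realfun finmap ring lra.

Set Implicit Arguments.
Unset Strict Implicit.
Unset Printing Implicit Defensive.

Import Order.TTheory GRing.Theory Num.Theory.
Import numFieldNormedType.Exports.

Local Open Scope classical_set_scope.
Local Open Scope ring_scope.

(** The theorem joins the two classical convergence theorems, for ergodic means
    and for conditional expectations along a monotone family of
    sigma-algebras, by a comparison that is uniform in one of the indices.
    Write [S_n] for the ergodic means of [f], [g] for their limit, [E_m] for
    the conditional expectation on [F m] and [E] for that on [Foo].

    Norm convergence. In [E_m S_n - E g = E_m (S_n - g) + (E_m g - E g)] the
    first term is, in L_p, no larger than [S_n - g] because conditional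
    expectations are contractions, so it is small for large [n] uniformly in
    [m]; the second one depends on [m] only. This is
    [moment_cond_exp_ergodic_mean_cvg].

    Almost everywhere convergence. The splitting is the same, but now the
    maximal inequality [cond_exp_maximal] is needed: it bounds
    [sup_m sup_(j >= k) `|E_m (S_j - g)|] in measure by the integral of
    [sup_(j >= k) `|S_j - g|], and since the supremum of the means is
    integrable, this integral tends to 0 by dominated convergence
    ([cond_exp_dominated_cvg0]). The equality of the integrals holds because
    conditional expectations and ergodic means preserve them.

    The ingredients are the following.
    - Contraction and existence of conditional expectations rest on
      [strong_variation_le]: if the norm of the integral of a function over
      every set of a sigma-algebra is at most the mass of a positive measure,
      so is the integral of its norm. Existence starts from conditional probabilities,
      that is, Radon-Nikodym for real measures, and extends by density.
    - Convergence of conditional expectations ([cond_exp_cvg]): conditional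
      probabilities are orthogonal projections with monotone norms, hence
      converge in mean; by density and contraction so do all conditional
      expectations, and Doob's maximal inequality gives convergence almost
      everywhere. The increasing and the decreasing case differ only in the
      identification of the limit and in the order in which finite stretches
      of the family are read.
    - Convergence of ergodic means ([ergodic_mean_ae_cvg]): Garsia's maximal
      lemma gives Birkhoff's theorem for indicators, which extends to simple
      functions by linearity and to integrable ones by the maximal lemma
      again.
    - In both cases convergence of p-th moments follows from convergence almost
      everywhere ([moment_approx_cvg0]). *)

(** * Strong measurability *)

Section FinitelyValued.
Context {d : measure_display} {T : measurableType d}.

(** Asking for all preimages to be measurable, and not only the fibres, makes
    the notion stable under composition with any map and under pairing,
    whatever the type of values. *)
Definition finitely_valued {I : Type} (k : T -> I) : Prop :=
  finite_set (range k) /\ forall B : set I, measurable (k @^-1` B).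

Lemma finitely_valuedP {I : Type} (k : T -> I) : finite_set (range k) ->
  (forall i, measurable (k @^-1` [set i])) -> finitely_valued k.
Proof.
move=> fk mk; split=> // B.
have -> : k @^-1` B = \bigcup_(i in range k `&` B) k @^-1` [set i].
  apply/seteqP; split=> [w /= Bkw|w [i [_ Bi] /= ->]//].
  by exists (k w) => //; split=> //; exists w.
apply: fin_bigcup_measurable => [|i _]; [exact: finite_setIl|exact: mk].
Qed.

Lemma finitely_valued_comp {I J : Type} (h : I -> J) (k : T -> I) :
  finitely_valued k -> finitely_valued (h \o k).
Proof.
move=> [fk mk]; split; last by move=> B; rewrite comp_preimage; exact: mk.
have -> : range (h \o k) = h @` range k by rewrite image_comp.
exact: finite_image.
Qed.

Lemma finitely_valued_pair {I J : choiceType} (k : T -> I) (l : T -> J) :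
  finitely_valued k -> finitely_valued l -> finitely_valued (fun w => (k w, l w)).
Proof.
move=> [fk mk] [fl ml]; apply: finitely_valuedP.
  apply: (@sub_finite_set _ _ (range k `*` range l)); last exact: finite_setX.
  by move=> _ [w _ <-]; split; exists w.
move=> [i j]; rewrite (_ : _ @^-1` _ = k @^-1` [set i] `&` l @^-1` [set j]).
  exact: measurableI.
by apply/seteqP; split=> w /= [-> ->].
Qed.

Lemma finitely_valued_mem (A : set T) : measurable A ->
  finitely_valued (fun w => w \in A).
Proof.
move=> mA; apply: finitely_valuedP => // b.
rewrite (_ : _ @^-1` _ = if b then A else ~` A); first by case: b => //; exact: measurableC.
case: b; apply/seteqP; split=> w /=.
- by move=> wA; apply: set_mem.
- by move=> Aw; apply: mem_set.
- by move=> wA Aw; rewrite (mem_set Aw) in wA.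
- by move=> Aw; apply: memNset.
Qed.

End FinitelyValued.

Section StrongMeasurability.
Context {d : measure_display} {T : measurableType d} {R : realType}
  {X : completeNormedModType R}.
Implicit Types (f s : T -> X).

Local Notation SM := (@strongly_measurable d T R X measurable).

Lemma simple_functionP s : simple_function measurable s <-> finitely_valued s.
Proof.
by split=> [[fs ms]|[fs ms]]; [exact: finitely_valuedP|split].
Qed.

Lemma cvg_norm_sub (u : nat -> X) (l x : X) : u n @[n --> \oo] --> l ->
  `|u n - x| @[n --> \oo] --> `|l - x|.
Proof. by move=> ul; apply: cvg_norm; apply: cvgB => //; exact: cvg_cst. Qed.

Definition separably_valued f : Prop :=
  exists e : nat -> X, forall w (eps : R), 0 < eps -> exists k, `|f w - e k| < eps.

Lemma finitely_valued_separable (s : nat -> T -> X) :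
  (forall n, finitely_valued (s n)) ->
  exists e : nat -> X, forall n w, exists k, e k = s n w.
Proof.
move=> fs; have : countable (\bigcup_n range (s n)).
  apply: bigcup_countable; first exact: countableP.
  by move=> n _; apply: finite_set_countable; have [] := fs n.
move=> /pcard_surjP[e se]; exists e => n w.
have [|k _ <-] := se (s n w); last by exists k.
by exists n => //; exists w.
Qed.

(** A Pettis criterion with the distances to points in place of functionals.
    From the right-hand side the approximating functions are explicit: the
    n-th one takes the nearest point to [f w] among the first points of a
    countable set that approximates all the values. Both conditions on the
    right pass to pointwise limits, whereas approximating sequences of simple
    functions cannot be diagonalised pointwise; see
    [strongly_measurable_cvg]. *)
Lemma strongly_measurableP f : SM f <->
  (forall x, measurable_fun setT (fun w => `|f w - x|)) /\ separably_valued f.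
Proof.
split=> [[s [ss sf]]|[mf [e ef]]].
  have fs n : finitely_valued (s n) by apply/simple_functionP.
  split=> [x|].
    apply: (@measurable_fun_cvg _ _ _ _ (fun n w => `|s n w - x|)).
      move=> n _ B mB; rewrite setTI.
      by rewrite -[X in measurable X]/(s n @^-1` ((fun y => `|y - x|) @^-1` B)); exact: (fs n).2.
    by move=> w _; exact: cvg_norm_sub.
  have [e es] := finitely_valued_separable fs.
  exists e => w eps eps0.
  have /cvgrPdist_lt /(_ _ eps0)[n _ /(_ n (leqnn n))/= H] := sf w.
  by have [k ek] := es n w; exists k; rewrite ek.
pose s := fix s n w := if n is m.+1 then
  (if (`|f w - e n| < `|f w - s m w|) then e n else s m w) else e 0%N.
have fs n : finitely_valued (s n).
  elim: n => [|n ih]; first exact: (finitely_valued_comp (fun=> e 0%N) (finitely_valued_mem measurableT)).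
  have mA : measurable [set w | `|f w - e n.+1| < `|f w - s n w|].
    have -> : [set w | `|f w - e n.+1| < `|f w - s n w|] =
        \bigcup_(x in range (s n)) (s n @^-1` [set x] `&` [set w | `|f w - e n.+1| < `|f w - x|]).
      apply/seteqP; split=> [w /= H|w [x _ [/= -> //]]].
      by exists (s n w) => //; exists w.
    apply: fin_bigcup_measurable; first exact: ih.1.
    move=> x _; apply: measurableI; first exact: ih.2.
    rewrite -[X in measurable X]setTI.
    by apply: (measurable_fun_ltr (mf _) (mf _)).
  apply: (@eq_rect _ _ (@finitely_valued _ _ X)
    (finitely_valued_comp (fun p : bool * X => if p.1 then e n.+1 else p.2) (finitely_valued_pair (finitely_valued_mem mA) ih))).
  by apply/funext => w /=; rewrite mem_setE.
have smin w n k : (k <= n)%N -> `|f w - s n w| <= `|f w - e k|.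
  elim: n => [|n ih]; first by rewrite leqn0 => /eqP ->.
  rewrite leq_eqVlt => /orP[/eqP ->|/ih {}ih] /=.
    by case: ltP.
  case: ltP => // H; exact: le_trans (ltW H) ih.
exists s; split=> [n|w]; first exact/simple_functionP.
apply/cvgrPdist_lt => eps eps0.
have [k ek] := ef w _ eps0.
by exists k => // n /= kn; apply: le_lt_trans ek; exact: smin.
Qed.

Lemma strongly_measurable_cvg (u : nat -> T -> X) f :
  (forall n, SM (u n)) -> (forall w, u n w @[n --> \oo] --> f w) -> SM f.
Proof.
move=> mu uf; apply/strongly_measurableP; split=> [x|].
  apply: (@measurable_fun_cvg _ _ _ _ (fun n w => `|u n w - x|)) => [n|w _].
    by have /strongly_measurableP[+ _] := mu n; apply.
  exact: cvg_norm_sub.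
have /choice[e eP] : forall n, exists e : nat -> X,
    forall w (eps : R), 0 < eps -> exists k, `|u n w - e k| < eps.
  by move=> n; have /strongly_measurableP[_] := mu n.
exists (fun m => if (choice.unpickle m : option (nat * nat)) is Some (i, j) then e i j else 0) => w eps eps0.
have e20 : 0 < eps / 2 by rewrite divr_gt0.
have /cvgrPdist_lt /(_ _ e20)[n _ /(_ n (leqnn n))/= H] := uf w.
have [k ek] := eP n w _ e20.
exists (choice.pickle (n, k)); rewrite choice.pickleK.
by rewrite (splitr eps) -(subrK (u n w) (f w)) -addrA (le_lt_trans (ler_normD _ _))// ltrD.
Qed.

Lemma simple_strongly_measurable s : simple_function measurable s -> SM s.
Proof. by move=> ss; exists (fun=> s); split=> // w; exact: cvg_cst. Qed.

Lemma strongly_measurable_cst x : SM (fun=> x).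
Proof.
apply: simple_strongly_measurable; apply/simple_functionP.
exact: (finitely_valued_comp (fun=> x) (finitely_valued_mem measurableT)).
Qed.

Lemma strongly_measurable_norm f : SM f -> measurable_fun setT (fun w => `|f w|).
Proof.
move=> /strongly_measurableP[/(_ 0) + _].
by under eq_fun do rewrite subr0.
Qed.

End StrongMeasurability.

Section StrongMeasurabilityOps.
Context {d : measure_display} {T : measurableType d} {R : realType}.

Lemma strongly_measurable_op2 {X Y Z : completeNormedModType R} (h : X -> Y -> Z)
    (f : T -> X) (g : T -> Y) :
  (forall (u : nat -> X) (v : nat -> Y) x y, u n @[n --> \oo] --> x -> v n @[n --> \oo] --> y ->
     h (u n) (v n) @[n --> \oo] --> h x y) ->
  strongly_measurable measurable f -> strongly_measurable measurable g ->
  strongly_measurable measurable (fun w => h (f w) (g w)).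
Proof.
move=> hc [s [ss sf]] [t [st tg]]; exists (fun n w => h (s n w) (t n w)); split.
  move=> n; apply/simple_functionP.
  have /simple_functionP fs := ss n; have /simple_functionP ft := st n.
  exact: (finitely_valued_comp (fun p => h p.1 p.2) (finitely_valued_pair fs ft)).
by move=> w; exact: hc.
Qed.

Lemma measurable_strongly_measurable (f : T -> R) : measurable_fun setT f ->
  strongly_measurable measurable (f : T -> R^o).
Proof.
move=> mf; apply/strongly_measurableP; split.
  move=> x; apply: measurableT_comp => //.
  by apply: measurable_funB => //; exact: measurable_cst.
exists (fun m => if (choice.unpickle m : option rat) is Some q then ratr q else 0) => w eps eps0.
have [|q] := @rat_in_itvoo R (f w - eps) (f w + eps).
  by rewrite ltrBlDr -addrA ltrDl addr_gt0.
rewrite in_itv/= => /andP[q1 q2]; exists (choice.pickle q); rewrite choice.pickleK.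
by rewrite ltr_norml ltrBrDl ltrBlDr addrC; apply/andP; split; lra.
Qed.

End StrongMeasurabilityOps.

Section StrongMeasurabilityClosure.
Context {d : measure_display} {T : measurableType d} {R : realType}
  {X : completeNormedModType R}.
Implicit Types (f g s : T -> X) (A : set T).

Local Notation SM := (@strongly_measurable d T R X measurable).

Lemma strongly_measurableD f g : SM f -> SM g -> SM (fun w => f w + g w).
Proof.
by apply: (strongly_measurable_op2 (h := fun x y : X => x + y)) => u v x y; exact: cvgD.
Qed.

Lemma strongly_measurableB f g : SM f -> SM g -> SM (fun w => f w - g w).
Proof.
by apply: (strongly_measurable_op2 (h := fun x y : X => x - y)) => u v x y; exact: cvgB.
Qed.

Lemma strongly_measurable_scale (phi : T -> R) f : measurable_fun setT phi ->
  SM f -> SM (fun w => phi w *: f w).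
Proof.
move=> /measurable_strongly_measurable mphi.
apply: (strongly_measurable_op2 (h := fun (x : R^o) (y : X) => x *: y) _ mphi) => u v x y ux vy.
exact: cvgZ.
Qed.

Lemma strongly_measurableZ (a : R) f : SM f -> SM (fun w => a *: f w).
Proof. by apply: strongly_measurable_scale; exact: measurable_cst. Qed.

Lemma strongly_measurable_restrict A f : measurable A -> SM f ->
  SM (fun w => \1_A w *: f w).
Proof. by move=> mA; apply: strongly_measurable_scale; exact: measurable_indic. Qed.

Lemma strongly_measurable_sum (I : Type) (r : seq I) (P : pred I) (F : I -> T -> X) :
  (forall i, SM (F i)) -> SM (fun w => \sum_(i <- r | P i) F i w).
Proof.
move=> mF; elim: r => [|i r ih].
  by under eq_fun do rewrite big_nil; exact: strongly_measurable_cst.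
under eq_fun do rewrite big_cons; case: (P i) => //.
exact: strongly_measurableD.
Qed.

Lemma strongly_measurable_if A f g : measurable A -> SM f -> SM g ->
  SM (fun w => if w \in A then f w else g w).
Proof.
move=> mA mf mg.
rewrite (_ : (fun w => _) = (fun w => \1_A w *: f w + \1_(~` A) w *: g w)); last first.
  apply/funext => w; rewrite !indicE; have [wA|wA] := boolP (w \in A).
    rewrite scale1r memNset ?scale0r ?addr0// => nA; apply: nA; exact: set_mem.
  rewrite scale0r add0r mem_set ?scale1r// => Aw; move/negP : wA; apply; exact: mem_set.
by apply: strongly_measurableD; apply: strongly_measurable_restrict => //; exact: measurableC.
Qed.

Lemma strongly_measurable_comp (tau : T -> T) f : measurable_fun setT tau ->
  SM f -> SM (f \o tau).
Proof.
move=> mtau [s [ss sf]]; exists (fun n => s n \o tau); split=> [n|w]; last exact: sf.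
have [fs ms] := ss n; split=> [|x].
  by apply: sub_finite_set fs => _ [w _ <-]; exists (tau w).
by rewrite comp_preimage -[_ @^-1` _]setTI; apply: mtau => //; exact: ms.
Qed.

(** Comparing all terms with the single term of index [N] leaves only
    countable unions and intersections in the set of convergence of a
    sequence of functions, see [measurable_cvgn]. *)
Lemma cvgn_tailP (u : nat -> X) : cvgn u <->
  forall e : R, 0 < e -> exists N, forall n, (N <= n)%N -> `|u n - u N| < e.
Proof.
split=> [/cvg_cauchy /cauchyP H e e0|H].
  have /H [x [N _ HN]] : 0 < e / 2 by rewrite divr_gt0.
  exists N => n Nn.
  have {}HN m : (N <= m)%N -> `|x - u m| < e / 2.
    by move=> /HN; rewrite /= -ball_normE.
  have h1 := HN _ Nn; have h2 := HN _ (leqnn N).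
  rewrite (splitr e) -(subrK x (u n)) -addrA (le_lt_trans (ler_normD _ _))//.
  by rewrite ltrD// distrC.
apply/cauchy_cvgP/cauchyP => e /H[N HN].
by exists (u N); exists N => // n /= Nn; rewrite -ball_normE /= distrC HN.
Qed.

Lemma measurable_cvgn (u : nat -> T -> X) : (forall n, SM (u n)) ->
  measurable [set w | cvgn (fun n => u n w)].
Proof.
move=> mu.
have -> : [set w | cvgn (fun n => u n w)] =
  \bigcap_k \bigcup_N \bigcap_m [set w | `|u (N + m)%N w - u N w| < k.+1%:R^-1].
  apply/seteqP; split=> w /=.
    move=> /cvgn_tailP H k _; have [//|N HN] := H k.+1%:R^-1.
    by exists N => // m _ /=; apply: HN; exact: leq_addr.
  move=> H; apply/cvgn_tailP => e e0.
  have [k] := ltr_add_invr e0; rewrite add0r => ke.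
  have [N _ HN] := H k I; exists N => n Nn.
  by rewrite (lt_trans _ ke)//; have := HN (n - N)%N I; rewrite /= subnKC.
apply: bigcapT_measurable => k; apply: bigcupT_measurable => N.
apply: bigcapT_measurable => m.
rewrite -[X in measurable X]setTI.
apply: (measurable_fun_ltr _ (measurable_cst _)) => //.
by apply: strongly_measurable_norm; exact: strongly_measurableB.
Qed.

Lemma strongly_measurable_lim (u : nat -> T -> X) (c : X) : (forall n, SM (u n)) ->
  SM (fun w => if w \in [set w | cvgn (fun n => u n w)] then limn (fun n => u n w) else c).
Proof.
move=> mu; pose D := [set w | cvgn (fun n => u n w)].
apply: (@strongly_measurable_cvg _ _ _ _ (fun n w => if w \in D then u n w else c)).
  move=> n; apply: strongly_measurable_if => //; first exact: measurable_cvgn.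
  exact: strongly_measurable_cst.
move=> w; rewrite -/D; case: ifPn => [/set_mem//|_]; exact: cvg_cst.
Qed.

(** Replacing an approximating value by 0 where its norm exceeds twice that
    of the limit changes finitely many terms where the limit is not 0, and
    leaves only zeros where it is. The bound makes dominated convergence
    available. *)
Lemma dominated_simple_approximation f : SM f ->
  exists s : nat -> T -> X, [/\ forall n, simple_function measurable (s n),
    forall w, s n w @[n --> \oo] --> f w & forall n w, `|s n w| <= 2 * `|f w|].
Proof.
move=> mf; have [s [ss sf]] := mf.
pose A n := [set w | `|s n w| <= 2 * `|f w|].
exists (fun n w => if w \in A n then s n w else 0); split.
- move=> n; apply/simple_functionP.
  have mA : measurable (A n).
    rewrite -[X in measurable X]setTI; apply: measurable_fun_ler => //.
      by apply: strongly_measurable_norm; exact: simple_strongly_measurable.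
    by apply: measurable_funM => //; exact: strongly_measurable_norm.
  have /simple_functionP fs := ss n.
  exact: (finitely_valued_comp (fun p : bool * X => if p.1 then p.2 else 0)
    (finitely_valued_pair (finitely_valued_mem mA) fs)).
- move=> w; have [fw0|fw0] := eqVneq (f w) 0.
    rewrite fw0 (_ : (fun n => _) = fun=> 0); last first.
      apply/funext => n; case: ifPn => // /set_mem; rewrite /A/= fw0 normr0 mulr0.
      by rewrite normr_le0 => /eqP.
    exact: cvg_cst.
  have f0 : 0 < `|f w| by rewrite normr_gt0.
  apply: cvg_trans (sf w); apply: near_eq_cvg.
  have /cvgrPdist_lt /(_ _ f0) := sf w; apply: filterS => n H.
  rewrite mem_set//= /A/= mulr_natl mulr2n -lerBlDr.
  by rewrite (le_trans (lerB_dist _ _))// distrC ltW.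
- by move=> n w; case: ifPn => [/set_mem//|_]; rewrite normr0 mulr_ge0.
Qed.

End StrongMeasurabilityClosure.

Section SubSigmaAlgebra.
Context {d : measure_display} {T : measurableType d} {R : realType}
  {X : completeNormedModType R}.
Variable F : set (set T).
Hypothesis subF : is_sub_sigma_algebra F.
Implicit Types f g : T -> X.

Lemma strongly_measurableS (G H : set (set T)) f : G `<=` H ->
  strongly_measurable G f -> strongly_measurable H f.
Proof.
move=> GH [s [ss sf]]; exists s; split=> // n; have [fs ms] := ss n; split=> // x.
exact: GH.
Qed.

Lemma sub_strongly_measurable f : strongly_measurable F f ->
  strongly_measurable measurable f.
Proof. exact: strongly_measurableS subF.2. Qed.

(** Every sub-sigma-algebra [F] is handled as the measurable type
    [g_sigma_algebraType F] on the same carrier: closure properties proved for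
    an arbitrary measurable type then hold for measurability relative to
    [F]. *)
Lemma measurable_sub : @measurable _ (g_sigma_algebraType F) = F.
Proof. by apply: measurable_g_measurableTypeE; case: subF. Qed.

Lemma strongly_measurable_subE (f : T -> X) :
  strongly_measurable F f <->
  @strongly_measurable _ (g_sigma_algebraType F) _ X measurable f.
Proof. by rewrite measurable_sub. Qed.

Lemma measurable_fun_sub d' (Y : measurableType d') (f : T -> Y) :
  @measurable_fun _ _ (g_sigma_algebraType F) Y setT f -> measurable_fun setT f.
Proof.
move=> mf _ B mB; rewrite setTI; apply: subF.2; rewrite -measurable_sub.
by have := mf measurableT B mB; rewrite setTI.
Qed.

Lemma measurable_fun_subF d' (Y : measurableType d') (f : T -> Y) (B : set Y) :
  @measurable_fun _ _ (g_sigma_algebraType F) Y setT f -> measurable B -> F (f @^-1` B).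
Proof.
by move=> mf mB; have := mf measurableT B mB; rewrite setTI measurable_sub.
Qed.

Lemma sub_sigma_setT : F setT.
Proof. by rewrite -measurable_sub; exact: (@measurableT _ (g_sigma_algebraType F)). Qed.

Lemma sub_strongly_measurableB f g :
  strongly_measurable F f -> strongly_measurable F g ->
  strongly_measurable F (fun w => f w - g w).
Proof.
move=> mf mg; apply/strongly_measurable_subE.
by apply: (@strongly_measurableB _ (g_sigma_algebraType F)); exact/strongly_measurable_subE.
Qed.

Lemma sub_strongly_measurable_norm f : strongly_measurable F f ->
  @measurable_fun _ _ (g_sigma_algebraType F) _ setT (fun w => `|f w|).
Proof. by move=> mf; apply: strongly_measurable_norm; exact/strongly_measurable_subE. Qed.

Lemma measurable_norm_gt f (c : R) : strongly_measurable F f -> F [set w | c < `|f w|].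
Proof.
move=> mf; rewrite (_ : mkset _ = (fun w => `|f w|) @^-1` `]c, +oo[).
  apply: (measurable_fun_subF (sub_strongly_measurable_norm mf)).
  exact: measurable_itv.
by apply/seteqP; split=> w /=; rewrite in_itv/= andbT.
Qed.

End SubSigmaAlgebra.

(** * Integrals of simple functions *)

Section NonnegativeIntegrals.
Context {d : measure_display} {T : measurableType d} {R : realType}.
Variable mu : {measure set T -> \bar R}.
Implicit Types (a b c : T -> R) (A : set T).

Lemma integral_leD A a b c : measurable A ->
  measurable_fun setT a -> measurable_fun setT b -> measurable_fun setT c ->
  (forall w, A w -> 0 <= a w) -> (forall w, A w -> 0 <= b w) ->
  (forall w, A w -> 0 <= c w) -> (forall w, A w -> c w <= a w + b w) ->
  (\int[mu]_(w in A) (c w)%:E <=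
   \int[mu]_(w in A) (a w)%:E + \int[mu]_(w in A) (b w)%:E)%E.
Proof.
move=> mA ma mb mc a0 b0 c0 cab.
have mE (g : T -> R) : measurable_fun setT g -> measurable_fun A (fun w => (g w)%:E).
  by move=> mg; apply/measurable_EFinP; exact: measurable_funTS.
rewrite -ge0_integralD//; try exact: mE.
by apply: ge0_le_integral => //; [exact: mE|apply: emeasurable_funD; exact: mE].
Qed.

Lemma integral_le A a b : measurable A ->
  measurable_fun setT a -> measurable_fun setT b ->
  (forall w, A w -> 0 <= a w) -> (forall w, A w -> a w <= b w) ->
  (\int[mu]_(w in A) (a w)%:E <= \int[mu]_(w in A) (b w)%:E)%E.
Proof.
move=> mA ma mb a0 ab; apply: ge0_le_integral => //.
- by apply/measurable_EFinP; exact: measurable_funTS.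
- by apply/measurable_EFinP; exact: measurable_funTS.
Qed.

Lemma integral_scale A a (k : R) : measurable A -> measurable_fun setT a ->
  (forall w, A w -> 0 <= a w) -> 0 <= k ->
  (\int[mu]_(w in A) (k * a w)%:E = k%:E * \int[mu]_(w in A) (a w)%:E)%E.
Proof.
move=> mA ma a0 k0; under eq_integral do rewrite EFinM.
rewrite ge0_integralZl_EFin//.
by apply/measurable_EFinP; exact: measurable_funTS.
Qed.

Lemma integral_finitely_valued {I : choiceType} (k : T -> I) A a :
  finitely_valued k -> measurable A -> measurable_fun setT a ->
  (forall w, 0 <= a w) ->
  (\int[mu]_(w in A) (a w)%:E =
   \sum_(i <- fset_set (range k)) \int[mu]_(w in A `&` k @^-1` [set i]) (a w)%:E)%E.
Proof.
move=> [fk mk] mA ma a0.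
have AE : A = \big[setU/set0]_(i <- fset_set (range k)) (A `&` k @^-1` [set i]).
  rewrite -bigcup_fset_set//; apply/seteqP; split=> [w Aw|w [i _ []]//].
  by exists (k w) => //; exists w.
rewrite {1}AE; apply: ge0_integral_bigsetU => //.
- by move=> i; apply: measurableI.
- by move=> i j _ _ [w [/= [_ <-] [_ <-]]].
- by rewrite -AE; apply/measurable_EFinP; exact: measurable_funTS.
- by move=> w _; rewrite lee_fin.
Qed.

Lemma integral_cst_on A (k : R) : measurable A ->
  (\int[mu]_(w in A) k%:E = k%:E * mu A)%E.
Proof. by move=> mA; rewrite integral_cst. Qed.

Lemma integral_indicM A a : measurable A ->
  (\int[mu]_w (\1_A w * a w)%:E = \int[mu]_(w in A) (a w)%:E)%E.
Proof.
move=> mA; rewrite [RHS]integral_mkcond; apply: eq_integral => w _.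
by rewrite patchE indicE; case: ifPn => _; rewrite ?mul1r ?mul0r.
Qed.

End NonnegativeIntegrals.

Lemma cvge0P {R : realType} {I : Type} (G : set_system I) {FG : Filter G} (u : I -> \bar R) :
  (forall i, (0 <= u i)%E) ->
  u i @[i --> G] --> 0%E <-> forall e : R, 0 < e -> \forall i \near G, (u i <= e%:E)%E.
Proof.
move=> u0; split=> [uG e e0|H].
  have /fine_fcvg ? := uG; have := uG; move/fine_cvgP => [fu /cvgrPdist_le /(_ e e0)].
  apply: filterS2 fu => i fi; rewrite sub0r normrN => H.
  by rewrite -(fineK fi) lee_fin (le_trans _ H)// ler_norm.
apply/fine_cvgP; split.
  have := H _ ltr01; apply: filterS => i ui.
  by rewrite ge0_fin_numE// (le_lt_trans ui)// ltry.
apply/cvgrPdist_le => e e0; have := H e e0; apply: filterS => i ui.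
rewrite sub0r normrN ger0_norm ?fine_ge0//=.
by rewrite -lee_fin fineK// ge0_fin_numE// (le_lt_trans ui)// ltry.
Qed.

Section SimpleIntegral.
Context {d : measure_display} {T : measurableType d} {R : realType}
  {X : completeNormedModType R}.
Variable mu : {finite_measure set T -> \bar R}.
Implicit Types (s t : T -> X).

(** The fibres of [k] refine those of [h \o k], so the integral may be computed
    on them. With [k] the pair of two simple functions, linearity becomes an
    identity between corresponding terms of two sums. *)
Lemma simple_integral_comp {I : choiceType} (k : T -> I) (h : I -> X) :
  finitely_valued k ->
  simple_integral mu (h \o k) =
  \sum_(i \in range k) fine (mu (k @^-1` [set i])) *: h i.
Proof.
move=> [fk mk]; rewrite /simple_integral.
have rE : range (h \o k) = h @` range k by rewrite image_comp.
rewrite rE fsbig_finite; last exact: finite_image.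
rewrite fset_set_image// [RHS]fsbig_finite// [RHS](partition_big_imfset _ h).
apply: eq_bigr => x _.
transitivity ((\sum_(i <- fset_set (range k) | h i == x) fine (mu (k @^-1` [set i]))) *: x); last first.
  by rewrite scaler_suml; apply: eq_bigr => i /eqP ->.
congr (_ *: _).
pose D := range k `&` [set i | h i = x].
have fD : finite_set D by exact: finite_setIl.
have -> : (h \o k) @^-1` [set x] = \bigcup_(i in D) k @^-1` [set i].
  apply/seteqP; split=> [w /= hx|w [i [_ <-] /= ->]//].
  by exists (k w) => //; split=> //; exists w.
rewrite measure_fin_bigcup//; last by move=> i j _ _ [w [/= <- <-]].
rewrite (eq_fsbigr (fun i => (fine (mu (k @^-1` [set i])))%:E)); last first.
  by move=> i _; rewrite fineK// fin_num_measure.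
rewrite fsumEFin//= fsbig_mkcondr fsbig_finite// [RHS]big_mkcond/=.
apply: eq_bigr => i _; congr (if _ then _ else _).
by apply/idP/eqP => [/set_mem|hi]//; exact: mem_set.
Qed.

Lemma simple_integral_lin (c : R) s t : finitely_valued s -> finitely_valued t ->
  simple_integral mu (fun w => s w + c *: t w) =
  simple_integral mu s + c *: simple_integral mu t.
Proof.
move=> fs ft; have fp := finitely_valued_pair fs ft.
rewrite (simple_integral_comp (fun p => p.1 + c *: p.2) fp).
rewrite [X in _ = X + _](simple_integral_comp fst fp).
rewrite [X in _ = _ + _ *: X](simple_integral_comp snd fp).
rewrite !fsbig_finite; try exact: fp.1.
rewrite scaler_sumr -big_split/=; apply: eq_bigr => -[x y] _ /=.
by rewrite scalerDr !scalerA [X in _ + X *: _]mulrC.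
Qed.

Lemma simple_integral_norm s : finitely_valued s ->
  (`|simple_integral mu s|%:E <= \int[mu]_w `|s w|%:E)%E.
Proof.
move=> fs; have [fr ms] := fs.
have mns : measurable_fun setT (fun w => `|s w|).
  by apply/strongly_measurable_norm/simple_strongly_measurable/simple_functionP.
rewrite (integral_finitely_valued mu fs measurableT mns)//.
rewrite /simple_integral fsbig_finite//.
apply: (@le_trans _ _ (\sum_(x <- fset_set (range s)) `|fine (mu (s @^-1` [set x])) *: x|)%:E).
  by rewrite lee_fin; exact: ler_norm_sum.
rewrite -sumEFin; apply: lee_sum => x _; rewrite setTI.
rewrite normrZ ger0_norm ?fine_ge0// EFinM fineK ?fin_num_measure//.
rewrite (eq_integral (fun=> `|x|%:E)); first by rewrite integral_cst_on// muleC.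
by move=> w /set_mem /= ->.
Qed.

End SimpleIntegral.

(** * Moments and the Bochner integral *)

Section PowerInequalities.
Context {R : realType}.
Variable p : R.
Hypothesis p1 : 1 <= p.
Implicit Types x y c : R.

Let p0 : 0 < p. Proof. exact: lt_le_trans ltr01 p1. Qed.

Lemma le_powR x y : 0 <= x -> x <= y -> x `^ p <= y `^ p.
Proof.
move=> x0 xy; apply: ge0_ler_powR => //; first exact: ltW.
- by rewrite nnegrE; exact: le_trans x0 xy.
Qed.

Lemma powRD_le x y : 0 <= x -> 0 <= y ->
  (x + y) `^ p <= 2 `^ p * (x `^ p + y `^ p).
Proof.
move=> x0 y0; apply: (@le_trans _ _ ((2 * Num.max x y) `^ p)).
  apply: le_powR; first exact: addr_ge0.
  by rewrite mulr_natl mulr2n lerD// le_max lexx ?orbT.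
rewrite powRM ?le_max ?x0// ler_wpM2l ?powR_ge0//.
by case: (leP x y) => _; rewrite ?lerDr ?lerDl powR_ge0.
Qed.

Lemma powR_small x : 0 <= x -> x <= 1 -> x `^ p <= x.
Proof.
rewrite le_eqVlt => /predU1P[<-|x0 x1]; first by rewrite powR0// gt_eqF.
by apply: ge1r_powR => //; rewrite x0.
Qed.

Lemma le_1DpowR x : 0 <= x -> x <= 1 + x `^ p.
Proof.
move=> x0; have [x1|/ltW x1] := leP x 1; first by rewrite (le_trans x1)// lerDl powR_ge0.
by rewrite (le_trans (le1r_powR x1 p1))// lerDr.
Qed.

(** Young's inequality for [x] and [c `^ (p - 1)]: the graph of the p-th power
    lies above its tangent at [c]. It takes the place of Jensen's inequality.
    With [c] the norm of a mean of values [x], averaging makes the p-th power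
    of [c] appear on both sides, on the right with the factor [1 - p^-1], and
    [convex_absorb] gathers it on the left. *)
Lemma powR_tangent x c : 0 <= x -> 0 <= c ->
  x * c `^ (p - 1) <= x `^ p / p + c `^ p * (1 - p^-1).
Proof.
move=> x0 c0; have [->|p_neq1] := eqVneq p 1.
  by rewrite subrr powRr0 invr1 subrr mulr0 addr0 !mulr1 powRr1.
have p_gt1 : 1 < p by rewrite lt_neqAle eq_sym p_neq1.
have q0 : 0 < 1 - p^-1 by rewrite subr_gt0 invf_lt1.
rewrite (le_trans (@conjugate_powR R x (c `^ (p - 1)) p (1 - p^-1)^-1 _ _ _ _ _))//.
- exact: powR_ge0.
- by rewrite invr_gt0.
- by rewrite invrK; lra.
rewrite invrK -powRrM (_ : (p - 1) * _ = p)//.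
have -> : 1 - p^-1 = (p - 1) / p by field; rewrite gt_eqF.
by field; rewrite !gt_eqF// subr_gt0.
Qed.

Lemma cvg0_powR {I : Type} (G : set_system I) {FG : Filter G} (u : I -> R) :
  (forall i, 0 <= u i) -> u i @[i --> G] --> 0 -> u i `^ p @[i --> G] --> 0.
Proof.
move=> u0 uG; apply/cvgrPdist_le => e e0.
have em0 : 0 < Num.min e 1 by rewrite lt_min e0 ltr01.
move/cvgrPdist_le : uG => /(_ _ em0); apply: filterS => i.
rewrite !sub0r !normrN !ger0_norm ?powR_ge0// le_min => /andP[ue u1].
by rewrite (le_trans _ ue)// powR_small.
Qed.

End PowerInequalities.

Section BochnerIntegral.
Context {d : measure_display} {T : measurableType d} {R : realType}
  {X : completeNormedModType R}.
Variable mu : {finite_measure set T -> \bar R}.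
Implicit Types (f g s : T -> X).

Local Notation SM := (@strongly_measurable d T R X measurable).

Definition bochner_integrable f := SM f /\ (\int[mu]_w `|f w|%:E < +oo)%E.

(** The p-th power of the L_p norm, in which additivity of the integral can be
    used without extracting roots. *)
Definition moment (p : R) f : \bar R := (\int[mu]_w (`|f w| `^ p)%:E)%E.

Lemma moment_ge0 p f : (0 <= moment p f)%E.
Proof. by apply: integral_ge0 => w _; rewrite lee_fin powR_ge0. Qed.

Lemma moment1 f : moment 1 f = (\int[mu]_w `|f w|%:E)%E.
Proof. by apply: eq_integral => w _; rewrite powRr1. Qed.

Lemma measurable_moment p f : SM f -> measurable_fun setT (fun w => `|f w| `^ p).
Proof.
move=> mf; apply: (measurableT_comp (f := fun x : R => x `^ p)) => //.
exact: strongly_measurable_norm.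
Qed.

Lemma momentC p f g :
  moment p (fun w => f w - g w)%R = moment p (fun w => g w - f w)%R.
Proof. by apply: eq_integral => w _; rewrite distrC. Qed.

(** A substitute for Minkowski's inequality: for convergence statements the
    triangle inequality up to a constant factor is enough. *)
Lemma momentB_le p f g h : 1 <= p -> SM f -> SM g -> SM h ->
  (moment p (fun w => f w - h w)%R <=
   (2 `^ p)%:E * (moment p (fun w => f w - g w)%R + moment p (fun w => g w - h w)%R))%E.
Proof.
move=> p1 mf mg mh; rewrite /moment.
have mm := measurable_moment.
have mB a b : SM a -> SM b -> measurable_fun setT (fun w => `|a w - b w| `^ p).
  by move=> ma mb; apply: mm; exact: strongly_measurableB.
have c0 : 0 <= 2 `^ p :> R by exact: powR_ge0.
rewrite ge0_muleDr ?moment_ge0//.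
rewrite -!integral_scale//; try exact: mB.
apply: integral_leD => //.
- by apply: measurable_funM => //; exact: mB.
- by apply: measurable_funM => //; exact: mB.
- exact: mB.
- move=> w _; rewrite -mulrDr (le_trans _ (powRD_le _ _ _))//.
  by apply: le_powR => //; rewrite -{1}(subrK (g w) (f w)) -addrA ler_normD.
Qed.

Lemma moment_lty_integrable p f : 1 <= p -> SM f -> (moment p f < +oo)%E ->
  bochner_integrable f.
Proof.
move=> p1 mf ff; split=> //.
apply: (@le_lt_trans _ _ (\int[mu]_w 1%:E + moment p f)%E).
  apply: integral_leD => //; try by move=> w _; exact: powR_ge0.
  - exact: measurable_moment.
  - exact: strongly_measurable_norm.
  - by move=> w _; exact: le_1DpowR.
by rewrite integral_cst_on// mul1e lte_add_pinfty// -ge0_fin_numE// fin_num_measure.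
Qed.

Lemma moment_cvg0 p f (s : nat -> T -> X) : 1 <= p -> SM f -> (forall n, SM (s n)) ->
  (forall w, s n w @[n --> \oo] --> f w) -> (forall n w, `|s n w| <= 2 * `|f w|) ->
  (moment p f < +oo)%E -> moment p (fun w => f w - s n w) @[n --> \oo] --> 0%E.
Proof.
move=> p1 mf ms sf s2 ff; pose c : R := 3 `^ p.
have p0 : 0 < p by exact: lt_le_trans ltr01 p1.
have ig : mu.-integrable setT (fun w => (c * `|f w| `^ p)%:E).
  apply/integrableP; split.
    by apply/measurable_EFinP; apply: measurable_funM => //; exact: measurable_moment.
  under eq_integral do rewrite /= ger0_norm ?mulr_ge0 ?powR_ge0//.
  rewrite integral_scale ?powR_ge0//; last by exact: measurable_moment.
  by rewrite lte_mul_pinfty ?lee_fin ?powR_ge0.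
have := @dominated_convergence _ _ _ mu setT measurableT
  (fun n w => (`|f w - s n w| `^ p)%:E) (cst 0%E) _ _ _ _ ig.
case.
- move=> n; apply/measurable_EFinP; apply: measurable_moment; exact: strongly_measurableB.
- exact: measurable_cst.
- apply: aeW => w _; apply/cvg_EFin; first by near=> n.
  apply: (cvg0_powR p1) => //=.
  rewrite -[X in _ --> X](normr0 X) -(subrr (f w)).
  by apply: cvg_norm; apply: cvgB; [exact: cvg_cst|exact: sf].
- apply: aeW => w n _; rewrite /= lee_fin ger0_norm ?powR_ge0// -powRM//.
  apply: le_powR => //; rewrite (le_trans (ler_normB _ _))//.
  by have := s2 n w; lra.
move=> _ _; rewrite integral_cst// mul0e; exact.
Unshelve. all: by end_near. Qed.

Lemma integrable_moment1 f : bochner_integrable f <-> SM f /\ (moment 1 f < +oo)%E.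
Proof. by rewrite moment1. Qed.

Lemma bochner_integrableW f g : bochner_integrable g -> SM f ->
  (forall w, `|f w| <= `|g w|) -> bochner_integrable f.
Proof.
move=> [mg ig] mf fg; split=> //; apply: le_lt_trans ig.
by apply: integral_le => //; exact: strongly_measurable_norm.
Qed.

Lemma bochner_integrable_lin (c : R) f g : bochner_integrable f -> bochner_integrable g ->
  bochner_integrable (fun w => f w + c *: g w).
Proof.
move=> [mf ff] [mg gf]; have mcg := strongly_measurableZ c mg.
have mfg := strongly_measurableD mf mcg.
split=> //; apply: (@le_lt_trans _ _ (\int[mu]_w `|f w|%:E + \int[mu]_w (`|c| * `|g w|)%:E)%E).
  apply: integral_leD => //; try exact: strongly_measurable_norm.
    by apply: measurable_funM => //; exact: strongly_measurable_norm.
  by move=> w _; rewrite -normrZ ler_normD.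
rewrite integral_scale//; last exact: strongly_measurable_norm.
by rewrite lte_add_pinfty// lte_mul_pinfty.
Qed.

Lemma simple_approximation f : bochner_integrable f ->
  exists s : nat -> T -> X, (forall n, simple_function measurable (s n)) /\
    (\int[mu]_w `|f w - s n w|%:E)%E @[n --> \oo] --> 0%E.
Proof.
move=> /integrable_moment1[mf ff].
have [s [ss sf s2]] := dominated_simple_approximation mf.
exists s; split=> //; under eq_fun do rewrite -moment1.
by apply: moment_cvg0 => // n; exact: simple_strongly_measurable.
Qed.

Lemma simple_approximation_moment p f (e : R) :
  1 <= p -> SM f -> (moment p f < +oo)%E -> 0 < e ->
  exists s, finitely_valued s /\ (moment p (fun w => f w - s w)%R <= e%:E)%E.
Proof.
move=> p1 mf ff e0; have [s [ss sf s2]] := dominated_simple_approximation mf.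
have := moment_cvg0 p1 mf (fun n => simple_strongly_measurable (ss n)) sf s2 ff.
move/cvge0P => /(_ _ _ e0) [|N _ /(_ N (leqnn N)) /= HN].
  by move=> n; exact: moment_ge0.
by exists (s N); split=> //; apply/simple_functionP.
Qed.

Lemma simple_approximation_mean f (e : R) : bochner_integrable f -> 0 < e ->
  exists s, finitely_valued s /\ (\int[mu]_w `|f w - s w|%:E <= e%:E)%E.
Proof.
move=> /integrable_moment1[mf ff] e0.
have [s [fs se]] := simple_approximation_moment (lexx 1) mf ff e0.
by exists s; split=> //; rewrite -moment1.
Qed.

End BochnerIntegral.

Section BochnerIntegralTheory.
Context {d : measure_display} {T : measurableType d} {R : realType}
  {X : completeNormedModType R}.
Variable mu : {finite_measure set T -> \bar R}.
Implicit Types (f g s t : T -> X) (A : set T).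

Local Notation SM := (@strongly_measurable d T R X measurable).
Local Notation int1 f := (\int[mu]_w `|f w|%:E)%E.

Lemma integral_norm_leD f g h : SM f -> SM g -> SM h ->
  (forall w, `|h w| <= `|f w| + `|g w|) -> (int1 h <= int1 f + int1 g)%E.
Proof.
by move=> mf mg mh hfg; apply: integral_leD => //; exact: strongly_measurable_norm.
Qed.

(** True for simple functions, and preserved by convergence in mean. By
    linearity it gives uniqueness of the integral and its continuity for
    convergence in mean. *)
Lemma has_bochner_integral_norm f v : has_bochner_integral mu f v ->
  (`|v|%:E <= int1 f)%E.
Proof.
move=> [mf [s [ss sf sv]]].
apply/lee_addgt0Pr => e e0; have e20 : 0 < e / 2 by rewrite divr_gt0.
have /cvge0P /(_ _ e20) H1 : (\int[mu]_w `|f w - s n w|%:E)%E @[n --> \oo] --> 0%E by exact: sf.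
have H2 : \forall n \near \oo, `|v - simple_integral mu (s n)| <= e / 2.
  by move/cvgrPdist_le : sv; exact.
have [n [h1 h2]] : exists n, (\int[mu]_w `|f w - s n w|%:E <= (e / 2)%:E)%E /\
    `|v - simple_integral mu (s n)| <= e / 2.
  have := filterI (H1 _) H2; case; first by move=> i; exact: integral_ge0.
  by move=> n _ /(_ n (leqnn n)) []; exists n.
have /simple_functionP fs := ss n.
have ms := simple_strongly_measurable (ss n).
apply: (@le_trans _ _ ((e / 2)%:E + `|simple_integral mu (s n)|%:E)%E).
  rewrite -EFinD lee_fin.
  by rewrite -{1}(subrK (simple_integral mu (s n)) v) (le_trans (ler_normD _ _))// lerD2r.
rewrite [X in (_ <= _ + X%:E)%E](splitr e) EFinD addeCA leeD2l//.
apply: le_trans (simple_integral_norm mu fs) _.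
apply: (@le_trans _ _ (int1 f + \int[mu]_w `|f w - s n w|%:E)%E); last by rewrite leeD2l.
apply: (@integral_norm_leD f (fun w => f w - s n w) (s n)) => //.
  exact: strongly_measurableB.
by move=> w; rewrite -{1}(subKr (f w) (s n w)) ler_normB.
Qed.

Lemma has_bochner_integral_lin (c : R) f g u v :
  has_bochner_integral mu f u -> has_bochner_integral mu g v ->
  has_bochner_integral mu (fun w => f w + c *: g w) (u + c *: v).
Proof.
move=> [mf [s [ss sf su]]] [mg [t [st tg tv]]].
have mS n : SM (s n) := simple_strongly_measurable (ss n).
have mt n : SM (t n) := simple_strongly_measurable (st n).
split; first by apply: strongly_measurableD => //; exact: strongly_measurableZ.
exists (fun n w => s n w + c *: t n w); split.
- move=> n; apply/simple_functionP.
  have /simple_functionP fs := ss n; have /simple_functionP ft := st n.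
  exact: (finitely_valued_comp (fun p => p.1 + c *: p.2) (finitely_valued_pair fs ft)).
- apply: (@squeeze_cvge _ _ _ _ (fun=> 0%E) _
    (fun n => \int[mu]_w `|f w - s n w|%:E + `|c|%:E * \int[mu]_w `|g w - t n w|%:E)%E).
  + near=> n; apply/andP; split; first exact: integral_ge0.
    rewrite -integral_scale//; last by apply: strongly_measurable_norm; exact: strongly_measurableB.
    apply: integral_leD => //.
    * by apply: strongly_measurable_norm; exact: strongly_measurableB.
    * apply: measurable_funM => //; apply: strongly_measurable_norm.
      exact: strongly_measurableB.
    * apply: strongly_measurable_norm; apply: strongly_measurableB;
      by apply: strongly_measurableD => //; exact: strongly_measurableZ.
    * move=> w _; rewrite -normrZ scalerBr; apply: le_trans (ler_normD _ _).
      by rewrite opprD addrACA.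
  + exact: cvg_cst.
  + rewrite -[X in _ --> X](adde0 0%E) -[X in (_ + X)%E](mule0 `|c|%:E).
    by apply: cvgeD => //; apply: cvgeZl.
- rewrite (_ : (fun n => _) = fun n => simple_integral mu (s n) + c *: simple_integral mu (t n)).
    by apply: cvgD => //; apply: cvgZ => //; exact: cvg_cst.
  by apply/funext => n; apply: simple_integral_lin; exact/simple_functionP.
Unshelve. all: by end_near. Qed.

Lemma has_bochner_integral_uniq f u v :
  has_bochner_integral mu f u -> has_bochner_integral mu f v -> u = v.
Proof.
move=> fu fv; have := has_bochner_integral_lin (-1) fu fv.
move=> /has_bochner_integral_norm; under eq_integral do rewrite scaleN1r subrr normr0.
by rewrite integral0 lee_fin normr_le0 scaleN1r subr_eq0 => /eqP.
Qed.

Lemma has_bochner_integral_simple s : finitely_valued s ->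
  has_bochner_integral mu s (simple_integral mu s).
Proof.
move=> fs; have ss : simple_function measurable s by exact/simple_functionP.
split; first exact: simple_strongly_measurable.
exists (fun=> s); split => //; last exact: cvg_cst.
under eq_fun do under eq_integral do rewrite subrr normr0.
by rewrite integral0; exact: cvg_cst.
Qed.

Lemma has_bochner_integral_integrable f v : has_bochner_integral mu f v ->
  bochner_integrable mu f.
Proof.
move=> [mf [s [ss sf _]]]; split=> //.
have /cvge0P /(_ _ ltr01) : (\int[mu]_w `|f w - s n w|%:E)%E @[n --> \oo] --> 0%E by exact: sf.
case; first by move=> i; exact: integral_ge0.
move=> n _ /(_ n (leqnn n)) /= h.
have mS := simple_strongly_measurable (ss n).
apply: (@le_lt_trans _ _ (\int[mu]_w `|f w - s n w|%:E + int1 (s n))%E).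
  apply: (@integral_norm_leD (fun w => f w - s n w) (s n) f) => //.
    exact: strongly_measurableB.
  by move=> w; rewrite -{1}(subrK (s n w) (f w)) ler_normD.
apply: lte_add_pinfty; first by rewrite (le_lt_trans h)// ltry.
have /simple_functionP fs := ss n.
rewrite (integral_finitely_valued mu fs measurableT (strongly_measurable_norm mS))//.
apply: lte_sum_pinfty => x _.
rewrite setTI (eq_integral (fun=> `|x|%:E)).
  rewrite integral_cst_on; last exact: fs.2.
  rewrite lte_mul_pinfty//.
  by rewrite -ge0_fin_numE// fin_num_measure//; exact: fs.2.
by move=> w /set_mem /= ->.
Qed.

Lemma has_bochner_integral_exists f : bochner_integrable mu f ->
  exists v, has_bochner_integral mu f v.
Proof.
move=> intf; have [s [ss sf]] := simple_approximation intf.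
have mf := intf.1.
have mS n : SM (s n) := simple_strongly_measurable (ss n).
have fs n : finitely_valued (s n) by exact/simple_functionP.
have /cvg_ex[v sv] : cvgn (fun n => simple_integral mu (s n)).
  apply/cvgn_tailP => e e0; have e30 : 0 < e / 3 by rewrite divr_gt0.
  have /cvge0P /(_ _ e30) : (\int[mu]_w `|f w - s n w|%:E)%E @[n --> \oo] --> 0%E by exact: sf.
  case; first by move=> i; exact: integral_ge0.
  move=> N _ HN; exists N => n Nn.
  have := simple_integral_norm mu
    (finitely_valued_comp (fun p => p.1 + (-1) *: p.2) (finitely_valued_pair (fs n) (fs N))).
  rewrite [simple_integral _ _](simple_integral_lin mu (-1) (fs n) (fs N)) scaleN1r.
  move=> H; rewrite -lte_fin (le_lt_trans H)//.
  apply: (@le_lt_trans _ _ ((e / 3)%:E + (e / 3)%:E)%E); last by rewrite -EFinD lte_fin; lra.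
  have h1 := HN _ Nn; have h2 := HN _ (leqnn N); apply: le_trans (leeD h1 h2).
  apply: (@integral_norm_leD (fun w => f w - s n w) (fun w => f w - s N w)); try exact: strongly_measurableB.
    exact: (strongly_measurableD (mS n) (strongly_measurableZ (-1) (mS N))).
  move=> w /=; rewrite scaleN1r [X in _ <= X + _]distrC.
  by rewrite -{1}(subrK (f w) (s n w)) -addrA ler_normD.
by exists v; split=> //; exists s.
Qed.

(** In particular a limit in mean of integrable functions is integrable. *)
Lemma bochner_integrable_close f g : SM f -> bochner_integrable mu g ->
  (int1 (fun w => f w - g w)%R < +oo)%E -> bochner_integrable mu f.
Proof.
move=> mf [mg gf] fg; split=> //.
apply: le_lt_trans (lte_add_pinfty fg gf).
apply: integral_norm_leD => //; first exact: strongly_measurableB.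
by move=> w; rewrite -{1}(subrK (g w) (f w)) ler_normD.
Qed.

Local Notation B := (bochner_integral mu).

Lemma bochner_integralP f : bochner_integrable mu f -> has_bochner_integral mu f (B f).
Proof. by move=> /has_bochner_integral_exists fv; rewrite /bochner_integral; apply: xgetPex. Qed.

Lemma bochner_integralE f v : has_bochner_integral mu f v -> B f = v.
Proof.
move=> fv; apply: has_bochner_integral_uniq (fv).
by apply: bochner_integralP; exact: has_bochner_integral_integrable fv.
Qed.

Lemma bochner_integral_lin (c : R) f g : bochner_integrable mu f -> bochner_integrable mu g ->
  B (fun w => f w + c *: g w) = B f + c *: B g.
Proof.
move=> intf intg; apply: bochner_integralE.
by apply: has_bochner_integral_lin; exact: bochner_integralP.
Qed.

Lemma bochner_integralB f g : bochner_integrable mu f -> bochner_integrable mu g ->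
  B (fun w => f w - g w) = B f - B g.
Proof.
move=> intf intg; rewrite -scaleN1r -(bochner_integral_lin (-1) intf intg).
by congr B; apply/funext => w; rewrite scaleN1r.
Qed.

Lemma bochner_integral_norm f : bochner_integrable mu f -> (`|B f|%:E <= int1 f)%E.
Proof. by move=> intf; apply: has_bochner_integral_norm; exact: bochner_integralP. Qed.

Lemma bochner_integrableB f g : bochner_integrable mu f -> bochner_integrable mu g ->
  bochner_integrable mu (fun w => f w - g w).
Proof.
move=> intf intg; have := bochner_integrable_lin (-1) intf intg.
by under eq_fun do rewrite scaleN1r.
Qed.

Lemma bochner_integrable_simple s : finitely_valued s -> bochner_integrable mu s.
Proof. by move=> fs; exact: has_bochner_integral_integrable (has_bochner_integral_simple fs). Qed.

Lemma bochner_integrable_restrict A f : measurable A -> bochner_integrable mu f ->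
  bochner_integrable mu (fun w => \1_A w *: f w).
Proof.
move=> mA intf; apply: (bochner_integrableW intf).
  by apply: strongly_measurable_restrict => //; case: intf.
move=> w; rewrite normrZ ger0_norm// indicE; case: (_ \in _); rewrite ?mul1r// mul0r//.
Qed.

Lemma integral_norm_restrict A f : measurable A ->
  (\int[mu]_w `|\1_A w *: f w|%:E = \int[mu]_(w in A) `|f w|%:E)%E.
Proof.
move=> mA; rewrite -[RHS]integral_indicM//; apply: eq_integral => w _.
by rewrite normrZ ger0_norm.
Qed.

Lemma bochner_integral_on_norm A f : measurable A -> bochner_integrable mu f ->
  (`|bochner_integral_on mu A f|%:E <= \int[mu]_(w in A) `|f w|%:E)%E.
Proof.
move=> mA intf; rewrite -integral_norm_restrict//; apply: bochner_integral_norm.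
exact: bochner_integrable_restrict.
Qed.

Lemma bochner_integral_onB A f g : measurable A ->
  bochner_integrable mu f -> bochner_integrable mu g ->
  bochner_integral_on mu A (fun w => f w - g w) =
  bochner_integral_on mu A f - bochner_integral_on mu A g.
Proof.
move=> mA intf intg; rewrite -bochner_integralB; try exact: bochner_integrable_restrict.
by congr bochner_integral; apply/funext => w; rewrite scalerBr.
Qed.

Lemma bochner_integral_on_cvg A (g : nat -> T -> X) f : measurable A ->
  bochner_integrable mu f -> (forall n, bochner_integrable mu (g n)) ->
  (int1 (fun w => f w - g n w)%R @[n --> \oo] --> 0)%E ->
  bochner_integral_on mu A (g n) @[n --> \oo] --> bochner_integral_on mu A f.
Proof.
move=> mA intf intg /cvge0P gf; apply/cvgrPdist_le => e e0.
have /gf/(_ e e0) : forall n, (0 <= int1 (fun w => f w - g n w)%R)%E.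
  by move=> n; exact: integral_ge0.
apply: filterS => n; rewrite -lee_fin; apply: le_trans.
rewrite -bochner_integral_onB//; have intd := bochner_integrableB intf (intg n).
apply: le_trans (bochner_integral_on_norm mA intd) _.
apply: ge0_subset_integral => //; apply/measurable_EFinP.
by apply: strongly_measurable_norm; case: intd.
Qed.

Lemma bochner_integral_on_lim A (g : nat -> T -> X) f v N : measurable A ->
  bochner_integrable mu f -> (forall n, bochner_integrable mu (g n)) ->
  (int1 (fun w => f w - g n w)%R @[n --> \oo] --> 0)%E ->
  (forall n, (N <= n)%N -> bochner_integral_on mu A (g n) = v) ->
  bochner_integral_on mu A f = v.
Proof.
move=> mA intf intg gf gv; have := bochner_integral_on_cvg mA intf intg gf.
move/(cvg_unique _); apply; first exact: norm_hausdorff.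
by apply: cvg_near_cst; exists N.
Qed.

Lemma bochner_integral_on_cst A (x : X) : measurable A ->
  bochner_integral_on mu A (fun=> x) = fine (mu A) *: x :> X.
Proof.
move=> mA; have fA := finitely_valued_mem mA.
have -> : bochner_integral_on mu A (fun=> x) = B ((fun b : bool => if b then x else 0) \o (fun w => w \in A)).
  congr bochner_integral; apply/funext => w /=; rewrite indicE.
  by case: (w \in A); rewrite ?scale1r ?scale0r.
rewrite (bochner_integralE (has_bochner_integral_simple (finitely_valued_comp _ fA))).
rewrite simple_integral_comp// (@fsbig_widen _ _ _ _ _ setT)//; last first.
  move=> b /= [_ nb]; rewrite (_ : _ @^-1` _ = set0) ?measure0 ?scale0r//.
  by rewrite -subset0 => w /= wb; apply: nb; exists w.
rewrite (@fsbigE _ _ _ _ _ [:: true; false])//=; last by case.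
  rewrite !big_cons big_nil !in_setT scaler0 !addr0; congr (fine (mu _) *: _).
  by apply/seteqP; split=> w /=; [move=> /set_mem|move=> /mem_set].
Qed.

End BochnerIntegralTheory.

(** * Conditional probabilities *)

Section TraceMeasure.
Context {d : measure_display} {T : measurableType d} {R : realType}.
Variable mu : {finite_measure set T -> \bar R}.
Variable F : set (set T).

(** The restriction to [F] of the measure [A |-> mu (A `&` B)]; its density
    with respect to the restriction of [mu] to [F] is the conditional
    probability of [B]. The proofs are arguments of the definition because
    the measure structure declared on it is inferred from its form. *)
Definition trace_measure (subF : is_sub_sigma_algebra F) (B : set T)
  (mB : measurable B) (A : set (g_sigma_algebraType F)) : \bar R := mu (A `&` B).

Hypothesis subF : is_sub_sigma_algebra F.
Variable B : set T.
Hypothesis mB : measurable B.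

Local Notation nu := (trace_measure subF mB).

Lemma sub_measurable (A : set (g_sigma_algebraType F)) :
  measurable A -> measurable (A : set T).
Proof. by rewrite measurable_sub//; exact: subF.2. Qed.

Let nu0 : nu set0 = 0%E. Proof. by rewrite /trace_measure set0I measure0. Qed.

Let nu_ge0 A : (0 <= nu A)%E. Proof. exact: measure_ge0. Qed.

Let nu_semi_sigma_additive : semi_sigma_additive nu.
Proof.
move=> A mA tA mUA; rewrite /trace_measure setI_bigcupl.
apply: measure_semi_sigma_additive.
- by move=> n; apply: measurableI => //; exact: sub_measurable (mA n).
- exact: trivIset_setIr.
- by rewrite -setI_bigcupl; apply: measurableI => //; exact: sub_measurable mUA.
Qed.

HB.instance Definition _ := isMeasure.Build _ (g_sigma_algebraType F) R
  nu nu0 nu_ge0 nu_semi_sigma_additive.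

Let nu_fin : fin_num_fun nu.
Proof.
move=> A mA; apply: fin_num_measure; apply: measurableI => //.
exact: sub_measurable mA.
Qed.

HB.instance Definition _ := @Measure_isFinite.Build _ (g_sigma_algebraType F) R nu nu_fin.

End TraceMeasure.

Section SubIntegral.
Import HBNNSimple.
Context {d : measure_display} {T : measurableType d} {R : realType}.
Variable mu : {finite_measure set T -> \bar R}.
Variable F : set (set T).
Hypothesis subF : is_sub_sigma_algebra F.

Definition is_conditional_probability (B : set T) (k : T -> R) : Prop :=
  [/\ @measurable_fun _ _ (g_sigma_algebraType F) _ setT k, forall w, 0 <= k w &
    forall A, F A -> (\int[mu]_(w in A) (k w)%:E = mu (A `&` B))%E].

Lemma integral_trace (A : set T) (f : T -> \bar R) : F A ->
  @measurable_fun _ _ (g_sigma_algebraType F) _ setT f -> (forall w, 0 <= f w)%E ->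
  (\int[trace_measure mu subF measurableT]_(w in A) f w = \int[mu]_(w in A) f w)%E.
Proof.
move=> FA mf f0.
have mid : measurable_fun setT (idfun : T -> g_sigma_algebraType F).
  move=> _ C mC; rewrite setTI; exact: (sub_measurable subF mC).
have FA' : measurable (A : set (g_sigma_algebraType F)) by rewrite measurable_sub.
rewrite -[RHS](@ge0_integral_pushforward _ _ _ _ _ _ mid mu A f)//; last first.
  exact: (@measurable_funTS _ _ (g_sigma_algebraType F)).
apply: eq_measure_integral => C mC _.
by rewrite /= /trace_measure setIT.
Qed.

Lemma conditional_probability_exists (B : set T) : measurable B ->
  exists k : T -> R, is_conditional_probability B k.
Proof.
move=> mB.
have dom : trace_measure mu subF mB `<< trace_measure mu subF measurableT.
  apply/null_content_dominatesP => A mA; rewrite /= /trace_measure setIT => A0.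
  have mA' := sub_measurable subF mA.
  by apply: subset_measure0 A0 => //; exact: measurableI.
have [f [f0 ff fi fE]] := radon_nikodym_sigma_finite dom.
have mfk : @measurable_fun _ _ (g_sigma_algebraType F) _ setT (fine \o f).
  apply: measurableT_comp => //; exact: measurable_int fi.
exists (fine \o f); split => // [w|A FA]; first by rewrite fine_ge0.
have FA' : measurable (A : set (g_sigma_algebraType F)) by rewrite measurable_sub.
have := fE A FA'; rewrite /= {1}/trace_measure => ->.
rewrite -[LHS]integral_trace//; first by apply: eq_integral => w _; rewrite fineK.
- by apply/measurable_EFinP.
- by move=> w; rewrite lee_fin fine_ge0.
Qed.

(** A weight measurable for [F] is an increasing limit of simple functions
    whose fibres lie in [F], and on these fibres the hypothesis applies. *)
Lemma weighted_integral_le (a b phi : T -> R) :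
  measurable_fun setT a -> measurable_fun setT b ->
  (forall w, 0 <= a w) -> (forall w, 0 <= b w) ->
  (forall A, F A -> \int[mu]_(w in A) (a w)%:E <= \int[mu]_(w in A) (b w)%:E)%E ->
  @measurable_fun _ _ (g_sigma_algebraType F) _ setT phi -> (forall w, 0 <= phi w) ->
  (\int[mu]_w (phi w * a w)%:E <= \int[mu]_w (phi w * b w)%:E)%E.
Proof.
move=> ma mb a0 b0 ab mphi phi0.
have mphi' := measurable_fun_sub subF mphi.
have mephi : @measurable_fun _ _ (g_sigma_algebraType F) _ setT (EFin \o phi) by exact/measurable_EFinP.
pose s := @nnsfun_approx _ (g_sigma_algebraType F) R setT measurableT (EFin \o phi) mephi.
have sphi w : (s n w)%:E @[n --> \oo] --> (phi w)%:E.
  apply: (@cvg_nnsfun_approx _ (g_sigma_algebraType F) R setT measurableT (EFin \o phi) mephi) => // v _.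
  by rewrite lee_fin.
have nds := @nd_nnsfun_approx _ (g_sigma_algebraType F) R setT measurableT (EFin \o phi) mephi.
have s0 n w : 0 <= s n w by [].
have ms' n : @measurable_fun _ _ (g_sigma_algebraType F) _ setT (s n) by [].
have ms n : measurable_fun setT (s n : T -> R) := measurable_fun_sub subF (ms' n).
have sle n w : s n w <= phi w.
  rewrite -lee_fin /s nnsfun_approxE.
  by apply: (@le_approx _ (g_sigma_algebraType F) R setT (EFin \o phi)) => // v _; rewrite lee_fin.
have -> : (\int[mu]_w (phi w * a w)%:E = \int[mu]_w limn (fun n => (s n w * a w)%:E))%E.
  apply: eq_integral => w _; apply/esym/cvg_lim => //.
  under eq_fun do rewrite EFinM.
  by rewrite EFinM; apply: cvgeZr => //; exact: sphi.
have cvs := @cvg_monotone_convergence _ T R mu setT measurableT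
  (fun n w => (s n w * a w)%:E).
have {cvs} : (\int[mu]_w (s n w * a w)%:E)%E @[n --> \oo] -->
    (\int[mu]_w limn (fun n => (s n w * a w)%:E))%E.
  apply: cvs.
  - by move=> n; apply/measurable_EFinP; exact: measurable_funM.
  - by move=> n w _; rewrite lee_fin mulr_ge0.
  - move=> w _ m n mn; rewrite lee_fin ler_wpM2r//; have /lefP := nds _ _ mn; exact.
move=> cvs; have /cvg_lim <- // := cvs.
apply: lime_le; first by apply/cvg_ex; eexists; exact: cvs.
near=> n.
apply: (@le_trans _ _ (\int[mu]_w (s n w * b w)%:E)%E); last first.
  apply: integral_le => //; try exact: measurable_funM.
  - by move=> w _; rewrite mulr_ge0.
  - by move=> w _; rewrite ler_wpM2r.
have fs : finitely_valued (s n : T -> R).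
  split; first exact: (@fimfunP (g_sigma_algebraType F) R (s n)).
  move=> C; rewrite -[_ @^-1` _]setTI; apply: (sub_measurable subF).
  have fs' : @finitely_valued _ (g_sigma_algebraType F) _ (s n).
    by apply: finitely_valuedP => //; exact: (@fimfunP (g_sigma_algebraType F) R (s n)).
  by rewrite setTI; exact: fs'.2.
have mM (c : T -> R) : @measurable_fun _ _ T R setT c ->
    @measurable_fun _ _ T R setT (fun w : T => s n w * c w).
  by move=> mc; exact: (@measurable_funM _ T R setT (s n) c (ms n) mc).
rewrite (integral_finitely_valued mu fs measurableT (mM _ ma)); last by move=> w; exact: mulr_ge0.
rewrite (integral_finitely_valued mu fs measurableT (mM _ mb)); last by move=> w; exact: mulr_ge0.
rewrite !big_seq; apply: lee_sum => x; rewrite in_fset_set; last exact: fs.1.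
move=> /set_mem [w0 _ sx].
have x0 : 0 <= x by rewrite -sx.
rewrite setTI.
have E (c : T -> R) : measurable_fun setT c -> (forall w, 0 <= c w) ->
  (\int[mu]_(w in s n @^-1` [set x]) (s n w * c w)%:E =
  x%:E * \int[mu]_(w in s n @^-1` [set x]) (c w)%:E)%E.
  move=> mc c0; rewrite -integral_scale//; last exact: fs.2.
  by apply: eq_integral => w /set_mem /= ->.
rewrite !E// lee_wpmul2l ?lee_fin//.
apply: ab; apply: (measurable_fun_subF subF (ms' n)).
exact: measurable_set1.
Unshelve. all: by end_near. Qed.

End SubIntegral.

(** * Completeness in mean *)

Section PowerLimits.
Context {R : realType}.
Variable p : R.
Hypothesis p1 : 1 <= p.

Lemma cvg_powR {I : Type} (G : set_system I) {FG : Filter G} (u : I -> R) (l : R) :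
  (forall i, 0 <= u i) -> 0 <= l -> u i @[i --> G] --> l -> u i `^ p @[i --> G] --> l `^ p.
Proof.
move=> u0; rewrite le_eqVlt => /predU1P[<- ul|l0 ul].
  rewrite powR0; first exact: (cvg0_powR p1).
  by rewrite gt_eqF// (lt_le_trans ltr01).
apply: (@cvg_comp _ _ _ u (fun x => x `^ p) _ _ _ ul).
have : derivable (fun x : R => x `^ p) l 1.
  by apply: derivable_powR; rewrite in_itv/= l0.
by move=> /derivable1_diffP/differentiable_continuous.
Qed.

End PowerLimits.

Section Fatou.
Context {d : measure_display} {T : measurableType d} {R : realType}
  {X : completeNormedModType R}.
Variable mu : {finite_measure set T -> \bar R}.
Implicit Types (f : T -> X).

Local Notation SM := (@strongly_measurable d T R X measurable).

Lemma moment_fatou p (u : nat -> T -> X) f (C : \bar R) : 1 <= p ->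
  (forall n, SM (u n)) -> SM f ->
  {ae mu, forall w, u n w @[n --> \oo] --> f w} ->
  (\forall n \near \oo, (moment mu p (u n) <= C)%E) -> (moment mu p f <= C)%E.
Proof.
move=> p1 mU mf uf uC.
have mm n : measurable_fun setT (fun w => (`|u n w| `^ p)%:E).
  by apply/measurable_EFinP; exact: measurable_moment.
have [N [mN N0 Nuf]] := uf.
have mTN : measurable ([set: T] `\` N) by exact: measurableD.
have -> : moment mu p f = (\int[mu]_(w in [set: T] `\` N) (`|f w| `^ p)%:E)%E.
  apply: ge0_negligible_integral => //.
  - by apply/measurable_EFinP; exact: measurable_moment.
have -> : (\int[mu]_(w in [set: T] `\` N) (`|f w| `^ p)%:E =
    \int[mu]_(w in [set: T] `\` N) limn_einf (fun n => (`|u n w| `^ p)%:E))%E.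
  apply: eq_integral => w /set_mem [_ Nw].
  have {}uf : u n w @[n --> \oo] --> f w by apply: contrapT => /Nuf.
  have cu : (`|u n w| `^ p)%:E @[n --> \oo] --> (`|f w| `^ p)%:E.
    apply/cvg_EFin; first exact: filterE.
    by apply: (cvg_powR p1) => //=; exact: cvg_norm.
  by rewrite is_cvg_limn_einfE; [move/cvg_lim : cu => ->|apply/cvg_ex; eexists; exact: cu].
apply: le_trans (fatou mu mTN _ _) _.
- by move=> n; apply: measurable_funTS.
- by move=> n w _; rewrite lee_fin powR_ge0.
rewrite limn_einf_lim; apply: lime_le; first exact: is_cvg_einfs.
apply: filterS (nbhs_infty_ge 0%N) => n _.
have [M _ HM] := uC.
apply: (@le_trans _ _ (moment mu p (u (maxn n M)))); last by apply: HM; rewrite /= leq_maxr.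
apply: (@le_trans _ _ (\int[mu]_(w in [set: T] `\` N) (`|u (maxn n M) w| `^ p)%:E)%E).
  by apply: ereal_inf_lbound; exists (maxn n M) => //=; rewrite leq_maxl.
apply: ge0_subset_integral => // w _; rewrite lee_fin powR_ge0//.
Qed.

End Fatou.

Section FastCauchy.
Context {d : measure_display} {T : measurableType d} {R : realType}
  {X : completeNormedModType R}.
Variable mu : {finite_measure set T -> \bar R}.
Implicit Types (f g s : T -> X).

Local Notation SM := (@strongly_measurable d T R X measurable).
Local Notation int1 f := (\int[mu]_w `|f w|%:E)%E.

Lemma cvgn_summable (u : nat -> X) :
  (\sum_(0 <= n <oo) `|u n.+1 - u n|%:E < +oo)%E -> cvgn u.
Proof.
move=> s_lty; set s := (\sum_(0 <= n <oo) _)%E in s_lty.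
have s_fin : s \is a fin_num.
  by rewrite ge0_fin_numE//; apply: nneseries_ge0 => n _ _; rewrite lee_fin.
have /normed_cvg : cvgn [normed series (telescope u)].
  apply: nondecreasing_is_cvgn.
    apply: nondecreasing_series => n _ _ /=; exact: normr_ge0.
  exists (fine s) => _ [n _ <-]; rewrite -lee_fin fineK// /series/= -sumEFin.
  by apply: nneseries_lim_ge => k _ _; rewrite lee_fin.
rewrite telescopeK => cu.
rewrite (_ : u = (fun n => (u n - u 0%N) + u 0%N)); last by apply/funext => n; rewrite subrK.
by apply: is_cvgD => //; exact: is_cvg_cst.
Qed.

Lemma expr2_sum_le (n m : nat) :
  \sum_(n <= j < m) 2^-1 ^+ j <= 2 * 2^-1 ^+ n :> R.
Proof.
have [nm|/ltnW mn] := leqP n m; last by rewrite big_geq// mulr_ge0.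
have : \sum_(n <= j < m) 2^-1 ^+ j = 2 * 2^-1 ^+ n - 2 * 2^-1 ^+ m :> R.
  elim: m nm => [|m ih]; first by rewrite leqn0 => /eqP ->; rewrite big_geq// subrr.
  rewrite leq_eqVlt => /predU1P[->|nm]; first by rewrite big_geq// subrr.
  by rewrite big_nat_recr//= ih// exprS; field.
by move=> ->; rewrite gerBl mulr_ge0.
Qed.

Lemma cvge0_geometric (u : nat -> \bar R) (c : R) : (forall n, (0 <= u n)%E) ->
  (forall n, (u n <= (c * 2^-1 ^+ n)%:E)%E) -> u n @[n --> \oo] --> 0%E.
Proof.
move=> u0 uc; apply: (@squeeze_cvge _ _ _ _ (fun=> 0%E) _ (fun n => (c * 2^-1 ^+ n)%:E)).
- by apply: nearW => n; rewrite u0 uc.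
- exact: cvg_cst.
- apply/cvg_EFin; first exact: filterE.
  rewrite -(mulr0 c); apply: cvgM; first exact: cvg_cst.
  by apply: cvg_expr; rewrite ger0_norm// invf_lt1// ltr1n.
Qed.

Lemma fast_cauchy_integral (u : nat -> T -> X) n m : (n <= m)%N -> (forall n, SM (u n)) ->
  (forall n, int1 (fun w => u n.+1 w - u n w)%R <= (2^-1 ^+ n)%:E)%E ->
  (int1 (fun w => u m w - u n w)%R <= (2 * 2^-1 ^+ n)%:E)%E.
Proof.
move=> nm mU uE.
apply: (@le_trans _ _ (\sum_(n <= j < m) 2^-1 ^+ j)%:E); last by rewrite lee_fin expr2_sum_le.
elim: m nm => [|m ih].
  rewrite leqn0 => /eqP ->; rewrite big_geq//.
  by under eq_integral do rewrite subrr normr0; rewrite integral0.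
rewrite leq_eqVlt => /predU1P[->|nm].
  by rewrite big_geq//; under eq_integral do rewrite subrr normr0; rewrite integral0.
rewrite big_nat_recr//= EFinD; apply: le_trans (leeD (ih nm) (uE m)).
apply: (@integral_norm_leD _ _ _ _ mu (fun w => u m w - u n w) (fun w => u m.+1 w - u m w)).
- exact: strongly_measurableB.
- exact: strongly_measurableB.
- exact: strongly_measurableB.
- by move=> w; rewrite [leRHS]addrC -{1}(subrK (u m w) (u m.+1 w)) -addrA ler_normD.
Qed.

Lemma fast_cauchy_ae (u : nat -> T -> X) : (forall n, SM (u n)) ->
  (forall n, int1 (fun w => u n.+1 w - u n w)%R <= (2^-1 ^+ n)%:E)%E ->
  {ae mu, forall w, cvgn (fun n => u n w)}.
Proof.
move=> mU uE.
have mh n : measurable_fun setT (fun w => `|u n.+1 w - u n w|%:E).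
  by apply/measurable_EFinP; apply: strongly_measurable_norm; exact: strongly_measurableB.
pose h w := (\sum_(0 <= n <oo) `|u n.+1 w - u n w|%:E)%E.
have ih : mu.-integrable setT h.
  apply/integrableP; split.
    by apply: ge0_emeasurable_sum => // n w _ _; rewrite lee_fin.
  under eq_integral do rewrite gee0_abs ?nneseries_ge0//.
  rewrite integral_nneseries//.
  apply: (@le_lt_trans _ _ 2%:E); last exact: ltry.
  apply: lime_le.
    by apply: is_cvg_nneseries => n _ _; exact: integral_ge0.
  apply: nearW => n.
  apply: (@le_trans _ _ (\sum_(0 <= j < n) 2^-1 ^+ j)%:E).
    by rewrite -sumEFin; apply: lee_sum => j _; exact: uE.
  by rewrite lee_fin (le_trans (expr2_sum_le _ _))// expr0 mulr1.
have := integrable_ae measurableT ih; apply: filterS => w /(_ I) hw.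
apply: cvgn_summable; rewrite -/(h w) -ge0_fin_numE//.
by apply: nneseries_ge0 => n _ _; rewrite lee_fin.
Qed.

(** Completeness of the space of integrable functions measurable for [F].
    Since the distances of consecutive terms are summable, the sum of the
    increments is integrable, hence finite almost everywhere, and the limit
    exists there. With the value 0 elsewhere the limit is measurable for [F]
    itself, and not only up to a null set. *)
Lemma fast_cauchy_complete (F : set (set T)) (u : nat -> T -> X) :
  is_sub_sigma_algebra F -> (forall n, strongly_measurable F (u n)) ->
  (forall n, int1 (fun w => u n.+1 w - u n w)%R <= (2^-1 ^+ n)%:E)%E ->
  exists g, [/\ strongly_measurable F g,
    {ae mu, forall w, u n w @[n --> \oo] --> g w} &
    forall n, (int1 (fun w => g w - u n w)%R <= (2 * 2^-1 ^+ n)%:E)%E].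
Proof.
move=> subF mFu uE.
have mU n : SM (u n) by apply: sub_strongly_measurable (mFu n).
pose D := [set w | cvgn (fun n => u n w)].
pose g w := if w \in D then limn (fun n => u n w) else 0.
have mFg : strongly_measurable F g.
  apply/(strongly_measurable_subE subF).
  apply: (@strongly_measurable_lim _ (g_sigma_algebraType F)) => n.
  exact/(strongly_measurable_subE subF).
have mg : SM g by exact: sub_strongly_measurable mFg.
have ug : {ae mu, forall w, u n w @[n --> \oo] --> g w}.
  apply: filterS (fast_cauchy_ae mU uE) => w uw.
  by rewrite /g mem_set.
exists g; split=> // n; rewrite -moment1.
apply: (moment_fatou (u := fun m w => u m w - u n w)) => //.
- by move=> m; exact: strongly_measurableB.
- exact: strongly_measurableB.
- by apply: filterS ug => w uw; apply: cvgB => //; exact: cvg_cst.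
- by exists n => // m /= nm; rewrite moment1; exact: fast_cauchy_integral.
Qed.

End FastCauchy.

(** * Conditional expectation of vector-valued functions *)

Section TotalVariation.
Context {d : measure_display} {T : measurableType d} {R : realType}
  {X : completeNormedModType R}.
Variable mu : {finite_measure set T -> \bar R}.
Variable F : set (set T).
Hypothesis subF : is_sub_sigma_algebra F.
Implicit Types (g s t : T -> X) (A : set T).

Local Notation SM := (@strongly_measurable d T R X measurable).

Lemma sub_simple_approximation g : strongly_measurable F g ->
  exists s : nat -> T -> X, [/\ forall n, simple_function F (s n),
    forall w, s n w @[n --> \oo] --> g w & forall n w, `|s n w| <= 2 * `|g w|].
Proof.
move=> /(strongly_measurable_subE subF) /dominated_simple_approximation.
by rewrite (measurable_sub subF).
Qed.

(** The variation of the vector measure [A |-> \int_A g] is [\int_A `|g|],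
    so a bound on its values by a positive measure is also a bound on its
    variation. Indeed, if [t] is simple and close to [g] in mean, then on
    each fibre of [t] the function [g] is nearly a constant [x], and the
    integral of the norm nearly equals the norm of the integral; these bounds
    are added over the fibres. Every contraction property of conditional
    expectations comes from this lemma. *)
Lemma strong_variation_le g (h : T -> R) : strongly_measurable F g ->
  (\int[mu]_w `|g w|%:E < +oo)%E -> measurable_fun setT h -> (forall w, 0 <= h w) ->
  (forall A, F A -> `|bochner_integral_on mu A g|%:E <= \int[mu]_(w in A) (h w)%:E)%E ->
  forall A, F A -> (\int[mu]_(w in A) `|g w|%:E <= \int[mu]_(w in A) (h w)%:E)%E.
Proof.
move=> mFg ig mh h0 gh A FA.
have mA : measurable A := subF.2 _ FA.
have mg : SM g := sub_strongly_measurable subF mFg.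
have intg : bochner_integrable mu g by [].
have [s [ss sg s2]] := sub_simple_approximation mFg.
have mS n : SM (s n).
  apply: simple_strongly_measurable; have [fs ms] := ss n; split => // x.
  exact: subF.2.
have : moment mu 1 (fun w => g w - s n w) @[n --> \oo] --> 0%E.
  by apply: moment_cvg0 => //; rewrite moment1.
move/cvge0P => H; apply/lee_addgt0Pr => e e0.
have e20 : 0 < e / 2 by rewrite divr_gt0.
have [N _ /(_ N (leqnn N)) /=] := H (fun=> moment_ge0 _ _ _) _ e20.
rewrite moment1 => HN {H}; set t := s N in HN *.
have mt : SM t := mS N.
have mgt : measurable_fun setT (fun w => `|g w - t w|).
  by apply: strongly_measurable_norm; exact: strongly_measurableB.
have gtA : (\int[mu]_(w in A) `|g w - t w|%:E <= (e / 2)%:E)%E.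
  apply: le_trans HN; apply: ge0_subset_integral => //.
  exact/measurable_EFinP.
apply: (@le_trans _ _ (\int[mu]_(w in A) `|t w|%:E + \int[mu]_(w in A) `|g w - t w|%:E)%E).
  apply: integral_leD => //; try exact: strongly_measurable_norm.
  by move=> w _; rewrite -{1}(subrK (t w) (g w)) addrC ler_normD.
rewrite [X in (_ <= _ + X%:E)%E](splitr e) EFinD addeA; apply: leeD => //.
apply: le_trans (leeD2l _ gtA).
have ft : finitely_valued t.
  by apply/simple_functionP; have [fs ms] := ss N; split => // x; exact: subF.2.
rewrite (integral_finitely_valued mu ft mA (strongly_measurable_norm mt))//.
rewrite (integral_finitely_valued mu ft mA mh)//.
rewrite (integral_finitely_valued mu ft mA mgt)//.
rewrite -big_split/=; apply: lee_sum => x _.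
have FAx : F (A `&` t @^-1` [set x]).
  rewrite -(measurable_sub subF); apply: measurableI; rewrite measurable_sub//.
  exact: (ss N).2.
have mAx := subF.2 _ FAx; set Ax := _ `&` _ in FAx mAx *.
have -> : (\int[mu]_(w in Ax) `|t w|%:E = `|bochner_integral_on mu Ax (fun=> x)|%:E)%E.
  rewrite bochner_integral_on_cst// normrZ ger0_norm ?fine_ge0// EFinM fineK ?fin_num_measure//.
  rewrite (eq_integral (fun=> `|x|%:E)); first by rewrite integral_cst_on// muleC.
  by move=> w /set_mem [_ /= ->].
have -> : (\int[mu]_(w in Ax) `|g w - t w|%:E = \int[mu]_(w in Ax) `|x - g w|%:E)%E.
  by apply: eq_integral => w /set_mem [_ /= ->]; rewrite distrC.
apply: le_trans (leeD2r _ (gh _ FAx)).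
have intx : bochner_integrable mu (fun=> x : X).
  exact: bochner_integrable_simple (finitely_valued_comp (fun=> x) (finitely_valued_mem measurableT)).
apply: le_trans (leeD2l _ (bochner_integral_on_norm mAx (bochner_integrableB intx intg))).
rewrite -EFinD lee_fin bochner_integral_onB//.
by rewrite addrC -{1}(subrK (bochner_integral_on mu Ax g) (bochner_integral_on mu Ax (fun=> x))) ler_normD.
Qed.

End TotalVariation.

Section ScaledVectors.
Import HBNNSimple.
Context {d : measure_display} {T : measurableType d} {R : realType}
  {X : completeNormedModType R}.
Variable mu : {finite_measure set T -> \bar R}.

Lemma has_bochner_integral_scaled (phi : T -> R) (x : X) :
  measurable_fun setT phi -> (forall w, 0 <= phi w) ->
  (\int[mu]_w (phi w)%:E < +oo)%E ->
  has_bochner_integral mu (fun w => phi w *: x) (fine (\int[mu]_w (phi w)%:E)%E *: x).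
Proof.
move=> mphi phi0 iphi.
have mx : @strongly_measurable _ T R X measurable (fun w => phi w *: x).
  by apply: strongly_measurable_scale => //; exact: strongly_measurable_cst.
split=> //.
have mephi : measurable_fun setT (EFin \o phi) by exact/measurable_EFinP.
pose s := nnsfun_approx measurableT mephi.
have sphi w : (s n w)%:E @[n --> \oo] --> (phi w)%:E.
  apply: (@cvg_nnsfun_approx _ _ _ _ measurableT (EFin \o phi) mephi) => // v _.
  by rewrite lee_fin.
have sle n w : s n w <= phi w.
  rewrite -lee_fin /s nnsfun_approxE.
  by apply: (@le_approx _ _ _ setT (EFin \o phi)) => // v _; rewrite lee_fin.
have fs n : finitely_valued (s n).
  by apply: finitely_valuedP => //; exact: fimfunP.
have fsx n : finitely_valued (fun w => s n w *: x).
  exact: (finitely_valued_comp (fun r : R => r *: x) (fs n)).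
have scvg w : s n w *: x @[n --> \oo] --> phi w *: x.
  apply: cvgZ; last exact: cvg_cst.
  by have /fine_cvg := sphi w.
exists (fun n w => s n w *: x); split.
- by move=> n; exact/simple_functionP.
- under eq_fun do rewrite -moment1.
  apply: moment_cvg0 => //.
  + by move=> n; apply: simple_strongly_measurable; exact/simple_functionP.
  + move=> n w; rewrite !normrZ !ger0_norm// mulrA ler_wpM2r//.
    by rewrite (le_trans (sle n w))// mulr_natl mulr2n lerDl.
  + rewrite moment1; under eq_integral do rewrite normrZ ger0_norm// mulrC.
    by rewrite integral_scale// lte_mul_pinfty.
- have si n : simple_integral mu (fun w => s n w *: x) = fine (\int[mu]_w (s n w)%:E)%E *: x.
    rewrite (simple_integral_comp mu (fun r : R => r *: x) (fs n)).
    rewrite integralT_nnsfun sintegralE.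
    rewrite (eq_fsbigr (fun y => (y * fine (mu (s n @^-1` [set y])))%:E)); last first.
      by move=> y _; rewrite EFinM fineK// fin_num_measure//; exact: (fs n).2.
    rewrite fsumEFin; last exact: (fs n).1.
    rewrite /= !fsbig_finite; try exact: (fs n).1.
    by rewrite scaler_suml; apply: eq_bigr => y _; rewrite scalerA mulrC.
  rewrite (_ : (fun n => _) = (fun n => fine (\int[mu]_w (s n w)%:E)%E *: x)); last exact/funext.
  apply: cvgZ; last exact: cvg_cst.
  apply: fine_cvg; rewrite fineK; last first.
    by rewrite ge0_fin_numE//; apply: integral_ge0 => w _; rewrite lee_fin.
  have := @cvg_monotone_convergence _ T R mu setT measurableT (fun n w => (s n w)%:E).
  rewrite (eq_integral (fun w => (phi w)%:E)); last first.
    by move=> w _; apply/cvg_lim => //; exact: sphi.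
  apply.
  + by move=> n; exact/measurable_EFinP.
  + by move=> n w _; rewrite lee_fin.
  + by move=> w _ m n mn; rewrite lee_fin; have /lefP := nd_nnsfun_approx measurableT mephi mn; exact.
Qed.

End ScaledVectors.

Section SimpleInduction.
Context {d : measure_display} {T : measurableType d} {R : realType}
  {X : completeNormedModType R}.

(** Reduces statements that are additive in a simple function to vector
    multiples of indicators. *)
Lemma finitely_valued_ind (P : (T -> X) -> Prop) :
  (forall B x, measurable B -> P (fun w => \1_B w *: x)) ->
  (forall s t, finitely_valued s -> finitely_valued t -> P s -> P t ->
    P (fun w => s w + t w)) ->
  forall s, finitely_valued s -> P s.
Proof.
move=> P1 PD s fs; have [fr ms] := fs.
have -> : s = fun w => \sum_(x <- fset_set (range s)) \1_(s @^-1` [set x]) w *: x.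
  apply/funext => w.
  rewrite (bigD1_seq (s w)) ?fset_uniq//=; last first.
    by rewrite in_fset_set//; apply: mem_set; exists w.
  rewrite big1 => [|x xs]; last first.
    by rewrite indicE memNset ?scale0r//= => sx; rewrite sx eqxx in xs.
  by rewrite addr0 indicE mem_set ?scale1r.
have indfv (B : set T) (x : X) : measurable B -> finitely_valued (fun w => \1_B w *: x).
  move=> mB; rewrite (_ : (fun w => _) = (fun b : bool => b%:R *: x) \o (fun w => w \in B)).
    exact: finitely_valued_comp (finitely_valued_mem mB).
  by apply/funext => w; rewrite indicE.
elim: (enum_fset _) => [|x r ih].
  under eq_fun do rewrite big_nil.
  have := P1 set0 0 measurable0; under eq_fun do rewrite scaler0; exact.
under eq_fun do rewrite big_cons.
apply: PD => //; [|elim: r {ih} => [|y r ih]|].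
- exact: indfv.
- under eq_fun do rewrite big_nil.
  have := indfv set0 0 measurable0; under eq_fun do rewrite scaler0; exact.
- under eq_fun do rewrite big_cons.
  exact: (finitely_valued_comp (fun p : X * X => p.1 + p.2) (finitely_valued_pair (indfv _ y (ms _)) ih)).
- exact: P1.
Qed.

End SimpleInduction.

Section ConditionalExpectation.
Context {d : measure_display} {T : measurableType d} {R : realType}
  {X : completeNormedModType R}.
Variable mu : {finite_measure set T -> \bar R}.
Variable F : set (set T).
Hypothesis subF : is_sub_sigma_algebra F.
Implicit Types (f g s t : T -> X) (A : set T).

Local Notation SM := (@strongly_measurable d T R X measurable).
Local Notation int1 f := (\int[mu]_w `|f w|%:E)%E.
Local Notation bint := (bochner_integrable mu).

Lemma is_cond_exp_integrable f g : is_cond_exp mu F f g -> bint g.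
Proof. by move=> [mg ig _]; split=> //; exact: sub_strongly_measurable mg. Qed.

(** On sets of [F] the functions [f] and [g] have the same integral, whose norm
    is at most the integral of the norm of [f]; [strong_variation_le] moves the
    norm of [g] inside the integral. *)
Lemma is_cond_exp_contraction f g : bint f -> is_cond_exp mu F f g ->
  forall A, F A -> (\int[mu]_(w in A) `|g w|%:E <= \int[mu]_(w in A) `|f w|%:E)%E.
Proof.
move=> intf [mg ig gf]; apply: (strong_variation_le subF) => //.
  by apply: strongly_measurable_norm; case: intf.
by move=> A FA; rewrite gf//; apply: bochner_integral_on_norm => //; exact: subF.2.
Qed.

Lemma bochner_integral_on_lin (c : R) A f g : measurable A -> bint f -> bint g ->
  bochner_integral_on mu A (fun w => f w + c *: g w) =
  bochner_integral_on mu A f + c *: bochner_integral_on mu A g.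
Proof.
move=> mA intf intg.
rewrite /bochner_integral_on -bochner_integral_lin; try exact: bochner_integrable_restrict.
by congr bochner_integral; apply/funext => w; rewrite scalerDr !scalerA [\1_A w * c]mulrC.
Qed.

Lemma is_cond_exp_lin (c : R) f f' g g' : bint f -> bint f' ->
  is_cond_exp mu F f g -> is_cond_exp mu F f' g' ->
  is_cond_exp mu F (fun w => f w + c *: f' w) (fun w => g w + c *: g' w).
Proof.
move=> intf intf' fg fg'.
have intg := is_cond_exp_integrable fg; have intg' := is_cond_exp_integrable fg'.
have [mg _ gA] := fg; have [mg' _ gA'] := fg'; split.
- apply/(strongly_measurable_subE subF).
  apply: (@strongly_measurableD _ (g_sigma_algebraType F)).
    exact/(strongly_measurable_subE subF).
  by apply: (@strongly_measurableZ _ (g_sigma_algebraType F)); exact/(strongly_measurable_subE subF).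
- by have [] := bochner_integrable_lin c intg intg'.
- move=> A FA; have mA := subF.2 _ FA.
  rewrite (bochner_integral_on_lin c mA intg intg') (bochner_integral_on_lin c mA intf intf').
  by rewrite (gA _ FA) (gA' _ FA).
Qed.

Lemma is_cond_exp_scaled B (x : X) k : measurable B ->
  is_conditional_probability mu F B k ->
  is_cond_exp mu F (fun w => \1_B w *: x) (fun w => k w *: x).
Proof.
move=> mB [mk k0 kE].
have mk' := measurable_fun_sub subF mk.
have kA A : F A -> (\int[mu]_w (\1_A w * k w)%:E = mu (A `&` B))%E.
  by move=> FA; rewrite integral_indicM ?kE//; exact: subF.2.
split.
- apply/(strongly_measurable_subE subF).
  apply: (@strongly_measurable_scale _ (g_sigma_algebraType F)) => //.
  exact: (@strongly_measurable_cst _ (g_sigma_algebraType F)).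
- under eq_integral do rewrite normrZ ger0_norm// mulrC.
  rewrite integral_scale// kE//; last exact: sub_sigma_setT.
  by rewrite setTI lte_mul_pinfty// -ge0_fin_numE// fin_num_measure.
- move=> A FA; have mA := subF.2 _ FA.
  have mAB : measurable (A `&` B) by exact: measurableI.
  transitivity (fine (mu (A `&` B)) *: x).
    rewrite -kA//; apply: bochner_integralE.
    rewrite (_ : (fun w => _) = (fun w => (\1_A w * k w) *: x)); last first.
      by apply/funext => w; rewrite scalerA.
    apply: has_bochner_integral_scaled => //.
    - by apply: measurable_funM => //; exact: measurable_indic.
    - by move=> w; rewrite mulr_ge0.
    - by rewrite kA// -ge0_fin_numE// fin_num_measure.
  rewrite -bochner_integral_on_cst//; congr bochner_integral; apply/funext => w.
  by rewrite scalerA indicI.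
Qed.

Lemma is_cond_exp_simple s : finitely_valued s -> exists g, is_cond_exp mu F s g.
Proof.
apply: (finitely_valued_ind (P := fun s => exists g, is_cond_exp mu F s g)) => {s}.
  move=> B x mB; have [k kP] := conditional_probability_exists mu subF mB.
  by exists (fun w => k w *: x); exact: is_cond_exp_scaled.
move=> s t fs ft [g sg] [h th].
exists (fun w => g w + 1 *: h w).
have := is_cond_exp_lin 1 (bochner_integrable_simple mu fs) (bochner_integrable_simple mu ft) sg th.
by under eq_fun do rewrite scale1r.
Qed.

(** For a multiple of an indicator the conditional probability gives an
    explicit version, hence existence for simple functions. In general [f] is
    a fast limit in mean of simple functions; by contraction their conditional
    expectations converge fast in mean too, and the limit inherits the
    integrals over the sets of [F]. *)
Lemma is_cond_exp_exists f : bint f -> exists g, is_cond_exp mu F f g.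
Proof.
move=> intf; have mf := intf.1.
have e0 n : 0 < 2^-1 ^+ n / 2 :> R by rewrite divr_gt0// exprn_gt0.
have /choice[t tP] n := simple_approximation_mean intf (e0 n).
have ft n : finitely_valued (t n) by case: (tP n).
have tf n := (tP n).2.
have intt n : bint (t n) := bochner_integrable_simple mu (ft n).
have /choice[g gP] : forall n, exists g, is_cond_exp mu F (t n) g.
  by move=> n; exact: is_cond_exp_simple.
have intg n : bint (g n) := is_cond_exp_integrable (gP n).
have FT := sub_sigma_setT subF.
have [n||h [mh gh hE]] := fast_cauchy_complete (mu := mu) (u := g) subF.
- by case: (gP n).
- move=> n.
  have := is_cond_exp_contraction (bochner_integrable_lin (-1) (intt n.+1) (intt n))
    (is_cond_exp_lin (-1) (intt n.+1) (intt n) (gP n.+1) (gP n)) FT.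
  under eq_integral do rewrite scaleN1r.
  move/le_trans; apply.
  rewrite (splitr (2^-1 ^+ n)) EFinD.
  have h1 : (int1 (fun w => f w - t n.+1 w)%R <= (2^-1 ^+ n / 2)%:E)%E.
    apply: le_trans (tf n.+1) _; rewrite lee_fin exprS.
    have : 0 <= 2^-1 ^+ n :> R by rewrite exprn_ge0.
    lra.
  apply: le_trans (leeD h1 (tf n)).
  apply: integral_norm_leD.
  + by apply: strongly_measurableB => //; case: (intt n.+1).
  + by apply: strongly_measurableB => //; case: (intt n).
  + by apply: strongly_measurableD; [case: (intt n.+1)|apply: strongly_measurableZ; case: (intt n)].
  + move=> w; rewrite scaleN1r [X in _ <= X + _]distrC.
    by rewrite -{1}(subrK (f w) (t n.+1 w)) -addrA ler_normD.
have mh' : SM h by exact: sub_strongly_measurable mh.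
have inth : bint h.
  by apply: (bochner_integrable_close mh' (intg 0%N)); rewrite (le_lt_trans (hE 0%N))// ltry.
exists h; split; [exact: mh|exact: inth.2|].
move=> A FA; have mA := subF.2 _ FA.
have gh0 : (int1 (fun w => h w - g n w)%R @[n --> \oo] --> 0)%E.
  by apply: cvge0_geometric hE => n; exact: integral_ge0.
have tf0 : (int1 (fun w => f w - t n w)%R @[n --> \oo] --> 0)%E.
  apply: (cvge0_geometric (c := 2^-1)) => n; first exact: integral_ge0.
  by rewrite mulrC; exact: tf.
apply: (cvg_unique (@norm_hausdorff _ X) (bochner_integral_on_cvg mA inth intg gh0)).
rewrite (_ : (fun n => _) = (fun n => bochner_integral_on mu A (t n))).
  exact: bochner_integral_on_cvg tf0.
by apply/funext => n; have [_ _ ->] := gP n.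
Qed.

End ConditionalExpectation.

Section AlmostEverywhere.
Context {d : measure_display} {T : measurableType d} {R : realType}
  {X : completeNormedModType R}.
Variable mu : {finite_measure set T -> \bar R}.
Implicit Types (f : T -> X).

Local Notation SM := (@strongly_measurable d T R X measurable).

Lemma integral_norm_eq0 f : SM f -> (\int[mu]_w `|f w|%:E <= 0)%E ->
  {ae mu, forall w, f w = 0}.
Proof.
move=> mf f0.
have mnf : measurable_fun setT (fun w => `|f w|%:E).
  by apply/measurable_EFinP; exact: strongly_measurable_norm.
have : (\int[mu]_w `| `|f w|%:E | = 0)%E.
  apply/eqP; rewrite eq_le integral_ge0// andbT; apply: le_trans f0.
  by rewrite le_eqVlt; apply/orP; left; apply/eqP; apply: eq_integral => w _; rewrite /= normr_id.
move/(ae_eq_integral_abs mu measurableT mnf).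
by apply: filterS => w /(_ I) /= [] /eqP; rewrite normr_eq0 => /eqP.
Qed.

End AlmostEverywhere.

Section ConditionalExpectationTheory.
Context {d : measure_display} {T : measurableType d} {R : realType}
  {X : completeNormedModType R}.
Variable mu : {finite_measure set T -> \bar R}.
Implicit Types (f g : T -> X) (A : set T) (F : set (set T)).

Local Notation bint := (bochner_integrable mu).

Lemma cond_expP F f : is_sub_sigma_algebra F -> bint f ->
  is_cond_exp mu F f (cond_exp mu f F).
Proof. by move=> subF /(is_cond_exp_exists subF); exact: xgetPex. Qed.

Lemma is_cond_exp_id F f : strongly_measurable F f -> bint f -> is_cond_exp mu F f f.
Proof. by move=> mf [_ intf]; split. Qed.

Lemma is_cond_exp_tower F G f g h : F `<=` G -> is_cond_exp mu G f g ->
  is_cond_exp mu F f h -> is_cond_exp mu F g h.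
Proof.
move=> FG [_ _ gf] [mh ih hf]; split; [exact: mh|exact: ih|].
by move=> A FA; rewrite (hf _ FA) (gf _ (FG _ FA)).
Qed.

Lemma is_cond_expB F f f' g g' : is_sub_sigma_algebra F -> bint f -> bint f' ->
  is_cond_exp mu F f g -> is_cond_exp mu F f' g' ->
  is_cond_exp mu F (fun w => f w - f' w) (fun w => g w - g' w).
Proof.
move=> subF intf intf' fg fg'; have := is_cond_exp_lin subF (-1) intf intf' fg fg'.
by under eq_fun do rewrite scaleN1r; under [X in is_cond_exp _ _ _ X]eq_fun do rewrite scaleN1r.
Qed.

Lemma convex_absorb (q a b : R) : 0 < q -> a <= q^-1 * b + (1 - q^-1) * a -> a <= b.
Proof.
move=> q0 ab; have qV0 : 0 < q^-1 by rewrite invr_gt0.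
rewrite -(ler_pM2l qV0); lra.
Qed.

(** Put [G := min (`|g|, N)]. Then
    [\int G^p <= \int G^(p-1) * `|g| <= \int G^(p-1) * `|f|
     <= p^-1 * \int `|f|^p + (1 - p^-1) * \int G^p],
    where the second inequality is the contraction property with a weight
    measurable for [F] and the third one is [powR_tangent]. The truncation
    makes the last integral finite, so that it can be absorbed on the left;
    then [N] tends to infinity. *)
Lemma is_cond_exp_powR_contraction p F f g : 1 <= p -> is_sub_sigma_algebra F -> bint f ->
  is_cond_exp mu F f g -> (moment mu p g <= moment mu p f)%E.
Proof.
move=> p1 subF intf fg.
have [->|] := eqVneq (moment mu p f) +oo%E; first by rewrite leey.
rewrite -ltey => ffin.
have p0 : 0 < p by exact: lt_le_trans ltr01 p1.
have mf := intf.1.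
have [mg intg] := is_cond_exp_integrable subF fg.
have mFg : strongly_measurable F g by case: fg.
have mFng := sub_strongly_measurable_norm subF mFg.
pose G (N : nat) w := Num.min `|g w| N%:R.
have G0 N w : 0 <= G N w by rewrite le_min normr_ge0 ler0n.
have mFG N : @measurable_fun _ _ (g_sigma_algebraType F) _ setT (G N).
  by apply: measurable_minr => //; exact: measurable_cst.
have mG N : measurable_fun setT (G N) := measurable_fun_sub subF (mFG N).
have Gp N : (\int[mu]_w (G N w `^ p)%:E <= moment mu p f)%E.
  have mphi : @measurable_fun _ _ (g_sigma_algebraType F) _ setT (fun w => G N w `^ (p - 1)).
    exact: (measurableT_comp (f := fun x : R => x `^ (p - 1))).
  have mphi' := measurable_fun_sub subF mphi.
  have mGp : measurable_fun setT (fun w => G N w `^ p).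
    exact: (measurableT_comp (f := fun x : R => x `^ p)).
  have mfp := measurable_moment p mf.
  have mng := strongly_measurable_norm mg; have mnf := strongly_measurable_norm mf.
  have W := weighted_integral_le subF mng mnf
    (fun w => normr_ge0 _) (fun w => normr_ge0 _) (is_cond_exp_contraction subF intf fg) mphi
    (fun w => powR_ge0 _ _).
  have i1 : (\int[mu]_w (G N w `^ p)%:E <= \int[mu]_w (G N w `^ (p - 1) * `|g w|)%:E)%E.
    apply: integral_le => //.
    - by apply: measurable_funM.
    - by move=> w _; exact: powR_ge0.
    - move=> w _; rewrite -mulr_powRB1// mulrC ler_wpM2l ?powR_ge0//.
      by rewrite ge_min lexx.
  have i2 : (\int[mu]_w (G N w `^ (p - 1) * `|f w|)%:E <=
      p^-1%:E * moment mu p f + (1 - p^-1)%:E * \int[mu]_w (G N w `^ p)%:E)%E.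
    have q0 : 0 <= 1 - p^-1 by rewrite subr_ge0 invf_le1.
    have pV0 : 0 <= p^-1 by rewrite invr_ge0 ltW.
    rewrite -!integral_scale//; [|by move=> w _; exact: powR_ge0..].
    apply: integral_leD => //; try exact: measurable_funM.
    - by move=> w _; rewrite mulr_ge0// powR_ge0.
    - by move=> w _; rewrite mulr_ge0// powR_ge0.
    - by move=> w _; rewrite mulr_ge0// powR_ge0.
    - move=> w _; rewrite mulrC (le_trans (powR_tangent p1 _ _))//.
      by rewrite mulrC lerD2l mulrC.
  have Gfin : (\int[mu]_w (G N w `^ p)%:E)%E \is a fin_num.
    rewrite ge0_fin_numE; last by apply: integral_ge0 => w _; rewrite lee_fin powR_ge0.
    apply: (@le_lt_trans _ _ (\int[mu]_w (N%:R `^ p)%:E)%E).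
      apply: integral_le => //; first by move=> w _; exact: powR_ge0.
      by move=> w _; apply: le_powR => //; rewrite ge_min lexx orbT.
    by rewrite integral_cst_on// lte_mul_pinfty ?lee_fin ?powR_ge0// -ge0_fin_numE// fin_num_measure.
  have ffin' : moment mu p f \is a fin_num by rewrite ge0_fin_numE// moment_ge0.
  have := le_trans i1 (le_trans W i2).
  rewrite -(fineK Gfin) -(fineK ffin') -!EFinM -EFinD !lee_fin.
  exact: convex_absorb.
have -> : moment mu p g = moment mu p (fun w => `|g w| : R^o).
  by apply: eq_integral => w _; rewrite normr_id.
apply: (moment_fatou (u := fun N w => G N w : R^o)) => //.
- by move=> N; exact: measurable_strongly_measurable.
- by apply: measurable_strongly_measurable; exact: strongly_measurable_norm.
- apply: aeW => w; apply: cvg_near_cst.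
  have [N _ HN] := nbhs_infty_ger (`|g w|).
  by exists N => // n /= /HN /= gn; rewrite /G min_l.
- apply: nearW => N; apply: le_trans (Gp N); rewrite le_eqVlt; apply/orP; left; apply/eqP.
  by apply: eq_integral => w _; rewrite ger0_norm.
Qed.

(** The set where [`|g|] exceeds [C] by a fixed amount belongs to [F]; the
    contraction property on it shows that it is null. *)
Lemma is_cond_exp_bounded F f g (C : R) : is_sub_sigma_algebra F -> bint f ->
  is_cond_exp mu F f g -> (forall w, `|f w| <= C) -> {ae mu, forall w, `|g w| <= C}.
Proof.
move=> subF intf fg fC.
have [mg intg] := is_cond_exp_integrable subF fg.
have mFg : strongly_measurable F g by case: fg.
have mng := strongly_measurable_norm mg.
pose A k := [set w | C + k.+1%:R^-1 < `|g w|].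
have FA k : F (A k) by exact: measurable_norm_gt.
have mA k : measurable (A k) := subF.2 _ (FA k).
have A0 k : mu (A k) = 0%E.
  have muA : mu (A k) \is a fin_num by exact: fin_num_measure.
  have : ((C + k.+1%:R^-1)%:E * mu (A k) <= C%:E * mu (A k))%E.
    rewrite -!integral_cst_on//.
    apply: (@le_trans _ _ (\int[mu]_(w in A k) `|g w|%:E)%E).
      apply: ge0_le_integral => //.
      - move=> w Aw; rewrite lee_fin addr_ge0//.
        by rewrite (le_trans _ (fC w)).
      - by apply/measurable_EFinP; exact: measurable_funTS.
      - by move=> w /ltW; rewrite lee_fin.
    apply: le_trans (is_cond_exp_contraction subF intf fg (FA k)) _.
    apply: integral_le => //.
    exact: strongly_measurable_norm intf.1.
  rewrite -(fineK muA) -!EFinM lee_fin mulrDl gerDl => H.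
  congr EFin; apply/eqP; rewrite eq_le fine_ge0// andbT.
  by rewrite -(@pmulr_rle0 _ k.+1%:R^-1).
have : mu.-negligible (\bigcup_k A k).
  by apply: negligible_bigcup => k; exact: (negligibleP mu (mA k)).2 (A0 k).
apply: negligibleS => w /= /negP; rewrite -ltNge => Cg.
have [k kg] : exists k, k.+1%:R^-1 < `|g w| - C.
  have gC : 0 < `|g w| - C by rewrite subr_gt0.
  by have [k] := ltr_add_invr gC; rewrite add0r => ?; exists k.
by exists k => //; rewrite /A/= addrC -ltrBrDr.
Qed.

End ConditionalExpectationTheory.

(** * Maximal inequalities *)

Section MonotoneFamilies.
Context {T : Type}.
Variable F : nat -> set (set T).

Definition monotone_family : Prop :=
  (forall n m, (n <= m)%N -> F n `<=` F m) \/ (forall n m, (n <= m)%N -> F m `<=` F n).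

Lemma increasing_homo : (forall n, F n `<=` F n.+1) ->
  forall n m, (n <= m)%N -> F n `<=` F m.
Proof.
move=> H n; elim=> [|m ih]; first by rewrite leqn0 => /eqP ->.
by rewrite leq_eqVlt => /predU1P[->//|/ih nm]; apply: subset_trans nm (H m).
Qed.

Lemma decreasing_homo : (forall n, F n.+1 `<=` F n) ->
  forall n m, (n <= m)%N -> F m `<=` F n.
Proof.
move=> H n; elim=> [|m ih]; first by rewrite leqn0 => /eqP ->.
by rewrite leq_eqVlt => /predU1P[->//|/ih nm]; apply: subset_trans (H m) nm.
Qed.

Lemma monotone_family_total n m : monotone_family -> F n `<=` F m \/ F m `<=` F n.
Proof.
by have [nm|/ltnW mn] := leqP n m; case=> H; [left|right|right|left]; exact: H.
Qed.

End MonotoneFamilies.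

Section Maximal.
Context {d : measure_display} {T : measurableType d} {R : realType}.
Variable mu : {finite_measure set T -> \bar R}.
Implicit Types (A : set T).

(** Doob's maximal inequality, separated from conditional expectations. The
    union is cut according to the first [i] with [w] in [B i]; the piece of
    index [i] belongs to [G i] because [G] increases, and the bounds on the
    pieces are added. *)
Lemma maximal_bound (G : nat -> set (set T)) (B : nat -> set T) (h : T -> \bar R) (lam : R) :
  0 <= lam -> (forall i, is_sub_sigma_algebra (G i)) -> (forall i, G i `<=` G i.+1) ->
  (forall i, G i (B i)) ->
  measurable_fun setT h -> (forall w, 0 <= h w)%E ->
  (forall i A, G i A -> A `<=` B i -> lam%:E * mu A <= \int[mu]_(w in A) h w)%E ->
  (lam%:E * mu (\bigcup_i B i) <= \int[mu]_(w in \bigcup_i B i) h w)%E.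
Proof.
move=> lam0 subG incG GB mh h0 H.
have GG := increasing_homo incG.
have GD i : G i (seqDU B i).
  rewrite -(measurable_sub (subG i)); apply: measurableD.
    by rewrite measurable_sub.
  apply: bigsetU_measurable => j _; rewrite measurable_sub//.
  by apply: (GG j) => //; exact/ltnW/ltn_ord.
have mD i : measurable (seqDU B i) := (subG i).2 _ (GD i).
have mU : measurable (\bigcup_i seqDU B i) by exact: bigcupT_measurable.
rewrite seqDU_bigcup_eq -integral_cst_on//.
rewrite !ge0_integral_bigcup//; try exact: trivIset_seqDU.
  apply: lee_nneseries => i _.
    by move=> _; apply: integral_ge0 => w _; rewrite lee_fin.
  rewrite integral_cst_on//; apply: H => //.
  exact: subDsetl.
exact: measurable_funTS.
Qed.

Lemma measure_le (A B : set T) : measurable A -> measurable B -> A `<=` B ->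
  (mu A <= mu B)%E.
Proof. by move=> mA mB AB; apply: le_measure => //; exact: mem_set. Qed.

Lemma measure_bigcup_le (B : nat -> set T) (lam : R) (c : \bar R) : 0 <= lam ->
  (forall i, measurable (B i)) ->
  (forall K, lam%:E * mu (\bigcup_(i in [set i | (i <= K)%N]) B i) <= c)%E ->
  (lam%:E * mu (\bigcup_i B i) <= c)%E.
Proof.
move=> lam0 mB H; pose U K := \bigcup_(i in [set i | (i <= K)%N]) B i.
have mU K : measurable (U K) by apply: bigcup_measurable.
have UE : \bigcup_K U K = \bigcup_i B i.
  apply/seteqP; split=> [w [K _ [i _ Bi]]|w [i _ Bi]]; first by exists i.
  by exists i => //; exists i => /=.
have mUB : measurable (\bigcup_K U K) by exact: bigcupT_measurable.
have ndU : {homo U : n m / (n <= m)%N >-> (n <= m)%O}.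
  move=> n m nm; apply/subsetPset => w [i /= ik Bi]; exists i => //=.
  exact: leq_trans ik nm.
have := nondecreasing_cvg_mu mU mUB ndU; rewrite UE => /(_ R mu) cmu.
have lc : (lam%:E * mu (U K) @[K --> \oo] --> lam%:E * mu (\bigcup_i B i))%E.
  exact: cvgeZl.
by apply: (cvge_to_le lc); apply: nearW => K; exact: H.
Qed.

End Maximal.

Section ChainMaximal.
Context {d : measure_display} {T : measurableType d} {R : realType}
  {X : completeNormedModType R}.
Variable mu : {finite_measure set T -> \bar R}.
Implicit Types (f : T -> X) (A : set T).

Local Notation SM := (@strongly_measurable d T R X measurable).
Local Notation int1 f := (\int[mu]_w `|f w|%:E)%E.
Local Notation bint := (bochner_integrable mu).

Lemma markov_on A f (c : R) : measurable A -> SM f -> 0 <= c ->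
  (forall w, A w -> c <= `|f w|) -> (c%:E * mu A <= \int[mu]_(w in A) `|f w|%:E)%E.
Proof.
move=> mA mf c0 cf; rewrite -integral_cst_on//.
by apply: integral_le => //; exact: strongly_measurable_norm.
Qed.

(** For [i <= K] the function [a i - a 0] is the conditional expectation of
    [a K - a 0] on [G i]. On a set of [G i] where its norm exceeds [e] the
    contraction property gives the hypothesis of [maximal_bound], with
    [h := `|a K - a 0|]. *)
Lemma chain_maximal (G : nat -> set (set T)) (a : nat -> T -> X) f K (e : R) :
  (forall i, is_sub_sigma_algebra (G i)) -> (forall i, G i `<=` G i.+1) ->
  bint f -> (forall i, is_cond_exp mu (G i) f (a i)) -> 0 <= e ->
  (e%:E * mu (\bigcup_(i in [set i | (i <= K)%N]) [set w | (e < `|a i w - a 0%N w|)%R]) <=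
   int1 (fun w => a K w - a 0%N w)%R)%E.
Proof.
move=> subG incG intf aP e0.
have GG := increasing_homo incG.
have inta i : bint (a i) := is_cond_exp_integrable (subG i) (aP i).
have mGa i : strongly_measurable (G i) (a i) by case: (aP i).
have mGa0 i : strongly_measurable (G i) (a 0%N).
  exact: strongly_measurableS (GG _ _ (leq0n i)) (mGa 0%N).
pose B i := if (i <= K)%N then [set w | e < `|a i w - a 0%N w|] else set0.
have GB i : G i (B i).
  rewrite /B; case: ifP => _; last by case: (subG i) => -[].
  by apply: measurable_norm_gt => //; exact: sub_strongly_measurableB.
have -> : \bigcup_(i in [set i | (i <= K)%N]) [set w | e < `|a i w - a 0%N w|] = \bigcup_i B i.
  apply/seteqP; split=> w [i iK]; rewrite /B.
    by move=> Bi; exists i => //; rewrite iK.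
  by case: ifP => // {}iK Bi; exists i.
have mB i : measurable (B i) := (subG i).2 _ (GB i).
have intd : bint (fun w => a K w - a 0%N w) by exact: bochner_integrableB.
have mh : measurable_fun setT (fun w => `|a K w - a 0%N w|%:E).
  by apply/measurable_EFinP; apply: strongly_measurable_norm; case: intd.
apply: (@le_trans _ _ (\int[mu]_(w in \bigcup_i B i) `|a K w - a 0%N w|%:E)%E); last first.
  by apply: ge0_subset_integral => //; exact: bigcupT_measurable.
apply: (maximal_bound (G := G)) => //.
move=> i A GA; rewrite /B; case: ifP => [iK|_] AB; last first.
  have -> : A = set0 by apply/seteqP; split.
  by rewrite measure0 mule0 integral_set0.
have dP : is_cond_exp mu (G i) (fun w => a K w - a 0%N w) (fun w => a i w - a 0%N w).
  apply: (is_cond_expB (subG i) (inta K) (inta 0%N)).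
    exact: is_cond_exp_tower (GG _ _ iK) (aP K) (aP i).
  exact: is_cond_exp_id (mGa0 i) (inta 0%N).
apply: le_trans (is_cond_exp_contraction (subG i) intd dP GA).
apply: markov_on => //.
- exact: (subG i).2.
- by case: (is_cond_exp_integrable (subG i) dP).
- by move=> w /AB /ltW.
Qed.

(** Banach's principle: a sequence that is uniformly close, off a set of small
    measure, to an almost everywhere convergent one converges almost
    everywhere. Take the tolerances [j.+1%:R^-1], with exceptional sets [B j].
    Almost every point avoids [B j] for infinitely many [j], and one such [j]
    that is large enough for [e] is all that Cauchy's criterion needs. *)
Lemma ae_cvgn_approx (u : nat -> T -> X) :
  (forall e : R, 0 < e -> exists v : nat -> T -> X, exists B : set T,
    [/\ {ae mu, forall w, cvgn (fun n => v n w)}, measurable B, (mu B <= e%:E)%E &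
        forall n w, e < `|u n w - v n w| -> B w]) ->
  {ae mu, forall w, cvgn (fun n => u n w)}.
Proof.
move=> H.
have /choice[v /choice[B vB]] : forall j : nat, exists v : nat -> T -> X, exists B : set T,
    [/\ {ae mu, forall w, cvgn (fun n => v n w)}, measurable B, (mu B <= j.+1%:R^-1%:E)%E &
        forall n w, j.+1%:R^-1 < `|u n w - v n w| -> B w].
  by move=> j; exact: H.
have mB j : measurable (B j) by case: (vB j).
pose C J := \bigcap_(j in [set j | (J <= j)%N]) B j.
have mC J : measurable (C J) by apply: bigcap_measurable => //; exists J => /=.
have C0 J : mu (C J) = 0%E.
  apply/eqP; rewrite eq_le measure_ge0 andbT; apply/lee_addgt0Pr => e e0; rewrite add0e.
  have [k] := ltr_add_invr e0; rewrite add0r => ke.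
  have kk : (k <= maxn J k)%N by rewrite leq_maxr.
  have [_ _ + _] := vB (maxn J k); move=> h.
  apply: (@le_trans _ _ (mu (B (maxn J k)))).
    by apply: measure_le => // w; apply; rewrite /= leq_maxl.
  apply: (le_trans h); rewrite lee_fin (le_trans _ (ltW ke))//.
  by rewrite lef_pV2 ?posrE// ler_nat ltnS.
have nC : mu.-negligible (\bigcup_J C J).
  by apply: negligible_bigcup => J; exact: (negligibleP mu (mC J)).2 (C0 J).
have cv : {ae mu, forall w, forall j, cvgn (fun n => v j n w)}.
  by apply/ae_foralln => j; case: (vB j).
have : {ae mu, forall w, ~ (\bigcup_J C J) w}.
  by apply: negligibleS nC => w /= /contrapT.
apply: filterS2 cv => w cw nw; apply/cvgn_tailP => e e0.
have e30 : 0 < e / 3 by rewrite divr_gt0.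
have [k] := ltr_add_invr e30; rewrite add0r => ke.
have [j kj nBj] : exists2 j, (k <= j)%N & ~ B j w.
  apply: contrapT => h; apply: nw; exists k => // j /= kj.
  by apply: contrapT => nB; apply: h; exists j.
have je : j.+1%:R^-1 < e / 3.
  by apply: le_lt_trans ke; rewrite lef_pV2 ?posrE// ler_nat ltnS.
have uv n : `|u n w - v j n w| <= e / 3.
  rewrite (le_trans _ (ltW je))// leNgt; apply/negP => h; apply: nBj.
  by case: (vB j) => _ _ _; apply; exact: h.
have /cvgn_tailP /(_ _ e30) [N HN] := cw j.
exists N => n Nn.
have -> : u n w - u N w = (u n w - v j n w) + (v j n w - v j N w) - (u N w - v j N w).
  by rewrite addrA subrK opprB addrA subrK.
apply: le_lt_trans (ler_normB _ _) _.
have := ler_normD (u n w - v j n w) (v j n w - v j N w).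
have := uv n; have := uv N; have := HN _ Nn; lra.
Qed.

End ChainMaximal.

(** * Convergence of conditional expectations *)

Section CauchyInMean.
Context {d : measure_display} {T : measurableType d} {R : realType}
  {X : completeNormedModType R}.
Variable mu : {finite_measure set T -> \bar R}.
Implicit Types (f g : T -> X) (u v : nat -> T -> X).

Local Notation SM := (@strongly_measurable d T R X measurable).
Local Notation int1 f := (\int[mu]_w `|f w|%:E)%E.

Definition cauchy_in_mean u : Prop :=
  forall e : R, 0 < e -> exists N, forall n m, (N <= n)%N -> (N <= m)%N ->
    (int1 (fun w => u n w - u m w)%R <= e%:E)%E.

Lemma integral_norm_triangle f g h : SM f -> SM g -> SM h ->
  (int1 (fun w => f w - h w)%R <= int1 (fun w => f w - g w)%R + int1 (fun w => g w - h w)%R)%E.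
Proof.
move=> mf mg mh; apply: integral_norm_leD; try exact: strongly_measurableB.
by move=> w; rewrite -{1}(subrK (g w) (f w)) -addrA ler_normD.
Qed.

Lemma integral_normC f g :
  (int1 (fun w => f w - g w)%R = int1 (fun w => g w - f w)%R)%E.
Proof. by apply: eq_integral => w _; rewrite distrC. Qed.

Lemma cauchy_in_mean_close u : (forall n, SM (u n)) ->
  (forall e : R, 0 < e -> exists v, [/\ forall n, SM (v n), cauchy_in_mean v &
     forall n, (int1 (fun w => u n w - v n w)%R <= e%:E)%E]) ->
  cauchy_in_mean u.
Proof.
move=> mU H e e0; have e30 : 0 < e / 3 by rewrite divr_gt0.
have [v [mv cv uv]] := H _ e30; have [N HN] := cv _ e30.
exists N => n m Nn Nm.
apply: le_trans (integral_norm_triangle (mU n) (mv n) (mU m)) _.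
apply: (@le_trans _ _ ((e / 3)%:E + ((e / 3)%:E + (e / 3)%:E))%E); last first.
  by rewrite -!EFinD lee_fin; lra.
apply: leeD => //; apply: le_trans (integral_norm_triangle (mv n) (mv m) (mU m)) _.
by apply: leeD; [exact: HN|rewrite integral_normC].
Qed.

Lemma cauchy_in_meanD u v : (forall n, SM (u n)) -> (forall n, SM (v n)) ->
  cauchy_in_mean u -> cauchy_in_mean v -> cauchy_in_mean (fun n w => u n w + v n w).
Proof.
move=> mU mV cu cv e e0; have e20 : 0 < e / 2 by rewrite divr_gt0.
have [N HN] := cu _ e20; have [M HM] := cv _ e20.
exists (maxn N M) => n m; rewrite !geq_max => /andP[Nn Mn] /andP[Nm Mm].
rewrite [e](splitr e) EFinD; apply: le_trans (leeD (HN n m Nn Nm) (HM n m Mn Mm)).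
apply: integral_norm_leD; try exact: strongly_measurableB.
  by apply: strongly_measurableB; exact: strongly_measurableD.
by move=> w; rewrite opprD addrACA ler_normD.
Qed.

End CauchyInMean.

Section ConditionalProbabilities.
Context {d : measure_display} {T : measurableType d} {R : realType}.
Variable mu : {finite_measure set T -> \bar R}.

(** The defining property of [k] on the sets of [F], extended to weights that
    are measurable for [F]. *)
Lemma integral_mul_conditional_probability F B k (phi : T -> R) :
  is_sub_sigma_algebra F -> measurable B -> is_conditional_probability mu F B k ->
  @measurable_fun _ _ (g_sigma_algebraType F) _ setT phi -> (forall w, 0 <= phi w) ->
  (\int[mu]_w (phi w * k w)%:E = \int[mu]_(w in B) (phi w)%:E)%E.
Proof.
move=> subF mB [mk k0 kE] mphi phi0; have mk' := measurable_fun_sub subF mk.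
rewrite -[RHS]integral_indicM//.
under [RHS]eq_integral do rewrite mulrC.
have iB A : F A -> (\int[mu]_(w in A) (\1_B w)%:E = mu (A `&` B))%E.
  move=> FA; have mA := subF.2 _ FA.
  by rewrite integral_indic// [B `&` A]setIC.
have mI : measurable_fun setT (\1_B : T -> R) by exact: measurable_indic.
by apply/eqP; rewrite eq_le; apply/andP; split; apply: (weighted_integral_le subF) => // A FA;
  rewrite kE// iB.
Qed.

Lemma measurable_fun_subS (F G : set (set T)) (k : T -> R) : is_sub_sigma_algebra F ->
  is_sub_sigma_algebra G -> F `<=` G -> @measurable_fun _ _ (g_sigma_algebraType F) _ setT k ->
  @measurable_fun _ _ (g_sigma_algebraType G) _ setT k.
Proof.
move=> subF subG FG mk _ C mC; rewrite setTI (measurable_sub subG); apply: FG.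
exact: (measurable_fun_subF subF mk mC).
Qed.

(** Pythagoras: [k] is the orthogonal projection of [l], and the squared norm
    of a conditional probability of [B] is its integral over [B]. *)
Lemma conditional_probability_dist F G B k l :
  is_sub_sigma_algebra F -> is_sub_sigma_algebra G -> F `<=` G -> measurable B ->
  is_conditional_probability mu F B k -> is_conditional_probability mu G B l ->
  (\int[mu]_w ((l w - k w) ^+ 2)%:E =
    (fine (\int[mu]_(w in B) (l w)%:E) - fine (\int[mu]_(w in B) (k w)%:E))%:E)%E.
Proof.
move=> subF subG FG mB Fk Gl.
have [mk k0 kE] := Fk; have [ml l0 lE] := Gl.
have mk' := measurable_fun_sub subF mk; have ml' := measurable_fun_sub subG ml.
have mGk := measurable_fun_subS subF subG FG mk.
have kk := integral_mul_conditional_probability subF mB Fk mk k0.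
have kl := integral_mul_conditional_probability subG mB Gl mGk k0.
have ll := integral_mul_conditional_probability subG mB Gl ml l0.
have finB h (H : set (set T)) : is_sub_sigma_algebra H -> is_conditional_probability mu H B h ->
    (\int[mu]_(w in B) (h w)%:E)%E \is a fin_num.
  move=> subH [mh h0 hE]; rewrite ge0_fin_numE; last by apply: integral_ge0 => w _; rewrite lee_fin.
  apply: (@le_lt_trans _ _ (\int[mu]_w (h w)%:E)%E).
    apply: ge0_subset_integral => //; last by move=> w _; rewrite lee_fin.
    by apply/measurable_EFinP; exact: measurable_fun_sub mh.
  rewrite hE ?setTI -?ge0_fin_numE ?fin_num_measure//; exact: sub_sigma_setT.
have finl := finB _ _ subG Gl; have fink := finB _ _ subF Fk.
have m2 : measurable_fun setT (fun w => (l w - k w) ^+ 2).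
  by apply: measurable_funX; exact: measurable_funB.
have mkl : measurable_fun setT (fun w => k w * l w) by exact: measurable_funM.
have E : (\int[mu]_w ((l w - k w) ^+ 2)%:E + (\int[mu]_w (k w * l w)%:E + \int[mu]_w (k w * l w)%:E) =
   \int[mu]_w (l w * l w)%:E + \int[mu]_w (k w * k w)%:E)%E.
  rewrite -!ge0_integralD//; try by move=> w _; rewrite -?EFinD lee_fin ?addr_ge0 ?mulr_ge0 ?sqr_ge0.
  - by apply: eq_integral => w _; rewrite -!EFinD; congr EFin; ring.
  all: try (by move=> w _; rewrite lee_fin sqr_ge0).
  all: try (by apply/measurable_EFinP => //; exact: measurable_funM).
  by apply: emeasurable_funD; apply/measurable_EFinP; exact: measurable_funM.
move: E; rewrite kk kl ll -(fineK fink) -(fineK finl).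
set a := fine (\int[mu]_(w in B) (k w)%:E)%E; set b := fine (\int[mu]_(w in B) (l w)%:E)%E.
case: (integral _ _ _) => [r| |]//=.
rewrite -!EFinD => -[] E; congr EFin; lra.
Qed.

End ConditionalProbabilities.

Section MartingaleMean.
Context {d : measure_display} {T : measurableType d} {R : realType}.
Variable mu : {finite_measure set T -> \bar R}.
Variable F : nat -> set (set T).
Hypothesis subF : forall n, is_sub_sigma_algebra (F n).
Hypothesis monoF : monotone_family F.

(** The integrals of the [k n] over [B] are monotone and bounded, hence form a
    Cauchy sequence; by [conditional_probability_dist] so do the [k n] in
    square mean. The argument does not depend on the direction of the
    family. *)
Lemma conditional_probability_cauchy (B : set T) (k : nat -> T -> R) :
  measurable B -> (forall n, is_conditional_probability mu (F n) B (k n)) ->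
  forall e : R, 0 < e -> exists N, forall n m, (N <= n)%N -> (N <= m)%N ->
    (\int[mu]_w `|k n w - k m w|%:E <= e%:E)%E.
Proof.
move=> mB kP e e0.
pose a n := fine (\int[mu]_(w in B) (k n w)%:E)%E.
have mk n : measurable_fun setT (k n).
  by apply: (measurable_fun_sub (subF n)); case: (kP n).
have k0 n w : 0 <= k n w by case: (kP n).
have mT : mu setT \is a fin_num by exact: fin_num_measure.
have a0 n : 0 <= a n by apply: fine_ge0; apply: integral_ge0 => w _; rewrite lee_fin.
have aT n : a n <= fine (mu B).
  apply: fine_le; rewrite ?fin_num_measure//.
    rewrite ge0_fin_numE; last by apply: integral_ge0 => w _; rewrite lee_fin.
    apply: (@le_lt_trans _ _ (\int[mu]_w (k n w)%:E)%E).
      apply: ge0_subset_integral => //; last by move=> w _; rewrite lee_fin.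
      exact/measurable_EFinP.
    have [_ _ ->] := kP n; last exact: sub_sigma_setT.
    by rewrite setTI -ge0_fin_numE// fin_num_measure.
  apply: (@le_trans _ _ (\int[mu]_w (k n w)%:E)%E).
    apply: ge0_subset_integral => //; last by move=> w _; rewrite lee_fin.
    exact/measurable_EFinP.
  have [_ _ ->] := kP n; last exact: sub_sigma_setT.
  by rewrite setTI.
have distE n m : F m `<=` F n ->
    (\int[mu]_w ((k n w - k m w) ^+ 2)%:E = (a n - a m)%:E)%E.
  by move=> FF; exact: (conditional_probability_dist (subF m) (subF n) FF mB (kP m) (kP n)).
have le_a n m : F m `<=` F n -> a m <= a n.
  move=> /distE E; rewrite -subr_ge0 -lee_fin -E; apply: integral_ge0 => w _.
  by rewrite lee_fin sqr_ge0.
have dist n m : (\int[mu]_w ((k n w - k m w) ^+ 2)%:E = `|a n - a m|%:E)%E.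
  have [FF|FF] := monotone_family_total n m monoF; last first.
    by rewrite distE// ger0_norm// subr_ge0 le_a.
  rewrite distrC ger0_norm ?subr_ge0 ?le_a// -distE//.
  by apply: eq_integral => w _; rewrite -sqrrN opprB.
have ca : cvgn a.
  case: monoF => H.
    apply: nondecreasing_is_cvgn; first by move=> n m nm; apply: le_a; exact: H.
    by exists (fine (mu B)) => _ [n _ <-].
  apply: nonincreasing_is_cvgn; first by move=> n m nm; apply: le_a; exact: H.
  by exists 0 => _ [n _ <-].
pose M := fine (mu setT) + 1.
have M0 : 0 < M by rewrite ltr_wpDl// fine_ge0.
(* From square mean to mean: x <= dl + x ^+ 2 / dl, where the constant dl
   contributes at most e / 2 to the integral. *)
pose dl := e / 2 / M.
have dl0 : 0 < dl by rewrite !divr_gt0.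
have ed0 : 0 < e / 4 * dl by rewrite mulr_gt0// divr_gt0.
have /(@cvgn_tailP _ R^o) /(_ _ ed0) [N HN] := ca.
exists N => n m Nn Nm.
have anm : `|a n - a m| <= e / 2 * dl.
  rewrite -(subrK (a N) (a n)) -addrA (le_trans (ler_normD _ _))// [X in _ + X]distrC.
  by have := HN _ Nn; have := HN _ Nm; lra.
apply: (@le_trans _ _ (\int[mu]_w dl%:E + \int[mu]_w (dl^-1 * (k n w - k m w) ^+ 2)%:E)%E).
  have msub : measurable_fun setT (fun w => k n w - k m w) by exact: measurable_funB.
  apply: integral_leD => //.
  - by apply: measurable_funM => //; exact: measurable_funX.
  - exact: measurableT_comp.
  - by move=> w _; exact: ltW.
  - by move=> w _; rewrite mulr_ge0 ?sqr_ge0// invr_ge0 ltW.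
  - move=> w _; set x := k n w - k m w.
    have E : dl^-1 * x ^+ 2 * dl = `|x| ^+ 2.
      by rewrite mulrAC mulVf ?gt_eqF// mul1r real_normK ?num_real.
    rewrite -(ler_pM2r dl0) mulrDl E.
    by have := sqr_ge0 (`|x| - dl); have := sqr_ge0 `|x|; nra.
have dlV0 : 0 <= dl^-1 by rewrite invr_ge0 ltW.
have msq : measurable_fun setT (fun w => (k n w - k m w) ^+ 2).
  by apply: measurable_funX; exact: measurable_funB.
rewrite integral_cst_on// (integral_scale mu measurableT msq (fun w _ => sqr_ge0 _) dlV0).
rewrite dist -[X in (_ * X + _)%E]fineK// -!EFinM -EFinD lee_fin [leRHS](splitr e); apply: lerD.
  by rewrite /dl mulrAC ler_pdivrMr// ler_pM2l ?divr_gt0// /M lerDl.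
by rewrite mulrC ler_pdivrMr.
Qed.

End MartingaleMean.

Section MartingaleMeanVector.
Context {d : measure_display} {T : measurableType d} {R : realType}
  {X : completeNormedModType R}.
Variable mu : {finite_measure set T -> \bar R}.
Variable F : nat -> set (set T).
Hypothesis subF : forall n, is_sub_sigma_algebra (F n).
Hypothesis monoF : monotone_family F.
Implicit Types (f g s t : T -> X).

Local Notation SM := (@strongly_measurable d T R X measurable).
Local Notation int1 f := (\int[mu]_w `|f w|%:E)%E.
Local Notation bint := (bochner_integrable mu).

Lemma is_cond_exp_dist (H : set (set T)) f f' g g' : is_sub_sigma_algebra H ->
  bint f -> bint f' -> is_cond_exp mu H f g -> is_cond_exp mu H f' g' ->
  (int1 (fun w => g w - g' w)%R <= int1 (fun w => f w - f' w)%R)%E.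
Proof.
move=> subH intf intf' fg fg'.
exact: (is_cond_exp_contraction subH (bochner_integrableB intf intf')
  (is_cond_expB subH intf intf' fg fg') (sub_sigma_setT subH)).
Qed.

Lemma is_cond_exp_uniq (H : set (set T)) f g g' : is_sub_sigma_algebra H ->
  bint f -> is_cond_exp mu H f g -> is_cond_exp mu H f g' ->
  {ae mu, forall w, g w = g' w}.
Proof.
move=> subH intf fg fg'; have := is_cond_exp_dist subH intf intf fg fg'.
under [X in (_ <= X)%E]eq_integral do rewrite subrr normr0.
rewrite integral0 => H0.
have : {ae mu, forall w, g w - g' w = 0}.
  apply: integral_norm_eq0 => //.
  by have [] := bochner_integrableB (is_cond_exp_integrable subH fg) (is_cond_exp_integrable subH fg').
by apply: filterS => w /subr0_eq.
Qed.

Local Notation ce f := (fun n => cond_exp mu f (F n)).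

Lemma cond_exp_indic_cauchy (B : set T) (x : X) : measurable B ->
  cauchy_in_mean mu (ce (fun w => \1_B w *: x)).
Proof.
move=> mB.
have /choice[k kP] : forall n, exists k, is_conditional_probability mu (F n) B k.
  by move=> n; exact: conditional_probability_exists.
have mk n : measurable_fun setT (k n).
  by apply: (measurable_fun_sub (subF n)); case: (kP n).
have intB : bint (fun w => \1_B w *: x).
  apply: bochner_integrable_restrict => //; apply: bochner_integrable_simple.
  exact: (finitely_valued_comp (fun=> x) (finitely_valued_mem measurableT)).
have mkx n : SM (fun w => k n w *: x).
  by apply: strongly_measurable_scale => //; exact: strongly_measurable_cst.
have ceP n := cond_expP (subF n) intB.
have mce n : SM (cond_exp mu (fun w => \1_B w *: x) (F n)).
  by have [] := is_cond_exp_integrable (subF n) (ceP n).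
apply: cauchy_in_mean_close => // e e0; exists (fun n w => k n w *: x); split=> //.
  move=> {}e {}e0; have e1 : 0 < e / (`|x| + 1) by rewrite divr_gt0// ltr_wpDl.
  have [N HN] := conditional_probability_cauchy subF monoF mB kP e1.
  exists N => n m Nn Nm.
  rewrite (eq_integral (fun w => (`|x| * `|k n w - k m w|)%:E)); last first.
    by move=> w _; rewrite -scalerBl normrZ mulrC.
  rewrite integral_scale//; last first.
    by apply: measurableT_comp => //; exact: measurable_funB.
  apply: (@le_trans _ _ (`|x|%:E * (e / (`|x| + 1))%:E)%E).
    by rewrite lee_wpmul2l ?lee_fin//; exact: HN.
  rewrite -EFinM lee_fin mulrCA ler_piMr ?ltW//.
  by rewrite ltr_pdivrMr ?mul1r ?ltrDl// ltr_wpDl.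
move=> n.
have := is_cond_exp_dist (subF n) intB intB (ceP n) (is_cond_exp_scaled (subF n) x mB (kP n)).
move/le_trans; apply; under eq_integral do rewrite subrr normr0.
by rewrite integral0 lee_fin ltW.
Qed.

(** The property holds for multiples of indicators, passes to sums, and then
    to limits in mean because conditional expectations are contractions. *)
Lemma cond_exp_cauchy f : bint f -> cauchy_in_mean mu (ce f).
Proof.
have mce h n : bint h -> SM (cond_exp mu h (F n)).
  by move=> inth; have [] := is_cond_exp_integrable (subF n) (cond_expP (subF n) inth).
have Hs s : finitely_valued s -> bint s /\ cauchy_in_mean mu (ce s).
  move=> fs; split; first exact: bochner_integrable_simple.
  move: s fs; apply: (finitely_valued_ind (P := fun s => cauchy_in_mean mu (ce s))).
    by move=> B x mB; exact: cond_exp_indic_cauchy.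
  move=> s t fs ft cs ct.
  have ints : bint s := bochner_integrable_simple mu fs.
  have intt : bint t := bochner_integrable_simple mu ft.
  have intst : bint (fun w => s w + t w).
    by have := bochner_integrable_lin 1 ints intt; under eq_fun do rewrite scale1r.
  apply: cauchy_in_mean_close => [n|e e0]; first exact: mce.
  exists (fun n w => cond_exp mu s (F n) w + cond_exp mu t (F n) w); split.
  - by move=> n; exact: (strongly_measurableD (mce s n ints) (mce t n intt)).
  - exact: (cauchy_in_meanD (fun n => mce s n ints) (fun n => mce t n intt) cs ct).
  - move=> n.
    have stP : is_cond_exp mu (F n) (fun w => s w + t w)
        (fun w => cond_exp mu s (F n) w + cond_exp mu t (F n) w).
      have := is_cond_exp_lin (subF n) 1 ints intt (cond_expP (subF n) ints) (cond_expP (subF n) intt).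
      by under eq_fun do rewrite scale1r; under [X in is_cond_exp _ _ _ X]eq_fun do rewrite scale1r.
    have := is_cond_exp_dist (subF n) intst intst (cond_expP (subF n) intst) stP.
    move/le_trans; apply; under eq_integral do rewrite subrr normr0.
    by rewrite integral0 lee_fin ltW.
move=> intf; apply: cauchy_in_mean_close => [n|e e0]; first exact: mce.
have [s [/Hs[ints cs] sf]] := simple_approximation_mean intf e0.
exists (ce s); split=> // n; first exact: mce.
apply: le_trans sf.
exact: (is_cond_exp_dist (subF n) intf ints (cond_expP (subF n) intf) (cond_expP (subF n) ints)).
Qed.

(** For a decreasing family the window is read backwards, so that the
    increments controlled by [chain_maximal] are those from [g (N + K)];
    passing to the increments from [g N] halves the level. *)
Lemma window_maximal f (g : nat -> T -> X) N K (e : R) : bint f ->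
  (forall n, is_cond_exp mu (F n) f (g n)) -> 0 < e ->
  ((e / 2)%:E * mu (\bigcup_(i in [set i | (i <= K)%N]) [set w | (e < `|g (N + i)%N w - g N w|)%R]) <=
   int1 (fun w => g (N + K)%N w - g N w)%R)%E.
Proof.
move=> intf gP e0.
have e20 : 0 <= e / 2 by rewrite divr_ge0 ?ltW.
have mg n : SM (g n) by have [] := is_cond_exp_integrable (subF n) (gP n).
have mB (c : R) i j : measurable [set w | c < `|g i w - g j w|].
  rewrite -[X in measurable X]setTI; apply: measurable_fun_ltr => //.
  by apply: strongly_measurable_norm; exact: strongly_measurableB.
case: monoF => H.
  have incF i : F (N + i)%N `<=` F (N + i.+1)%N by apply: H; rewrite addnS.
  have := @chain_maximal _ _ _ _ mu (fun i => F (N + i)%N) (fun i => g (N + i)%N) f K (e / 2)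
    (fun i => subF _) incF intf (fun i => gP _) e20.
  rewrite addn0; apply: le_trans; rewrite lee_wpmul2l ?lee_fin//; apply: measure_le.
  + by apply: bigcup_measurable => i _; exact: mB.
  + by apply: bigcup_measurable => i _; exact: mB.
  + move=> w [i iK /= ei]; exists i => //=.
    by rewrite (le_lt_trans _ ei)// ler_pdivrMr// ler_peMr// ?ltW// ltr1n.
have incF i : F (N + (K - i))%N `<=` F (N + (K - i.+1))%N.
  by apply: H; rewrite leq_add2l leq_sub2l.
have := @chain_maximal _ _ _ _ mu (fun i => F (N + (K - i))%N) (fun i => g (N + (K - i))%N) f K (e / 2)
  (fun i => subF _) incF intf (fun i => gP _) e20.
rewrite subnn addn0 subn0 integral_normC; apply: le_trans.
rewrite lee_wpmul2l ?lee_fin//; apply: measure_le.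
- by apply: bigcup_measurable => i _; exact: mB.
- by apply: bigcup_measurable => i _; exact: mB.
- move=> w [i /= iK ei]; rewrite /bigcup/=.
  have [h|h] := ltP (e / 2) `|g N w - g (N + K)%N w|.
    by exists K => //; rewrite subnn addn0.
  exists (K - i)%N; first exact: leq_subr.
  rewrite subKn//; have := ler_distD (g (N + K)%N w) (g (N + i)%N w) (g N w).
  by rewrite [X in _ <= _ + X]distrC; lra.
Qed.

(** The sequence stopped at [N] is eventually constant, and the maximal
    inequality shows that [g] stays close to it off a set of small measure. *)
Lemma ae_cvgn_cond_exp f (g : nat -> T -> X) : bint f ->
  (forall n, is_cond_exp mu (F n) f (g n)) -> cauchy_in_mean mu g ->
  {ae mu, forall w, cvgn (fun n => g n w)}.
Proof.
move=> intf gP cg; apply: ae_cvgn_approx => e e0.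
have mg n : SM (g n) by have [] := is_cond_exp_integrable (subF n) (gP n).
have ee0 : 0 < e / 2 * e by rewrite mulr_gt0// divr_gt0.
have [N HN] := cg _ ee0.
pose B i := [set w | e < `|g (N + i)%N w - g N w|].
have mB i : measurable (B i).
  rewrite -[X in measurable X]setTI; apply: measurable_fun_ltr => //.
  by apply: strongly_measurable_norm; exact: strongly_measurableB.
exists (fun n => g (minn n N)), (\bigcup_i B i); split.
- apply: aeW => w; apply/cvg_ex; exists (g N w); apply: cvg_near_cst.
  by exists N => // n /= Nn; rewrite (minn_idPr Nn).
- exact: bigcupT_measurable.
- have e20 : 0 < e / 2 by rewrite divr_gt0.
  rewrite -(@lee_pmul2l _ (e / 2)%:E)//.
  rewrite -EFinM; apply: measure_bigcup_le => // [|K]; first exact: ltW.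
  apply: le_trans (window_maximal N K intf gP e0) _.
  by apply: HN => //; rewrite leq_addr.
- move=> n w; have [nN|nN] := leqP n N; first by rewrite /= subrr normr0 ltNge ltW.
  by move=> h; exists (n - N)%N => //; rewrite /B/= subnKC// ltnW.
Qed.

Lemma cauchy_in_mean_ae_cvg (g : nat -> T -> X) h : (forall n, SM (g n)) -> SM h ->
  cauchy_in_mean mu g -> {ae mu, forall w, g n w @[n --> \oo] --> h w} ->
  (int1 (fun w => h w - g n w)%R @[n --> \oo] --> 0)%E.
Proof.
move=> mg mh cg gh; apply/cvge0P => [n|e e0]; first exact: integral_ge0.
have [N HN] := cg _ e0; exists N => // n /= Nn.
rewrite -moment1; apply: (moment_fatou (u := fun m w => g m w - g n w)) => //.
- by move=> m; exact: strongly_measurableB.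
- exact: strongly_measurableB.
- by apply: filterS gh => w gw; apply: cvgB => //; exact: cvg_cst.
- by exists N => // m /= Nm; rewrite moment1; exact: HN.
Qed.

End MartingaleMeanVector.

Section LimitSigmaAlgebra.
Context {d : measure_display} {T : measurableType d}.
Variables (F : nat -> set (set T)) (Foo : set (set T)).
Hypothesis subF : forall n, is_sub_sigma_algebra (F n).

Lemma monotone_family_of : increases_to F Foo \/ decreases_to F Foo -> monotone_family F.
Proof.
by case=> -[H _]; [left; exact: increasing_homo|right; exact: decreasing_homo].
Qed.

Lemma is_sub_sigma_algebra_limit : increases_to F Foo \/ decreases_to F Foo ->
  is_sub_sigma_algebra Foo.
Proof.
case=> -[H ->]; split.
- exact: smallest_sigma_algebra.
- apply: smallest_sub; first exact: sigma_algebra_measurable.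
  by move=> A [n _ FA]; exact: (subF n).2.
- split.
  + by move=> n _; case: (subF n) => -[].
  + by move=> A FA n _; case: (subF n) => -[_ + _] _; apply; exact: FA.
  + by move=> A FA n _; case: (subF n) => -[_ _ +] _; apply => k; exact: FA.
- by move=> A FA; apply: (subF 0%N).2; exact: FA.
Qed.

End LimitSigmaAlgebra.

Section CondExpPiLambda.
Context {d : measure_display} {T : measurableType d} {R : realType}
  {X : completeNormedModType R}.
Variable mu : {finite_measure set T -> \bar R}.
Implicit Types (f g s u : T -> X).

Local Notation bint := (bochner_integrable mu).
Local Notation Bon := (bochner_integral_on mu).

Lemma bochner_integral_on_setD (A B : set T) u : measurable A -> measurable B ->
  B `<=` A -> bint u -> Bon (A `\` B) u = Bon A u - Bon B u.
Proof.
move=> mA mB BA intu.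
rewrite -bochner_integralB; try exact: bochner_integrable_restrict.
congr bochner_integral; apply/funext => w; rewrite -scalerBl; congr (_ *: _).
rewrite !indicE in_setD; have [wB|wB] := boolP (w \in B).
  by rewrite (mem_set (BA _ (set_mem wB))) subrr.
by rewrite andbT subr0.
Qed.

Lemma bochner_integral_on_bigcup0 (A : nat -> set T) u : bint u ->
  nondecreasing_seq A -> (forall n, measurable (A n)) -> (forall n, Bon (A n) u = 0) ->
  Bon (\bigcup_n A n) u = 0.
Proof.
move=> intu ndA mA A0; have mu_ : strongly_measurable measurable u by case: intu.
have mU : measurable (\bigcup_n A n) by exact: bigcupT_measurable.
have intUu := bochner_integrable_restrict mU intu.
have intAu n := bochner_integrable_restrict (mA n) intu.
have := @moment_cvg0 _ _ _ _ mu 1 (fun w => \1_(\bigcup_n A n) w *: u w)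
  (fun n w => \1_(A n) w *: u w) (lexx _) intUu.1 (fun n => (intAu n).1) _ _ _.
rewrite moment1 => /(_ _ _ intUu.2) H.
apply/eqP; rewrite -normr_le0; apply/ler_addgt0Pr => e e0; rewrite add0r.
have {}H : moment mu 1 (fun w => \1_(\bigcup_n A n) w *: u w - \1_(A n) w *: u w) @[n --> \oo] --> 0%E.
  apply: H => [w|n w].
    apply: cvg_near_cst; have [wU|wU] := pselect ((\bigcup_n A n) w).
      have [N _ wN] := wU; exists N => // n /= Nn.
      rewrite !indicE !mem_set//.
      by have /subsetPset := ndA _ _ Nn; apply.
    near=> n; rewrite !indicE !memNset//; apply: contra_not wU => wA; by exists n.
  rewrite !normrZ !ger0_norm//.
  have [wA|wA] := pselect (A n w); last first.
    by rewrite [\1_(A n) w]indicE memNset// mul0r mulr_ge0// mulr_ge0.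
  rewrite !indicE !mem_set//; last by exists n.
  by rewrite !mul1r mulr_natl mulr2n lerDl.
move/cvge0P : H => /(_ _ _ e0) [|N _ /(_ N (leqnn N)) /=]; first by move=> n; exact: moment_ge0.
rewrite moment1 => HN; rewrite -lee_fin; apply: le_trans HN.
rewrite -[Bon _ u]subr0 -[X in _ - X](A0 N) -bochner_integralB//.
by apply: bochner_integral_norm; exact: bochner_integrableB.
Unshelve. all: by end_near. Qed.

(** The sets on which [f] and [g] have the same integral form a
    lambda-system. *)
Lemma is_cond_exp_generated (G : set (set T)) f g : G `<=` measurable ->
  setI_closed G -> G setT -> bint f -> bint g -> strongly_measurable <<s G>> g ->
  (forall A, G A -> Bon A g = Bon A f) -> is_cond_exp mu <<s G>> f g.
Proof.
move=> Gm GI GT intf intg mg gf; split; [exact: mg|exact: intg.2|].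
have intu := bochner_integrableB intg intf.
have sGm : <<s G>> `<=` measurable.
  by apply: smallest_sub => //; exact: sigma_algebra_measurable.
pose H := [set A | measurable A /\ Bon A (fun w => g w - f w) = 0].
suff sGH : <<s G>> `<=` H.
  move=> A GA; have [mA] := sGH A GA; rewrite bochner_integral_onB//.
  by move/subr0_eq.
have DH : lambda_system setT H.
  split; first by move=> A _; exact: subsetT.
  - by split; [exact: measurableT|rewrite bochner_integral_onB// gf// subrr].
  - move=> A B BA [mA A0] [mB B0]; split; first exact: measurableD.
    by rewrite bochner_integral_on_setD// A0 B0 subrr.
  - move=> A ndA HA; split; first by apply: bigcupT_measurable => n; case: (HA n).
    by apply: bochner_integral_on_bigcup0 => // n; case: (HA n).
have GH : G `<=` H.
  move=> A GA; have mA := Gm _ GA.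
  by split=> //; rewrite bochner_integral_onB// gf// subrr.
exact: (lambda_system_subset GI DH GH).
Qed.

End CondExpPiLambda.

Section MartingaleConvergence.
Context {d : measure_display} {T : measurableType d} {R : realType}
  {X : completeNormedModType R}.
Variable mu : {finite_measure set T -> \bar R}.
Variables (F : nat -> set (set T)) (Foo : set (set T)).
Hypothesis subF : forall n, is_sub_sigma_algebra (F n).
Hypothesis limF : increases_to F Foo \/ decreases_to F Foo.
Implicit Types (f g : T -> X).

Local Notation SM := (@strongly_measurable d T R X measurable).
Local Notation int1 f := (\int[mu]_w `|f w|%:E)%E.
Local Notation bint := (bochner_integrable mu).

Let monoF : monotone_family F := monotone_family_of limF.
Let subFoo : is_sub_sigma_algebra Foo := is_sub_sigma_algebra_limit subF limF.

(** Over a set that belongs to [F n] for all large [n] the almost everywhere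
    limit [h] of the conditional expectations has the same integral as [f],
    because they converge to it in mean. For an increasing family these sets
    form a generating class of [Foo] that is stable under intersection, and
    [is_cond_exp_generated] applies. For a decreasing family they include
    [Foo], and [h] is measurable for every [F m] because it does not depend on
    the first [m] terms. *)
Lemma cond_exp_limit_exists f : bint f ->
  exists h, [/\ is_cond_exp mu Foo f h,
    {ae mu, forall w, cond_exp mu f (F n) w @[n --> \oo] --> h w} &
    (int1 (fun w => h w - cond_exp mu f (F n) w)%R @[n --> \oo] --> 0)%E].
Proof.
move=> intf; pose g n := cond_exp mu f (F n).
have gP n : is_cond_exp mu (F n) f (g n) by exact: cond_expP.
have intg n : bint (g n) := is_cond_exp_integrable (subF n) (gP n).
have mFg n : strongly_measurable (F n) (g n) by case: (gP n).
have mg n : SM (g n) := (intg n).1.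
have cg : cauchy_in_mean mu g by exact: cond_exp_cauchy.
have ag : {ae mu, forall w, cvgn (fun n => g n w)} by exact: ae_cvgn_cond_exp gP cg.
pose D := [set w | cvgn (fun n => g n w)].
pose h w := if w \in D then limn (fun n => g n w) else 0.
have mh : SM h by exact: strongly_measurable_lim.
have gh : {ae mu, forall w, g n w @[n --> \oo] --> h w}.
  by apply: filterS ag => w gw; rewrite /h mem_set.
have g1 := cauchy_in_mean_ae_cvg mg mh cg gh.
have inth : bint h.
  move/cvge0P : (g1) => /(_ _ _ ltr01) [|N _ /(_ N (leqnn N)) /= HN].
    by move=> n; exact: integral_ge0.
  by apply: (bochner_integrable_close mh (intg N)); rewrite (le_lt_trans HN)// ltry.
exists h; split; [|exact: gh|exact: g1].
case: (limF) => -[H FooE].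
- have FFoo n : F n `<=` Foo.
    by rewrite FooE => A FA; apply: sub_sigma_algebra; exists n.
  rewrite FooE; apply: (is_cond_exp_generated _ _ _ intf inth).
  + by move=> A [n _ FA]; exact: (subF n).2.
  + move=> A B [n _ FA] [m _ FB]; exists (maxn n m) => //.
    rewrite -(measurable_sub (subF _)); apply: measurableI; rewrite measurable_sub//.
      by apply: (increasing_homo H) FA; exact: leq_maxl.
    by apply: (increasing_homo H) FB; exact: leq_maxr.
  + by exists 0%N => //; exact: sub_sigma_setT.
  + rewrite -FooE; apply/(strongly_measurable_subE subFoo).
    apply: (@strongly_measurable_lim _ (g_sigma_algebraType Foo)) => n.
    apply/(strongly_measurable_subE subFoo).
    exact: strongly_measurableS (FFoo n) (mFg n).
  + move=> A [N _ FA]; apply: (bochner_integral_on_lim (N := N) _ inth intg g1).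
      exact: (subF N).2.
    move=> n Nn; have [_ _ ->] := gP n => //.
    by apply: (increasing_homo H) FA.
- have FooF n : Foo `<=` F n by rewrite FooE => A; exact.
  split; [|by case: inth|].
    apply/(strongly_measurable_subE subFoo)/strongly_measurableP; split; last first.
      by have /strongly_measurableP[] := mh.
    move=> x _ C mC; rewrite setTI (measurable_sub subFoo) FooE => m _.
    have mFh : strongly_measurable (F m) h.
      apply/(strongly_measurable_subE (subF m)).
      have -> : h = (fun w => if w \in [set w | cvgn (fun n => g (n + m)%N w)] then
          limn (fun n => g (n + m)%N w) else 0).
        apply/funext => w; rewrite /h /D; have [gw|gw] := pselect (cvgn (fun n => g n w)).
          have gmw : g (n + m)%N w @[n --> \oo] --> limn (fun n => g n w).
            by rewrite (cvg_shiftn m (fun n => g n w)).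
          rewrite !mem_set//=; last by apply/cvg_ex; eexists; exact: gmw.
          by apply/esym/cvg_lim.
        rewrite !memNset//= => /cvg_ex[l]; rewrite (cvg_shiftn m (fun n => g n w)) => gl.
        by apply: gw; apply/cvg_ex; exists l.
      apply: (@strongly_measurable_lim _ (g_sigma_algebraType (F m))) => n.
      apply/(strongly_measurable_subE (subF m)).
      by apply: strongly_measurableS (mFg (n + m)%N); apply: (decreasing_homo H); exact: leq_addl.
    have /(strongly_measurable_subE (subF m))/strongly_measurableP[+ _] := mFh.
    by move=> /(_ x) mx; apply: (measurable_fun_subF (subF m) mx).
  move=> A FA; apply: (bochner_integral_on_lim (N := 0%N) _ inth intg g1).
    exact: subFoo.2.
  by move=> n _; have [_ _ ->] := gP n => //; exact: FooF.
Qed.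

Lemma cond_exp_cvg f : bint f ->
  {ae mu, forall w, cond_exp mu f (F n) w @[n --> \oo] --> cond_exp mu f Foo w} /\
  (int1 (fun w => cond_exp mu f Foo w - cond_exp mu f (F n) w)%R @[n --> \oo] --> 0)%E.
Proof.
move=> intf; have [h [hP ah h1]] := cond_exp_limit_exists intf.
have hE := is_cond_exp_uniq subFoo intf hP (cond_expP subFoo intf).
split; first by apply: filterS2 ah hE => w + <-.
have [mh _ _] := hP; have mh' := sub_strongly_measurable subFoo mh.
have mFoo : SM (cond_exp mu f Foo).
  by have [] := is_cond_exp_integrable subFoo (cond_expP subFoo intf).
have E n : int1 (fun w => cond_exp mu f Foo w - cond_exp mu f (F n) w)%R =
    int1 (fun w => h w - cond_exp mu f (F n) w)%R.
  have mFn : SM (cond_exp mu f (F n)).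
    by have [] := is_cond_exp_integrable (subF n) (cond_expP (subF n) intf).
  apply: ge0_ae_eq_integral => //.
  - by apply/measurable_EFinP; apply: strongly_measurable_norm; exact: strongly_measurableB.
  - by apply/measurable_EFinP; apply: strongly_measurable_norm; exact: strongly_measurableB.
  - by apply: filterS hE => w -> _.
by rewrite (_ : (fun n => _) = (fun n => int1 (fun w => h w - cond_exp mu f (F n) w)%R))//; exact/funext.
Qed.

End MartingaleConvergence.

(** * From almost everywhere convergence to convergence of moments *)

Section MomentUpgrade.
Context {d : measure_display} {T : measurableType d} {R : realType}
  {X : completeNormedModType R}.
Variable mu : {finite_measure set T -> \bar R}.
Implicit Types (g : T -> X) (u v : nat -> T -> X).

Local Notation SM := (@strongly_measurable d T R X measurable).

Lemma bounded_moment_cvg0 p (v : nat -> T -> X) g (C : R) : 1 <= p ->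
  (forall n, SM (v n)) -> SM g -> {ae mu, forall w, forall n, `|v n w| <= C} ->
  {ae mu, forall w, v n w @[n --> \oo] --> g w} ->
  moment mu p (fun w => g w - v n w) @[n --> \oo] --> 0%E.
Proof.
move=> p1 mv mg vC vg; pose c : R := (2 * `|C|) `^ p.
have gC : {ae mu, forall w, `|g w| <= C}.
  apply: filterS2 vC vg => w vC vg.
  have /cvg_lim <- // : `|v n w| @[n --> \oo] --> `|g w| by exact: cvg_norm.
  apply: limr_le; first by apply/cvg_ex; eexists; apply: cvg_norm vg.
  by apply: nearW => n.
have ig : mu.-integrable setT (fun w => c%:E) by exact: finite_measure_integrable_cst.
have := @dominated_convergence _ _ _ mu setT measurableT
  (fun n w => (`|g w - v n w| `^ p)%:E) (cst 0%E) _ _ _ _ ig.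
case.
- move=> n; apply/measurable_EFinP; apply: measurable_moment; exact: strongly_measurableB.
- exact: measurable_cst.
- apply: filterS vg => w vg _; apply/cvg_EFin; first exact: filterE.
  apply: (cvg0_powR p1) => //=.
  rewrite -[X in _ --> X](normr0 X) -(subrr (g w)).
  by apply: cvg_norm; apply: cvgB => //; exact: cvg_cst.
- apply: filterS2 vC gC => w vC gC n _; rewrite /= lee_fin ger0_norm ?powR_ge0//.
  apply: le_powR => //; rewrite (le_trans (ler_normB _ _))// mulr_natl mulr2n.
  by apply: lerD; [exact: le_trans gC (ler_norm _)|exact: le_trans (vC n) (ler_norm _)].
move=> _ _; rewrite integral_cst// mul0e; exact.
Qed.

(** Dominated convergence applies to the bounded sequences [v], whose limits
    are close to [g] by Fatou's lemma. *)
Lemma moment_approx_cvg0 p u g : 1 <= p -> (forall n, SM (u n)) -> SM g ->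
  {ae mu, forall w, u n w @[n --> \oo] --> g w} ->
  (forall e : R, 0 < e -> exists v, exists h, exists C : R,
    [/\ forall n, SM (v n), SM h, {ae mu, forall w, forall n, `|v n w| <= C},
        {ae mu, forall w, v n w @[n --> \oo] --> h w} &
        forall n, (moment mu p (fun w => u n w - v n w)%R <= e%:E)%E]) ->
  moment mu p (fun w => g w - u n w) @[n --> \oo] --> 0%E.
Proof.
move=> p1 mu_ mg ug H; apply/cvge0P => [n|e e0]; first exact: moment_ge0.
pose c : R := 2 `^ p; have c0 : 0 < c by exact: powR_gt0.
(* The error dl enters through two nested uses of momentB_le, as
   c * (dl + c * (dl + dl)), and this is at most e. *)
pose dl := e / 3 / (c * (c + 1)).
have dl0 : 0 < dl by rewrite !divr_gt0// mulr_gt0// addr_gt0.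
have [v [h [C [mv mh vC vh uv]]]] := H _ dl0.
have gh : (moment mu p (fun w => g w - h w)%R <= dl%:E)%E.
  apply: (moment_fatou (u := fun n w => u n w - v n w)) => //.
  - by move=> n; exact: strongly_measurableB.
  - exact: strongly_measurableB.
  - by apply: filterS2 ug vh => w ug vh; exact: cvgB.
  - exact: nearW.
have := bounded_moment_cvg0 p1 mv mh vC vh.
move/cvge0P => /(_ _ _ dl0) [|N _ HN]; first by move=> n; exact: moment_ge0.
exists N => // n /= /HN /= hv.
have vu : (moment mu p (fun w => v n w - u n w)%R <= dl%:E)%E.
  by rewrite momentC; exact: uv.
apply: le_trans (momentB_le mu p1 mg mh (mu_ n)) _.
have h2 := momentB_le mu p1 mh (mv n) (mu_ n).
apply: (@le_trans _ _ (c%:E * (dl%:E + c%:E * (dl%:E + dl%:E)))%E).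
  have c0' : (0 <= c%:E)%E by rewrite lee_fin ltW.
  apply: (lee_wpmul2l c0'); apply: (leeD gh); apply: (le_trans h2).
  by apply: (lee_wpmul2l c0'); exact: (leeD hv vu).
rewrite -!EFinD -!EFinM lee_fin /dl.
have -> : c * (e / 3 / (c * (c + 1)) + c * (e / 3 / (c * (c + 1)) + e / 3 / (c * (c + 1)))) =
  e * ((2 * c + 1) / (3 * (c + 1))).
  by field; rewrite !gt_eqF// addr_gt0.
by rewrite ler_piMr ?ltW// ltr_pdivrMr ?mulr_gt0 ?addr_gt0//; lra.
Qed.

End MomentUpgrade.

(** * The maximal ergodic lemma and bounded Birkhoff averages *)

Section MaximalErgodic.
Context {d : measure_display} {T : measurableType d} {R : realType}.
Variable mu : {finite_measure set T -> \bar R}.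
Variable tau : T -> T.
Hypothesis endo : endomorphism mu tau.

Let mtau : measurable_fun setT tau := endo.1.

Lemma ge0_integral_endomorphism (h : T -> R) : measurable_fun setT h ->
  (forall w, 0 <= h w) -> (\int[mu]_w (h (tau w))%:E = \int[mu]_w (h w)%:E)%E.
Proof.
move=> mh h0.
have := @ge0_integral_pushforward _ _ _ _ R _ mtau mu setT (EFin \o h) measurableT.
rewrite preimage_setT => <-//; first last.
- by move=> w _; rewrite lee_fin.
- exact/measurable_EFinP.
apply: eq_measure_integral => A mA _; exact: endo.2.
Qed.

Variables (a b : T -> R).
Hypothesis ma : measurable_fun setT a.
Hypothesis mb : measurable_fun setT b.
Hypothesis a0 : forall w, 0 <= a w.
Hypothesis b0 : forall w, 0 <= b w.
Hypothesis ia : (\int[mu]_w (a w)%:E < +oo)%E.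

Definition birkhoff_sum (h : T -> R) k w := \sum_(0 <= i < k) h (iter i tau w).

Lemma measurable_iter i : measurable_fun setT (fun w => iter i tau w).
Proof.
elim: i => [|i ih]; first exact: measurable_id.
exact: (measurableT_comp mtau ih).
Qed.

Lemma measurable_birkhoff_sum k (h : T -> R) : measurable_fun setT h ->
  measurable_fun setT (birkhoff_sum h k).
Proof.
move=> mh; apply: measurable_sum => i.
by apply: measurableT_comp => //; exact: measurable_iter.
Qed.

Lemma birkhoff_sumS h k w : birkhoff_sum h k.+1 w = h w + birkhoff_sum h k (tau w).
Proof.
by rewrite /birkhoff_sum big_nat_recl//=; congr (_ + _); apply: eq_bigr => i _; rewrite -iterSr.
Qed.

Let phi w := a w - b w.

(** The maximum of the sums of [phi] over at most [N] points of the orbit, as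
    [birkhoff_max_ge] and [birkhoff_max_attained] show, in the recursive form
    that Garsia's proof uses. *)
Fixpoint birkhoff_max N w : R :=
  if N is N'.+1 then Num.max 0 (phi w + birkhoff_max N' (tau w)) else 0.

Lemma birkhoff_max_ge0 N w : 0 <= birkhoff_max N w.
Proof. by case: N => [|N] //=; rewrite le_max lexx. Qed.

Lemma birkhoff_max_ge N k w : (k <= N)%N -> birkhoff_sum phi k w <= birkhoff_max N w.
Proof.
elim: N k w => [|N ih] [|k] w //.
- by move=> _; rewrite /birkhoff_sum big_geq.
- by move=> _; rewrite /birkhoff_sum big_geq// birkhoff_max_ge0.
- by move=> kN; rewrite birkhoff_sumS /= le_max lerD2l ih ?orbT.
Qed.

Lemma birkhoff_max_attained N w : exists2 k, (k <= N)%N & birkhoff_max N w = birkhoff_sum phi k w.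
Proof.
elim: N w => [|N ih] w; first by exists 0%N => //; rewrite /birkhoff_sum big_geq.
have [k kN kE] := ih (tau w); rewrite /=; case: leP => _; last first.
  by exists 0%N => //; rewrite /birkhoff_sum big_geq.
by exists k.+1 => //; rewrite birkhoff_sumS kE.
Qed.

Lemma measurable_birkhoff_max N : measurable_fun setT (birkhoff_max N).
Proof.
elim: N => [|N ih] /=; first exact: measurable_cst.
apply: measurable_maxr; first exact: measurable_cst.
apply: measurable_funD; first exact: measurable_funB.
exact: measurableT_comp.
Qed.

Lemma birkhoff_max_homo N w : birkhoff_max N w <= birkhoff_max N.+1 w.
Proof.
have [k kN ->] := birkhoff_max_attained N w; apply: birkhoff_max_ge; exact: leqW.
Qed.

Lemma integral_birkhoff_max N : (\int[mu]_w (birkhoff_max N w)%:E < +oo)%E.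
Proof.
elim: N => [|N ih]; first by rewrite integral0.
have mM := measurable_birkhoff_max.
apply: (@le_lt_trans _ _ (\int[mu]_w (a w)%:E + \int[mu]_w (birkhoff_max N (tau w))%:E)%E).
  apply: integral_leD => //.
  - by apply: measurableT_comp.
  - by move=> w _; exact: birkhoff_max_ge0.
  - by move=> w _; exact: birkhoff_max_ge0.
  - move=> w _ /=; rewrite ge_max addr_ge0 ?birkhoff_max_ge0//= lerD2r.
    by rewrite lerBlDr lerDl.
rewrite ge0_integral_endomorphism//; first exact: lte_add_pinfty.
by move=> w; exact: birkhoff_max_ge0.
Qed.

(** Garsia's argument: where the maximum [M N] is positive it is at most
    [phi + M N \o tau]. Integrate over that set; [M N] vanishes off it, and
    [M N \o tau] has the same total integral as [M N], so the integral of
    [phi] over the set is nonnegative. Keeping the two parts of [phi = a - b]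
    apart leaves only integrals of nonnegative functions. *)
Lemma maximal_ergodic_finite N :
  (\int[mu]_(w in [set w | (0 < birkhoff_max N w)%R]) (b w)%:E <=
   \int[mu]_(w in [set w | (0 < birkhoff_max N w)%R]) (a w)%:E)%E.
Proof.
set A := [set w | _]; have mM := measurable_birkhoff_max N.
have M0 := birkhoff_max_ge0 N.
have mMt : measurable_fun setT (fun w => birkhoff_max N (tau w)) by exact: measurableT_comp.
have mA : measurable A.
  by rewrite -[A]setTI; exact: measurable_fun_ltr.
have iM := integral_birkhoff_max N.
have AE : (\int[mu]_(w in A) (birkhoff_max N w)%:E = \int[mu]_w (birkhoff_max N w)%:E)%E.
  rewrite [LHS]integral_mkcond; apply: eq_integral => w _; rewrite patchE.
  case: ifPn => // /negP wA; congr EFin; apply/eqP; rewrite eq_le M0/= leNgt.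
  by apply/negP => h; apply: wA; exact: mem_set.
have iMfin : (\int[mu]_w (birkhoff_max N w)%:E)%E \is a fin_num.
  by rewrite ge0_fin_numE//; apply: integral_ge0 => w _; rewrite lee_fin.
have EF (c : T -> R) : measurable_fun setT c -> measurable_fun A (fun w => (c w)%:E).
  by move=> mc; apply/measurable_EFinP; exact: measurable_funTS.
have : (\int[mu]_(w in A) (birkhoff_max N w)%:E + \int[mu]_(w in A) (b w)%:E <=
   \int[mu]_(w in A) (a w)%:E + \int[mu]_(w in A) (birkhoff_max N (tau w))%:E)%E.
  rewrite -!ge0_integralD//; try exact: EF; try (by move=> w _; rewrite lee_fin ?M0).
  apply: ge0_le_integral => //.
  - by move=> w _; rewrite -EFinD lee_fin addr_ge0.
  - by apply: emeasurable_funD; exact: EF.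
  - by apply: emeasurable_funD; exact: EF.
  move=> w; rewrite /A/= -!EFinD lee_fin.
  case: (N) => [|N'] /=; first by rewrite ltxx.
  rewrite lt_max ltxx/= => h; rewrite [X in X + _](max_r (ltW h)) addrAC subrK.
  by rewrite lerD2l; exact: (birkhoff_max_homo N' (tau w)).
rewrite AE => H.
rewrite -(@leeD2lE _ (\int[mu]_w (birkhoff_max N w)%:E)%E)//.
apply: (le_trans H); rewrite addeC leeD2r//.
rewrite -[leRHS]ge0_integral_endomorphism//.
apply: ge0_subset_integral => //; first exact/measurable_EFinP.
by move=> w _; rewrite lee_fin.
Qed.

Lemma maximal_ergodic (A : set T) :
  A = [set w | exists k, 0 < birkhoff_sum phi k w] ->
  (\int[mu]_(w in A) (b w)%:E <= \int[mu]_(w in A) (a w)%:E)%E.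
Proof.
pose B N := [set w | 0 < birkhoff_max N w].
have mB N : measurable (B N).
  by rewrite -[B N]setTI; apply: measurable_fun_ltr => //; exact: measurable_birkhoff_max.
have ndB : nondecreasing_seq B.
  apply/nondecreasing_seqP => N; apply/subsetPset => w /lt_le_trans; apply.
  exact: birkhoff_max_homo.
have -> : [set w | exists k, 0 < birkhoff_sum phi k w] = \bigcup_N B N.
  apply/seteqP; split=> [w /= [k k0]|w [N _]].
    by exists k => //; rewrite /B/= (lt_le_trans k0)// birkhoff_max_ge.
  by rewrite /B/=; have [k _ ->] := birkhoff_max_attained N w => k0; exists k.
move=> ->.
have ca := @ge0_nondecreasing_set_cvg_integral _ _ _ B (EFin \o a) mu ndB mB.
have cb := @ge0_nondecreasing_set_cvg_integral _ _ _ B (EFin \o b) mu ndB mB.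
have mU : measurable (\bigcup_N B N) by exact: bigcupT_measurable.
have {}ca : (\int[mu]_(w in B N) (a w)%:E)%E @[N --> \oo] --> (\int[mu]_(w in \bigcup_N B N) (a w)%:E)%E.
  by apply: ca => [N|N w _]; [apply/measurable_EFinP; exact: measurable_funTS|rewrite lee_fin].
have {}cb : (\int[mu]_(w in B N) (b w)%:E)%E @[N --> \oo] --> (\int[mu]_(w in \bigcup_N B N) (b w)%:E)%E.
  by apply: cb => [N|N w _]; [apply/measurable_EFinP; exact: measurable_funTS|rewrite lee_fin].
have /cvg_lim <- // := cb; have /cvg_lim <- // := ca.
apply: lee_lim; [by apply/cvg_ex; eexists; exact: cb|by apply/cvg_ex; eexists; exact: ca|].
by apply: nearW => N; exact: maximal_ergodic_finite.
Qed.

End MaximalErgodic.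

Section Oscillation.
Context {R : realType}.
Implicit Types (x y : nat -> R) (c : R).

(** The lower limit of [x] is less than [c]. The margin makes this a property
    of [x] up to sequences tending to 0, and a countable condition. *)
Definition often_below x c : Prop :=
  exists j : nat, forall N, exists n, (N <= n)%N /\ x n + j.+1%:R^-1 < c.

Lemma often_below_close x y c : (x n - y n @[n --> \oo] --> 0) ->
  often_below x c -> often_below y c.
Proof.
move=> xy [j xj]; exists (2 * j).+1 => N.
have j0 : 0 < (2 * j).+2%:R^-1 :> R by [].
move/cvgrPdist_lt : xy => /(_ _ j0) [M _ HM].
have [n [Nn xn]] := xj (maxn N M); move: Nn; rewrite geq_max => /andP[Nn Mn].
exists n; split => //; have := HM _ Mn; rewrite /= sub0r normrN ltr_norml => /andP[h _].
have E : j.+1%:R^-1 = (2 * j).+2%:R^-1 + (2 * j).+2%:R^-1 :> R.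
  have -> : (2 * j).+2%:R = 2 * j.+1%:R :> R by rewrite -natrM mulnS.
  have : j.+1%:R != 0 :> R by rewrite pnatr_eq0.
  by set t := j.+1%:R => t0; field.
rewrite E in xn; move: h xn; set a := (2 * j).+2%:R^-1 => h xn; lra.
Qed.

(** Two rationals between the lower and the upper limit; boundedness makes
    these limits finite. *)
Lemma oscillation x : (forall n, 0 <= x n <= 1) -> ~ cvgn x ->
  exists p q : rat, [/\ 0 < (ratr p : R), (ratr p : R) < ratr q,
    often_below x (ratr p) & often_below (fun n => - x n) (- ratr q)].
Proof.
move=> x01 ncx; pose u n := (x n)%:E.
pose L := ereal_sup (range (einfs u)); pose U := ereal_inf (range (esups u)).
have einf_ge0 n : (0 <= einfs u n)%E.
  apply: le_ereal_inf_tmp => _ [m _ <-]; rewrite /u lee_fin.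
  by have /andP[] := x01 m.
have esup_le1 n : (esups u n <= 1%:E)%E.
  apply: ge_ereal_sup => _ [m _ <-]; rewrite /u lee_fin.
  by have /andP[] := x01 m.
have eL : einfs u @ \oo --> L by exact: cvg_einfs_sup.
have eU : esups u @ \oo --> U by exact: cvg_esups_inf.
have LU : (L <= U)%E.
  have /cvg_lim <- // := eL; have /cvg_lim <- // := eU.
  apply: lee_lim; [exact: is_cvg_einfs|exact: is_cvg_esups|].
  by apply: nearW => n; exact: einfs_le_esups.
have L0 : (0 <= L)%E.
  by apply: (le_trans (einf_ge0 0%N)); apply: ereal_sup_ubound; exists 0%N.
have U1 : (U <= 1%:E)%E.
  by apply: le_trans (esup_le1 0%N); apply: ereal_inf_lbound; exists 0%N.
have Lfin : L \is a fin_num by rewrite ge0_fin_numE// (le_lt_trans (le_trans LU U1))// ltry.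
have Ufin : U \is a fin_num.
  by rewrite ge0_fin_numE ?(le_trans L0 LU)// (le_lt_trans U1)// ltry.
have {LU} LU : (fine L < fine U).
  rewrite lt_neqAle fine_le// andbT; apply/eqP => E; apply: ncx.
  have UL : U = L by rewrite -(fineK Ufin) -(fineK Lfin) E.
  have uL : u n @[n --> \oo] --> L.
    apply: (@squeeze_cvge _ _ _ _ (einfs u) _ (esups u)).
    - apply: nearW => n; apply/andP; split.
        by apply: ereal_inf_lbound; exists n => /=.
      by apply: ereal_sup_ubound; exists n => /=.
    - exact: eL.
    - by rewrite -UL; exact: eU.
  have xL : fine (u n) @[n --> \oo] --> fine L by apply: fine_cvg; rewrite fineK.
  by apply/cvg_ex; exists (fine L); exact: xL.
have l0 : 0 <= fine L by rewrite fine_ge0.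
set l := fine L in LU l0; set v := fine U in LU.
have [|p] := @rat_in_itvoo R l ((l + v) / 2); first by lra.
rewrite in_itv/= => /andP[lp pm].
have [|q] := @rat_in_itvoo R ((l + v) / 2) v; first by lra.
rewrite in_itv/= => /andP[mq qv].
exists p, q; split; [lra|lra| |].
- have pl : 0 < ratr p - l by rewrite subr_gt0.
  have [j] := ltr_add_invr pl; rewrite add0r => jp.
  exists j => N; have : (einfs u N < (ratr p - j.+1%:R^-1)%:E)%E.
    apply: (@le_lt_trans _ _ L); first by apply: ereal_sup_ubound; exists N.
    by rewrite -(fineK Lfin) lte_fin -/l ltrBrDr addrC -ltrBrDr.
  move=> /ereal_inf_lt[_ [n /= Nn <-]]; rewrite /u lte_fin => h.
  by exists n; split => //; rewrite -ltrBrDr.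
- have qv' : 0 < v - ratr q by rewrite subr_gt0.
  have [j] := ltr_add_invr qv'; rewrite add0r => jq.
  exists j => N; have : ((ratr q + j.+1%:R^-1)%:E < esups u N)%E.
    apply: (@lt_le_trans _ _ U); last by apply: ereal_inf_lbound; exists N.
    by rewrite -(fineK Ufin) lte_fin -/v addrC -ltrBrDr.
  move=> /ereal_sup_gt[_ [n /= Nn <-]]; rewrite /u lte_fin => h.
  by exists n; split => //; rewrite addrC ltrBlDr -ltrBlDl opprK addrC.
Qed.

End Oscillation.

Section Birkhoff.
Context {d : measure_display} {T : measurableType d} {R : realType}.
Variable mu : {finite_measure set T -> \bar R}.
Variable tau : T -> T.
Hypothesis endo : endomorphism mu tau.

Let mtau : measurable_fun setT tau := endo.1.

(** Multiplied by the indicator of an invariant set, [a] and [b] keep their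
    values along the orbits inside it and vanish along the others. *)
Lemma maximal_ergodic_invariant (a b : T -> R) (E : set T) : measurable E ->
  (forall w, E (tau w) <-> E w) ->
  measurable_fun setT a -> measurable_fun setT b ->
  (forall w, 0 <= a w) -> (forall w, 0 <= b w) -> (\int[mu]_w (a w)%:E < +oo)%E ->
  (forall w, E w -> exists k, 0 < birkhoff_sum tau (fun w => a w - b w) k w) ->
  (\int[mu]_(w in E) (b w)%:E <= \int[mu]_(w in E) (a w)%:E)%E.
Proof.
move=> mE Etau ma mb a0 b0 ia Ek.
have iterE i w : E w -> E (iter i tau w) by elim: i => //= i ih /ih /Etau.
have iterNE i w : ~ E w -> ~ E (iter i tau w).
  by elim: i => //= i ih nE /Etau h; exact: ih nE h.
have mI : measurable_fun setT (\1_E : T -> R) by exact: measurable_indic.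
have := @maximal_ergodic _ _ _ mu tau endo (fun w => \1_E w * a w) (fun w => \1_E w * b w) _ _ _ _ _ E.
have r (c : T -> R) : (\int[mu]_(w in E) (\1_E w * c w)%:E = \int[mu]_(w in E) (c w)%:E)%E.
  by apply: eq_integral => w wE; rewrite indicE wE mul1r.
rewrite !r; apply => //.
- exact: measurable_funM.
- exact: measurable_funM.
- by move=> w; rewrite mulr_ge0.
- by move=> w; rewrite mulr_ge0.
- rewrite integral_indicM//; apply: le_lt_trans ia.
  apply: ge0_subset_integral => //; first exact/measurable_EFinP.
  by move=> w _; rewrite lee_fin.
- apply/seteqP; split=> [w wE|w /= [k]] /=.
    have [k k0] := Ek _ wE; exists k; rewrite /birkhoff_sum in k0 *.
    rewrite (lt_le_trans k0)// le_eqVlt; apply/orP; left; apply/eqP.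
    by apply: eq_bigr => i _; rewrite !indicE (mem_set (iterE i w wE)) !mul1r.
  apply: contraPP => nE; rewrite /birkhoff_sum big1 ?ltxx// => i _.
  by rewrite !indicE (memNset (iterNE i w nE)) !mul0r subrr.
Qed.

Lemma maximal_ergodic_weak (h : T -> R) (c : R) : measurable_fun setT h ->
  (forall w, 0 <= h w) -> (\int[mu]_w (h w)%:E < +oo)%E -> 0 <= c ->
  (c%:E * mu [set w | exists k, (0 < birkhoff_sum tau (fun w => h w - c) k w)%R] <=
   \int[mu]_w (h w)%:E)%E.
Proof.
move=> mh h0 ih c0; set A := [set w | _].
have mA : measurable A.
  rewrite (_ : A = \bigcup_k [set w | 0 < birkhoff_sum tau (fun w => h w - c) k w]); last first.
    by apply/seteqP; split=> [w [k ?]|w [k _ ?]]; exists k.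
  apply: bigcupT_measurable => k; rewrite -[X in measurable X]setTI.
  apply: measurable_fun_ltr => //.
  by apply: (measurable_birkhoff_sum endo); exact: measurable_funB.
have := @maximal_ergodic _ _ _ mu tau endo h (cst c) mh (measurable_cst _) h0 (fun=> c0) ih A erefl.
rewrite integral_cst_on// => /le_trans; apply.
by apply: ge0_subset_integral => //; [exact/measurable_EFinP|move=> w _; rewrite lee_fin].
Qed.

Variable h : T -> R.
Hypothesis mh : measurable_fun setT h.
Hypothesis h01 : forall w, 0 <= h w <= 1.

Let x w n := n%:R^-1 * birkhoff_sum tau h n w.

Let x01 w n : 0 <= x w n <= 1.
Proof.
rewrite /x; case: n => [|n]; first by rewrite invr0 mul0r lexx ler01.
apply/andP; split.
  by rewrite mulr_ge0// sumr_ge0// => i _; case/andP: (h01 (iter i tau w)).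
rewrite ler_pdivrMl// mulr1 (le_trans (@ler_sum _ _ _ _ _ (fun=> 1) _))//.
  by move=> i _; case/andP: (h01 (iter i tau w)).
by rewrite sumr_const_nat subn0.
Qed.

Let xtau w : x w n - x (tau w) n @[n --> \oo] --> 0.
Proof.
apply/cvgrPdist_le => e e0; have [j] := ltr_add_invr e0; rewrite add0r => je.
exists j.+1 => // -[//|n] /= jn; rewrite sub0r normrN /x -mulrBr.
have -> : birkhoff_sum tau h n.+1 w - birkhoff_sum tau h n.+1 (tau w) =
    h w - h (iter n.+1 tau w).
  rewrite birkhoff_sumS {2}/birkhoff_sum big_nat_recr//= -iterSr -/(birkhoff_sum tau h n (tau w)).
  by rewrite opprD addrA addrK.
rewrite normrM ger0_norm// (le_trans _ (ltW je))//.
rewrite -[leRHS]mulr1; apply: ler_pM => //.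
  by rewrite lef_pV2 ?posrE// ler_nat.
have /andP[? ?] := h01 w; have /andP[? ?] := h01 (iter n.+1 tau w).
by rewrite ler_norml; apply/andP; split; lra.
Qed.

Let mx n : measurable_fun setT (fun w => x w n).
Proof.
apply: measurable_funM; first exact: measurable_cst.
exact: (measurable_birkhoff_sum endo n mh).
Qed.

Lemma measurable_often_below (y : T -> nat -> R) c :
  (forall n, measurable_fun setT (fun w => y w n)) ->
  measurable [set w | often_below (y w) c].
Proof.
move=> my; have -> : [set w | often_below (y w) c] =
    \bigcup_j \bigcap_N \bigcup_n [set w | (N <= n)%N /\ y w n + j.+1%:R^-1 < c].
  apply/seteqP; split=> [w [j H]|w [j _ H]]; exists j => //.
    by move=> N _; have [n ?] := H N; exists n.
  by move=> N; have [n _ ?] := H N I; exists n.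
apply: bigcupT_measurable => j; apply: bigcapT_measurable => N.
apply: bigcupT_measurable => n; have [Nn|Nn] := leqP N n; last first.
  by rewrite (_ : mkset _ = set0)//; apply/seteqP; split=> [w [] |w []].
rewrite (_ : mkset _ = [set w | y w n + j.+1%:R^-1 < c]); last first.
  by apply/seteqP; split=> w //= [].
rewrite -[X in measurable X]setTI; apply: measurable_fun_ltr => //.
by apply: measurable_funD => //; exact: measurable_cst.
Qed.

Let E (p q : R) := [set w | often_below (x w) p] `&` [set w | often_below (fun n => - x w n) (- q)].

Let mE p q : measurable (E p q).
Proof.
apply: measurableI; apply: measurable_often_below => n //.
by apply: measurableT_comp => //; exact: mx.
Qed.

Let Etau p q w : E p q (tau w) <-> E p q w.
Proof.
have eq0 (u v : nat -> R) : u =1 v -> u n @[n --> \oo] --> 0 -> v n @[n --> \oo] --> 0.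
  by move=> /funext ->.
have Nx : - (x w n - x (tau w) n) @[n --> \oo] --> 0.
  by rewrite -[X in _ --> X]oppr0; apply: cvgN; exact: xtau.
have xt : - x w n - - x (tau w) n @[n --> \oo] --> 0.
  by apply: eq0 Nx => n; rewrite opprD.
have xt' : x (tau w) n - x w n @[n --> \oo] --> 0.
  by apply: eq0 Nx => n; rewrite opprB.
have xt'' : - x (tau w) n - - x w n @[n --> \oo] --> 0.
  by apply: eq0 (xtau w) => n; rewrite opprK addrC.
split=> -[E1 E2]; split.
- exact: often_below_close xt' E1.
- exact: often_below_close xt'' E2.
- exact: often_below_close (@xtau w) E1.
- exact: often_below_close xt E2.
Qed.

Let E0 p q : 0 < p -> p < q -> mu (E p q) = 0%E.
Proof.
move=> p0 pq.
have h0 w : 0 <= h w by case/andP: (h01 w).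
have mT : mu setT \is a fin_num by exact: fin_num_measure.
have mEfin : mu (E p q) \is a fin_num by exact: fin_num_measure.
have sumB c k w : birkhoff_sum tau (fun w => h w - c) k w = birkhoff_sum tau h k w - c * k%:R.
  by rewrite /birkhoff_sum sumrB sumr_const_nat subn0 mulr_natr.
have cint (c : R) : (\int[mu]_w c%:E < +oo)%E.
  by rewrite integral_cst_on// -[X in (_ * X)%E]fineK// -EFinM ltry.
have I1 : (q%:E * mu (E p q) <= \int[mu]_(w in E p q) (h w)%:E)%E.
  rewrite -integral_cst_on//.
  apply: (maximal_ergodic_invariant (b := fun=> q) (mE p q) (Etau p q)) => //.
  - by move=> w; rewrite ltW// (lt_trans p0).
  - apply: le_lt_trans (cint 1); apply: integral_le => // w _; by case/andP: (h01 w).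
  - move=> w [_ [j /(_ 1%N) [n [n1 xn]]]]; exists n; rewrite sumB subr_gt0.
    have n0 : 0 < n%:R :> R by rewrite ltr0n.
    rewrite mulrC -ltr_pdivlMl// -/(x w n).
    by rewrite -ltrN2 (le_lt_trans _ xn)// lerDl.
have I2 : (\int[mu]_(w in E p q) (h w)%:E <= p%:E * mu (E p q))%E.
  rewrite -integral_cst_on//.
  apply: (maximal_ergodic_invariant (a := fun=> p) (mE p q) (Etau p q)) => //.
  - by move=> w; exact: ltW.
  - move=> w [[j /(_ 1%N) [n [n1 xn]]] _]; exists n.
    have -> : birkhoff_sum tau (fun w => p - h w) n w = p * n%:R - birkhoff_sum tau h n w.
      by rewrite /birkhoff_sum sumrB sumr_const_nat subn0 mulr_natr.
    have n0 : 0 < n%:R :> R by rewrite ltr0n.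
    rewrite subr_gt0 mulrC -ltr_pdivrMl// -/(x w n).
    by rewrite (le_lt_trans _ xn)// lerDl.
have := le_trans I1 I2; rewrite -(fineK mEfin) -!EFinM lee_fin => H.
congr EFin; apply/eqP; rewrite eq_le fine_ge0// andbT.
have qp : 0 < q - p by rewrite subr_gt0.
by rewrite -(pmulr_rle0 _ qp) mulrBl subr_le0.
Qed.

(** Let [E p q] be the set where the averages have lower limit below [p] and
    upper limit above [q]. It is invariant, because the averages at [w] and at
    [tau w] differ by at most [n%:R^-1]. The maximal lemma on [E p q], for
    [h - q] and for [p - h], gives
    [q * mu (E p q) <= \int_(E p q) h <= p * mu (E p q)],
    so [E p q] is null for [p < q]. *)
Lemma birkhoff_bounded : {ae mu, forall w, cvgn (fun n => n%:R^-1 * birkhoff_sum tau h n w)}.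
Proof.
have nE (p q : rat) : mu.-negligible
    [set w | 0 < (ratr p : R) /\ (ratr p : R) < ratr q /\ E (ratr p) (ratr q) w].
  have [p0|p0] := ltP 0 (ratr p : R); last first.
    rewrite (_ : mkset _ = set0); first exact: negligible_set0.
    by apply/seteqP; split=> w //= [].
  have [pq|pq] := ltP (ratr p : R) (ratr q); last first.
    rewrite (_ : mkset _ = set0); first exact: negligible_set0.
    by apply/seteqP; split=> w //= [_ []].
  apply: negligibleS ((negligibleP mu (mE _ _)).2 (E0 p0 pq)).
  by move=> w /= [_ []].
have : mu.-negligible (\bigcup_m (if (choice.unpickle m : option (rat * rat)) is Some (p, q)
    then [set w | 0 < (ratr p : R) /\ (ratr p : R) < ratr q /\ E (ratr p) (ratr q) w] else set0)).
  apply: negligible_bigcup => m; case: (choice.unpickle m) => [[p q]|]; first exact: nE.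
  exact: negligible_set0.
apply: negligibleS => w /= ncx.
have [p [q [p0 pq E1 E2]]] := oscillation (x01 w) ncx.
refine (ex_intro2 _ _ (choice.pickle (p, q)) I _); rewrite choice.pickleK.
exact (conj p0 (conj pq (conj E1 E2))).
Qed.

End Birkhoff.

(** * Ergodic means of vector-valued functions *)

Section ErgodicVector.
Context {d : measure_display} {T : measurableType d} {R : realType}
  {X : completeNormedModType R}.
Variable mu : {finite_measure set T -> \bar R}.
Variable tau : T -> T.
Hypothesis endo : endomorphism mu tau.
Implicit Types (f g s t : T -> X).

Local Notation SM := (@strongly_measurable d T R X measurable).
Local Notation int1 f := (\int[mu]_w `|f w|%:E)%E.
Local Notation bint := (bochner_integrable mu).
Local Notation S n f := (ergodic_mean tau n f).

Let mtau : measurable_fun setT tau := endo.1.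

Lemma iter_generated_operator f i w :
  iter i (generated_operator tau) f w = f (iter i tau w).
Proof.
elim: i w => [//|i ih] w; rewrite [LHS]/= /generated_operator /= ih -iterSr.
by rewrite iterS.
Qed.

Lemma ergodic_meanE n f w :
  S n f w = n%:R^-1 *: \sum_(0 <= i < n) f (iter i tau w).
Proof.
by rewrite /ergodic_mean; congr (_ *: _); apply: eq_bigr => i _; exact: iter_generated_operator.
Qed.

Lemma ergodic_mean_lin n (c : R) f g w :
  S n (fun w => f w + c *: g w) w = S n f w + c *: S n g w.
Proof.
rewrite !ergodic_meanE big_split/= scalerDr -scaler_sumr; congr (_ + _).
by rewrite !scalerA mulrC.
Qed.

Lemma ergodic_meanB n f g w : S n (fun w => f w - g w) w = S n f w - S n g w.
Proof.
rewrite -[X in _ = _ + X]scaleN1r -ergodic_mean_lin !ergodic_meanE; congr (_ *: _).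
by apply: eq_bigr => i _; rewrite scaleN1r.
Qed.

Lemma ergodic_mean_norm n f w :
  `|S n f w| <= n%:R^-1 * birkhoff_sum tau (fun w => `|f w|) n w.
Proof.
rewrite ergodic_meanE normrZ ger0_norm ?invr_ge0// ler_wpM2l ?invr_ge0//.
exact: ler_norm_sum.
Qed.

Lemma strongly_measurable_ergodic_mean n f : SM f -> SM (S n f).
Proof.
move=> mf; rewrite (_ : S n f = fun w => n%:R^-1 *: \sum_(0 <= i < n) f (iter i tau w)).
  apply: strongly_measurableZ; apply: strongly_measurable_sum => i.
  exact: (strongly_measurable_comp (measurable_iter endo i)).
by apply/funext => w; exact: ergodic_meanE.
Qed.

Lemma birkhoff_sum_ge0 n (h : T -> R) w : (forall w, 0 <= h w) -> 0 <= birkhoff_sum tau h n w.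
Proof. by move=> h0; apply: sumr_ge0. Qed.

Lemma ge0_integral_birkhoff_sum n (h : T -> R) : measurable_fun setT h -> (forall w, 0 <= h w) ->
  (\int[mu]_w (birkhoff_sum tau h n w)%:E = n%:R%:E * \int[mu]_w (h w)%:E)%E.
Proof.
move=> mh h0; have I0 : (0 <= \int[mu]_w (h w)%:E)%E.
  by apply: integral_ge0 => w _; rewrite lee_fin.
elim: n => [|n ih].
  rewrite mul0e -[RHS](integral0 mu setT); apply: eq_integral => w _.
  by rewrite /birkhoff_sum big_geq.
have mn := measurable_birkhoff_sum endo n mh.
have n0 w : 0 <= birkhoff_sum tau h n w := birkhoff_sum_ge0 n w h0.
under eq_integral do rewrite birkhoff_sumS EFinD.
rewrite ge0_integralD//.
- rewrite (ge0_integral_endomorphism endo mn n0) ih -natr1 EFinD ge0_muleDl ?lee_fin//.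
  by rewrite mul1e addeC.
- by move=> w _; rewrite lee_fin.
- exact/measurable_EFinP.
- by move=> w _; rewrite lee_fin.
- by apply/measurable_EFinP; exact: measurableT_comp.
Qed.

Lemma ge0_integral_birkhoff_mean_le n (h : T -> R) : measurable_fun setT h -> (forall w, 0 <= h w) ->
  (\int[mu]_w (n%:R^-1 * birkhoff_sum tau h n w)%:E <= \int[mu]_w (h w)%:E)%E.
Proof.
move=> mh h0; have I0 : (0 <= \int[mu]_w (h w)%:E)%E.
  by apply: integral_ge0 => w _; rewrite lee_fin.
have nV0 : 0 <= n%:R^-1 :> R by rewrite invr_ge0.
rewrite (integral_scale mu measurableT (measurable_birkhoff_sum endo n mh)
  (fun w _ => birkhoff_sum_ge0 n w h0) nV0).
rewrite ge0_integral_birkhoff_sum// muleA -EFinM.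
case: n {nV0} => [|n]; first by rewrite mulr0 mul0e.
by rewrite mulVf ?pnatr_eq0// mul1e.
Qed.

(** Convexity of the p-th power along an orbit, in the tangent form of
    [powR_tangent] with [c] the norm of the mean. *)
Lemma moment_ergodic_mean p n f : 1 <= p -> SM f ->
  (moment mu p (S n f) <= moment mu p f)%E.
Proof.
move=> p1 mf; have mm := measurable_moment p mf.
apply: le_trans (ge0_integral_birkhoff_mean_le n mm (fun w => powR_ge0 _ _)).
apply: integral_le => //.
- by apply: measurable_moment; exact: strongly_measurable_ergodic_mean.
- by apply: measurable_funM => //; exact: (measurable_birkhoff_sum endo n mm).
move=> w _; case: n => [|n].
  rewrite ergodic_meanE big_geq// scaler0 normr0 powR0 ?gt_eqF ?(lt_le_trans ltr01)//.
  by rewrite invr0 mul0r.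
have p0 : 0 < p by exact: lt_le_trans ltr01 p1.
set c := `|S n.+1 f w|; have c0 : 0 <= c by exact: normr_ge0.
have n0 : 0 < n.+1%:R :> R by [].
apply: (convex_absorb p0).
rewrite -(mulr_powRB1 c0 p0).
apply: (@le_trans _ _ (n.+1%:R^-1 * birkhoff_sum tau (fun w => `|f w| * c `^ (p - 1)) n.+1 w)).
  rewrite /birkhoff_sum -mulr_suml mulrA ler_wpM2r ?powR_ge0//.
  exact: ergodic_mean_norm.
apply: (@le_trans _ _ (n.+1%:R^-1 *
    birkhoff_sum tau (fun w => `|f w| `^ p / p + c `^ p * (1 - p^-1)) n.+1 w)).
  rewrite ler_wpM2l ?invr_ge0//; apply: ler_sum => i _.
  by apply: powR_tangent.
rewrite /birkhoff_sum big_split/= -mulr_suml sumr_const_nat subn0 mulr_powRB1//.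
rewrite -[X in _ * (_ + X)]mulr_natr le_eqVlt; apply/orP; left; apply/eqP.
have : n.+1%:R != 0 :> R by rewrite gt_eqF.
have : p != 0 by rewrite gt_eqF.
set N := n.+1%:R; set A := \sum_(_ <= _ < _) _ => pn Nn.
by field; apply/andP.
Qed.

Lemma ergodic_mean_bounded n f (C : R) w : (forall w, `|f w| <= C) -> `|S n f w| <= C.
Proof.
move=> fC; have C0 : 0 <= C by exact: le_trans (fC w).
rewrite (le_trans (ergodic_mean_norm n f w))//.
case: n => [|n]; first by rewrite invr0 mul0r.
rewrite ler_pdivrMl// (le_trans (@ler_sum _ _ _ _ _ (fun=> C) _))//.
by rewrite sumr_const_nat subn0 mulr_natl.
Qed.

Lemma bochner_integrable_ergodic_mean n f : bint f -> bint (S n f).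
Proof.
move=> /integrable_moment1[mf ff]; apply/integrable_moment1; split.
  exact: strongly_measurable_ergodic_mean.
by apply: le_lt_trans ff; exact: moment_ergodic_mean.
Qed.

(** On a multiple of an indicator the means are real Birkhoff averages times a
    fixed vector. *)
Lemma ergodic_mean_cvg_simple s : finitely_valued s ->
  {ae mu, forall w, cvgn (fun n => S n s w)}.
Proof.
move: s; apply: (finitely_valued_ind (P := fun s => {ae mu, forall w, cvgn (fun n => S n s w)})).
  move=> B x mB; have mI : measurable_fun setT (\1_B : T -> R) by exact: measurable_indic.
  have I01 w : 0 <= (\1_B w : R) <= 1 by rewrite indicE; case: (w \in B); rewrite ?lexx ?ler01.
  apply: filterS (birkhoff_bounded endo mI I01) => w cw.
  have -> : (fun n => S n (fun w => \1_B w *: x) w) =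
      (fun n => (n%:R^-1 * birkhoff_sum tau \1_B n w) *: x).
    by apply/funext => n; rewrite ergodic_meanE -scaler_suml scalerA.
  by apply: is_cvgZ => //; exact: is_cvg_cst.
move=> s t _ _; apply: filterS2 => w cs ct.
have -> : (fun n => S n (fun w => s w + t w) w) = (fun n => S n s w + S n t w).
  by apply/funext => n; rewrite -[in RHS](scale1r (S n t w)) -ergodic_mean_lin;
    rewrite !ergodic_meanE; under [in RHS]eq_bigr do rewrite scale1r.
exact: is_cvgD.
Qed.

Lemma ergodic_mean_weak n f (e : R) w : 0 < e -> e < `|S n f w| ->
  exists k, 0 < birkhoff_sum tau (fun w => `|f w| - e) k w.
Proof.
move=> e0 eS; exists n; case: n eS => [|n] eS.
  by move: eS; rewrite ergodic_meanE big_geq// scaler0 normr0 ltNge ltW.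
rewrite /birkhoff_sum sumrB sumr_const_nat subn0 subr_gt0.
have := lt_le_trans eS (ergodic_mean_norm _ f w).
by rewrite ltr_pdivlMl// mulr_natl.
Qed.

(** The norms of the means are dominated by the averages of the norm, to which
    the real maximal lemma applies with the constant [e]. *)
Lemma ergodic_mean_maximal f (e : R) : bint f -> 0 < e ->
  exists B, [/\ measurable B, (e%:E * mu B <= int1 f)%E & forall n w, e < `|S n f w| -> B w].
Proof.
move=> [mf ff] e0; have mnf := strongly_measurable_norm mf.
exists [set w | exists k, 0 < birkhoff_sum tau (fun w => `|f w| - e) k w]; split.
- rewrite (_ : mkset _ = \bigcup_k [set w | 0 < birkhoff_sum tau (fun w => `|f w| - e) k w]).
    apply: bigcupT_measurable => k; rewrite -[X in measurable X]setTI.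
    apply: measurable_fun_ltr => //; apply: (measurable_birkhoff_sum endo).
    by apply: measurable_funB => //; exact: measurable_cst.
  by apply/seteqP; split=> [w [k ?]|w [k _ ?]]; exists k.
- by apply: (maximal_ergodic_weak endo) => //; exact: ltW.
- by move=> n w; exact: ergodic_mean_weak.
Qed.

(** Banach's principle, with the means of simple functions as approximating
    sequences and [ergodic_mean_maximal] for the difference. *)
Lemma ergodic_mean_ae_cvg f : bint f -> {ae mu, forall w, cvgn (fun n => S n f w)}.
Proof.
move=> intf; apply: ae_cvgn_approx => e e0.
have [s [fs sf]] := simple_approximation_mean intf (mulr_gt0 e0 e0).
have ints := bochner_integrable_simple mu fs.
have [B [mB muB BS]] := ergodic_mean_maximal (bochner_integrableB intf ints) e0.
exists (fun n => S n s), B; split => //.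
- exact: ergodic_mean_cvg_simple.
- rewrite -(@lee_pmul2l _ e%:E)//; rewrite -EFinM; exact: le_trans muB sf.
- by move=> n w h; apply: (BS n); rewrite ergodic_meanB.
Qed.

Lemma ergodic_limitE f w : ergodic_limit tau f w =
  if w \in [set w | cvgn (fun n => S n f w)] then limn (fun n => S n f w) else point.
Proof.
rewrite /ergodic_limit; case: ifPn => // /negP ncw.
have {}ncw : ~ cvgn (fun n => S n f w) by move=> h; apply: ncw; exact: mem_set.
exact: dvgP.
Qed.

Lemma strongly_measurable_ergodic_limit f : SM f -> SM (ergodic_limit tau f).
Proof.
move=> mf; rewrite (_ : ergodic_limit tau f = (fun w =>
  if w \in [set w | cvgn (fun n => S n f w)] then limn (fun n => S n f w) else point)).
  by apply: strongly_measurable_lim => n; exact: strongly_measurable_ergodic_mean.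
by apply/funext => w; exact: ergodic_limitE.
Qed.

Lemma ergodic_limit_ae f : bint f ->
  {ae mu, forall w, S n f w @[n --> \oo] --> ergodic_limit tau f w}.
Proof. by move=> intf; apply: filterS (ergodic_mean_ae_cvg intf). Qed.

Lemma moment_ergodic_limit p f : 1 <= p -> bint f ->
  (moment mu p (ergodic_limit tau f) <= moment mu p f)%E.
Proof.
move=> p1 intf; have mf := intf.1.
apply: (moment_fatou (u := fun n => S n f)) => //.
- by move=> n; exact: strongly_measurable_ergodic_mean.
- exact: strongly_measurable_ergodic_limit.
- exact: ergodic_limit_ae.
- by apply: nearW => n; exact: moment_ergodic_mean.
Qed.

Lemma ergodic_limit_integrable f : bint f -> bint (ergodic_limit tau f).
Proof.
move=> intf; apply/integrable_moment1; split.
  by apply: strongly_measurable_ergodic_limit; case: intf.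
apply: le_lt_trans (moment_ergodic_limit (lexx _) intf) _.
by move/integrable_moment1 : intf => [].
Qed.

Lemma finitely_valued_bounded s : finitely_valued s -> exists C : R, forall w, `|s w| <= C.
Proof.
move=> [fr _]; exists (\sum_(x <- fset_set (range s)) `|x|) => w.
rewrite (bigD1_seq (s w)) ?fset_uniq//=; first by rewrite lerDl sumr_ge0.
by rewrite in_fset_set//; apply: mem_set; exists w.
Qed.

(** The means of a simple function are uniformly bounded, and means are
    contractions for the moment. *)
Lemma moment_ergodic_mean_cvg p f : 1 <= p -> SM f -> (moment mu p f < +oo)%E ->
  moment mu p (fun w => ergodic_limit tau f w - S n f w) @[n --> \oo] --> 0%E.
Proof.
move=> p1 mf ff; have intf := moment_lty_integrable p1 mf ff.
apply: moment_approx_cvg0 => //.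
- by move=> n; exact: strongly_measurable_ergodic_mean.
- exact: strongly_measurable_ergodic_limit.
- exact: ergodic_limit_ae.
move=> e e0; have [s [fs se]] := simple_approximation_moment p1 mf ff e0.
have [C sC] := finitely_valued_bounded fs.
have ints := bochner_integrable_simple mu fs.
have ms : SM s by case: ints.
exists (fun n => S n s), (ergodic_limit tau s), C; split.
- by move=> n; exact: strongly_measurable_ergodic_mean.
- exact: strongly_measurable_ergodic_limit.
- by apply: aeW => w n; exact: ergodic_mean_bounded.
- exact: ergodic_limit_ae.
- move=> n; apply: le_trans se.
  rewrite (_ : moment mu p _ = moment mu p (S n (fun w => f w - s w))).
    by apply: moment_ergodic_mean => //; exact: strongly_measurableB.
  by apply: eq_integral => w _; rewrite ergodic_meanB.
Qed.

End ErgodicVector.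

Section BochnerInvariance.
Context {d : measure_display} {T : measurableType d} {R : realType}
  {X : completeNormedModType R}.
Variable mu : {finite_measure set T -> \bar R}.
Variable tau : T -> T.
Hypothesis endo : endomorphism mu tau.
Implicit Types (f g s : T -> X).

Local Notation bint := (bochner_integrable mu).
Local Notation Bi := (bochner_integral mu).

Let mtau : measurable_fun setT tau := endo.1.

Lemma simple_integral_endomorphism s : finitely_valued s ->
  simple_integral mu (s \o tau) = simple_integral mu s.
Proof.
move=> [fs ms]; rewrite /simple_integral.
rewrite (@fsbig_widen _ _ _ _ (range (s \o tau)) (range s)).
- by apply: eq_fsbigr => x _; rewrite comp_preimage endo.2.
- by move=> _ [w _ <-]; exists (tau w).
- move=> x /= [_ nx]; rewrite (_ : _ @^-1` _ = set0) ?measure0 ?scale0r//.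
  by rewrite -subset0 => w /= wx; apply: nx; exists w.
Qed.

Lemma bochner_integral_endomorphism f : bint f -> Bi (f \o tau) = Bi f.
Proof.
move=> intf; have [mf [s [ss sf sv]]] := bochner_integralP intf.
apply: bochner_integralE; split; first exact: strongly_measurable_comp.
have mS n := simple_strongly_measurable (ss n).
exists (fun n => s n \o tau); split.
- move=> n; have [fs ms] := ss n; split.
    by apply: sub_finite_set fs => _ [w _ <-]; exists (tau w).
  by move=> x; rewrite comp_preimage -[_ @^-1` _]setTI; apply: mtau => //; exact: ms.
- rewrite (_ : (fun n => _) = (fun n => \int[mu]_w `|f w - s n w|%:E)%E)//.
  apply/funext => n.
  rewrite -(ge0_integral_endomorphism endo (h := fun w => `|f w - s n w|))//.
  by apply: strongly_measurable_norm; exact: strongly_measurableB.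
- rewrite (_ : (fun n => _) = (fun n => simple_integral mu (s n)))//.
  by apply/funext => n; apply: simple_integral_endomorphism; exact/simple_functionP.
Qed.

Lemma bochner_integral_onT f : bochner_integral_on mu setT f = Bi f.
Proof.
by congr bochner_integral; apply/funext => w; rewrite indicE in_setT scale1r.
Qed.

Lemma bochner_integral_iter i f : bint f ->
  bint (fun w => f (iter i tau w)) /\ Bi (fun w => f (iter i tau w)) = Bi f.
Proof.
move=> intf; elim: i => [//|i [ih1 ih2]].
rewrite (_ : (fun w => f (iter i.+1 tau w)) = (fun w => f (iter i tau w)) \o tau); last first.
  by apply/funext => w /=; rewrite -iterS iterSr.
split; last by rewrite bochner_integral_endomorphism.
have [mfi fi] := ih1; split; first exact: (strongly_measurable_comp mtau).
rewrite (ge0_integral_endomorphism endo (h := fun w => `|f (iter i tau w)|))//.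
exact: strongly_measurable_norm.
Qed.

Lemma bochner_integral_ergodic_mean n f : bint f -> Bi (ergodic_mean tau n.+1 f) = Bi f.
Proof.
move=> intf.
have Hz : bint (fun=> 0 : X) /\ Bi (fun=> 0 : X) = 0.
  split.
    apply: (bochner_integrableW intf); first exact: strongly_measurable_cst.
    by move=> w; rewrite normr0.
  rewrite -[RHS](subrr (Bi f)) -(bochner_integralB intf intf).
  by congr bochner_integral; apply/funext => w; rewrite subrr.
have Hs k : bint (fun w => \sum_(0 <= i < k) f (iter i tau w)) /\
    Bi (fun w => \sum_(0 <= i < k) f (iter i tau w)) = k%:R *: Bi f.
  elim: k => [|k [ih1 ih2]].
    rewrite (_ : (fun w => _) = (fun=> 0)) ?scale0r//.
    by apply/funext => w; rewrite big_geq.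
  have [hi1 hi2] := bochner_integral_iter k intf.
  rewrite (_ : (fun w => \sum_(0 <= i < k.+1) f (iter i tau w)) =
    (fun w => \sum_(0 <= i < k) f (iter i tau w) + 1 *: f (iter k tau w))); last first.
    by apply/funext => w; rewrite big_nat_recr//= scale1r.
  split; first exact: bochner_integrable_lin.
  by rewrite (bochner_integral_lin 1 ih1 hi1) ih2 hi2 -scalerDl -natr1.
rewrite (_ : ergodic_mean tau n.+1 f = (fun w => 0 + n.+1%:R^-1 *: \sum_(0 <= i < n.+1) f (iter i tau w))).
  have [h1 h2] := Hs n.+1.
  by rewrite (bochner_integral_lin _ Hz.1 h1) Hz.2 h2 add0r scalerA mulVf// scale1r.
by apply/funext => w; rewrite add0r ergodic_meanE.
Qed.

Lemma bochner_integral_ergodic_limit f : bint f -> Bi (ergodic_limit tau f) = Bi f.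
Proof.
move=> intf; rewrite -bochner_integral_onT.
apply: (bochner_integral_on_lim (g := fun n => ergodic_mean tau n f) (N := 1%N) measurableT).
- exact: ergodic_limit_integrable.
- by move=> n; exact: bochner_integrable_ergodic_mean.
- have := moment_ergodic_mean_cvg endo (lexx 1) intf.1; rewrite moment1 => /(_ intf.2).
  rewrite (_ : (fun n => moment _ _ _) =
    (fun n => \int[mu]_w `|ergodic_limit tau f w - ergodic_mean tau n f w|%:E)%E)//.
  by apply/funext => n; rewrite moment1.
- case=> [//|n _]; rewrite bochner_integral_onT.
  exact: bochner_integral_ergodic_mean.
Qed.

End BochnerInvariance.

(** * The norms of the L_p spaces *)

Section LpNorm.
Context {d : measure_display} {T : measurableType d} {R : realType}
  {X : completeNormedModType R}.
Variable mu : {finite_measure set T -> \bar R}.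
Variable p : R.
Hypothesis p1 : 1 <= p.
Implicit Types (f g : T -> X).

Let p0 : 0 < p := lt_le_trans ltr01 p1.

Lemma Lp_normE f : Lp_norm mu p f = ((moment mu p f) `^ p^-1)%E.
Proof.
rewrite /Lp_norm unlock; congr poweR; apply: eq_integral => w _.
by rewrite /= normr_id.
Qed.

Lemma Lp_norm_lty f : (Lp_norm mu p f < +oo)%E = (moment mu p f < +oo)%E.
Proof.
rewrite Lp_normE; apply/idP/idP => [|h]; last exact: poweR_lty.
by apply: lty_poweRy; rewrite gt_eqF// invr_gt0.
Qed.

Lemma le_Lp_norm f g : (moment mu p f <= moment mu p g)%E -> (Lp_norm mu p f <= Lp_norm mu p g)%E.
Proof.
move=> fg; rewrite !Lp_normE; apply: gt0_ler_poweR => //.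
- by rewrite invr_ge0 ltW.
- by rewrite in_itv/= leey moment_ge0.
- by rewrite in_itv/= leey moment_ge0.
Qed.

Lemma Lp_norm_cvg0 {I : Type} (G : set_system I) {FG : Filter G} (u : I -> T -> X) :
  moment mu p (u i) @[i --> G] --> 0%E -> Lp_norm mu p (u i) @[i --> G] --> 0%E.
Proof.
move/cvge0P => /(_ (fun i => moment_ge0 _ _ _)) H; apply/cvge0P.
  by move=> i; exact: Lnorm_ge0.
move=> e e0; have := H _ (powR_gt0 p e0); apply: filterS => i /= hi.
rewrite Lp_normE -[leRHS](_ : ((e `^ p)%:E `^ p^-1)%E = e%:E); last first.
  by rewrite poweR_EFin -powRrM divff ?gt_eqF// powRr1// ltW.
apply: gt0_ler_poweR => //.
- by rewrite invr_ge0 ltW.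
- by rewrite in_itv/= leey moment_ge0.
- by rewrite in_itv/= leey lee_fin powR_ge0.
Qed.

End LpNorm.

(** * Maximal inequality in two indices *)

Section MaximalMonotone.
Context {d : measure_display} {T : measurableType d} {R : realType}
  {X : completeNormedModType R}.
Variable mu : {finite_measure set T -> \bar R}.
Variable F : nat -> set (set T).
Hypothesis subF : forall n, is_sub_sigma_algebra (F n).
Hypothesis monoF : monotone_family F.
Implicit Types (f : T -> X) (u : nat -> T -> X).

Local Notation SM := (@strongly_measurable d T R X measurable).
Local Notation bint := (bochner_integrable mu).
Local Notation ce f n := (cond_exp mu f (F n)).

(** Because the bound is an integral over the whole space, a decreasing family
    can be treated on finite stretches, each of which increases when read
    backwards. *)
Lemma maximal_monotone (B : nat -> set T) (h : T -> \bar R) (lam : R) :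
  0 <= lam -> (forall n, F n (B n)) -> measurable_fun setT h -> (forall w, 0 <= h w)%E ->
  (forall n A, F n A -> A `<=` B n -> lam%:E * mu A <= \int[mu]_(w in A) h w)%E ->
  (lam%:E * mu (\bigcup_n B n) <= \int[mu]_w h w)%E.
Proof.
move=> lam0 FB mh h0 H.
have mB n : measurable (B n) := (subF n).2 _ (FB n).
have int_le (A : set T) : measurable A -> (\int[mu]_(w in A) h w <= \int[mu]_w h w)%E.
  by move=> mA; apply: ge0_subset_integral.
case: monoF => mono.
  have mU : measurable (\bigcup_n B n) by exact: bigcupT_measurable.
  apply: le_trans (int_le _ mU).
  by apply: (maximal_bound lam0 subF) => // i; exact: mono.
apply: measure_bigcup_le => // K.
pose B' i := B (K - i)%N.
have mU : measurable (\bigcup_i B' i) by apply: bigcupT_measurable => i; exact: mB.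
apply: (@le_trans _ _ (lam%:E * mu (\bigcup_i B' i))%E).
  apply: lee_wpmul2l; first by rewrite lee_fin.
  apply: measure_le => //; first by apply: bigcup_measurable => i _; exact: mB.
  by move=> w [i /= iK Bi]; exists (K - i)%N => //; rewrite /B' subKn.
apply: le_trans (int_le _ mU).
apply: (@maximal_bound _ _ _ _ (fun i => F (K - i)%N)) => // [i|i A FA AB].
- by apply: mono; rewrite leq_sub2l.
- exact: H AB.
Qed.

(** The inequality is applied in each index in turn. For fixed [m] all the sets
    where the norm of a conditional expectation exceeds [lam] belong to
    [F m], so [maximal_bound] for the constant family [F m] shows that every
    subset in [F m] of their union [B m] satisfies the hypothesis of
    [maximal_monotone]. *)
Lemma cond_exp_maximal u (h : T -> \bar R) (lam : R) : 0 <= lam ->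
  (forall j, bint (u j)) -> measurable_fun setT h -> (forall j w, `|u j w|%:E <= h w)%E ->
  (lam%:E * mu (\bigcup_m \bigcup_j [set w | (lam < `|ce (u j) m w|)%R]) <= \int[mu]_w h w)%E.
Proof.
move=> lam0 intu mh uh.
have h0 w : (0 <= h w)%E by apply: le_trans (uh 0%N w); rewrite lee_fin.
have cP j m := cond_expP (subF m) (intu j).
pose B m j := [set w | lam < `|ce (u j) m w|].
have FB m j : F m (B m j) by apply: measurable_norm_gt => //; case: (cP j m).
apply: (maximal_monotone (B := fun m => \bigcup_j B m j)) => //.
  move=> m; rewrite -(measurable_sub (subF m)).
  by apply: bigcupT_measurable => j; rewrite (measurable_sub (subF m)).
move=> m A FA AB.
have -> : A = \bigcup_j (A `&` B m j) by rewrite -setI_bigcupr; apply/esym/setIidPl.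
have FI j : F m (A `&` B m j).
  move: FA (FB m j); rewrite -[X in X A](measurable_sub (subF m)) => mA.
  rewrite -[X in X (B m j)](measurable_sub (subF m)) => mB.
  by rewrite -[X in X (_ `&` _)](measurable_sub (subF m)); exact: measurableI.
apply: (@maximal_bound _ _ _ _ (fun=> F m)) => // [j|j C FC CB]; first exact: subset_refl.
have mC := (subF m).2 _ FC.
apply: (@le_trans _ _ (\int[mu]_(w in C) `|ce (u j) m w|%:E)%E).
  apply: markov_on => //; first by case: (is_cond_exp_integrable (subF m) (cP j m)).
  by move=> w /CB[_ /ltW].
apply: le_trans (is_cond_exp_contraction (subF m) (intu j) (cP j m) FC) _.
apply: ge0_le_integral => //.
- by apply/measurable_EFinP; apply: measurable_funTS; apply: strongly_measurable_norm; case: (intu j).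
- exact: measurable_funTS.
Qed.

(** Convergence in [j], uniformly in [m]. The suprema [D k] of the norms of
    the [u j] with [k <= j] tend to 0 in mean by dominated convergence, and
    [cond_exp_maximal] bounds by them the measure of the set where some
    conditional expectation with [k <= j] is large. *)
Lemma cond_exp_dominated_cvg0 u (h : T -> \bar R) : (forall j, SM (u j)) ->
  mu.-integrable setT h -> (forall j w, `|u j w|%:E <= h w)%E ->
  {ae mu, forall w, u j w @[j --> \oo] --> (0 : X)} ->
  {ae mu, forall w, forall e : R, 0 < e ->
    exists k, forall m j, (k <= j)%N -> `|ce (u j) m w| <= e}.
Proof.
move=> mu_ ih uh u0.
have nu w j : (0 <= (`|u j w|%:E : \bar R))%E by rewrite lee_fin.
have intu j : bint (u j).
  split=> //; move/integrableP : (ih) => [mh]; apply: le_lt_trans.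
  apply: ge0_le_integral => //.
  - by apply/measurable_EFinP; exact: strongly_measurable_norm.
  - exact: measurableT_comp.
  - by move=> w _; apply: le_trans (uh j w) _; exact: lee_abs.
pose D k w := esups (fun j => `|u j w|%:E) k.
have mD k : measurable_fun setT (D k).
  by apply: measurable_fun_esups => j; apply/measurable_EFinP; exact: strongly_measurable_norm.
have uD k j w : (k <= j)%N -> (`|u j w|%:E <= D k w)%E.
  by move=> kj; apply: ereal_sup_ubound; exists j.
have Dh k w : (D k w <= h w)%E by apply: ge_ereal_sup => _ [j _ <-].
have D0 k w : (0 <= D k w)%E by apply: le_trans (uD k k w _).
have /cvge0P Dcvg : (\int[mu]_w D k w @[k --> \oo] --> 0)%E.
  have := @dominated_convergence _ _ _ mu setT measurableT D (cst 0%E) h mD _ _ ih.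
  case.
  - exact: measurable_cst.
  - apply: filterS u0 => w u0 _; apply: cvg_esups; apply/cvg_EFin; first exact: filterE.
    by rewrite -[X in _ --> X](normr0 X); exact: cvg_norm.
  - by apply: aeW => w k _; rewrite gee0_abs.
  by move=> _ _; rewrite integral_cst// mul0e; exact.
have {}Dcvg := Dcvg (fun k => integral_ge0 _ (fun w _ => D0 k w)).
pose B (e : R) k := \bigcup_m \bigcup_j [set w | e < `|ce (u (k + j)%N) m w|].
have mB e k : measurable (B e k).
  apply: bigcupT_measurable => m; apply: bigcupT_measurable => j.
  apply: (subF m).2; apply: measurable_norm_gt => //.
  by have [] := cond_expP (subF m) (intu (k + j)%N).
have BD e k : 0 <= e -> (e%:E * mu (B e k) <= \int[mu]_w D k w)%E.
  move=> e0; apply: (cond_exp_maximal e0 (u := fun j => u (k + j)%N)) => //.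
  by move=> j w; apply: uD; exact: leq_addr.
have null e : 0 < e -> {ae mu, forall w, exists k, ~ B e k w}.
  move=> e0; exists (\bigcap_k B e k); split.
  - exact: bigcapT_measurable.
  - apply/eqP; rewrite eq_le measure_ge0 andbT; apply/lee_addgt0Pr => dl dl0.
    rewrite add0e.
    have [N _ /(_ N (leqnn N)) /= HN] := Dcvg (e * dl) (mulr_gt0 e0 dl0).
    rewrite -(@lee_pmul2l _ e%:E) ?lte_fin// -EFinM.
    apply: le_trans HN; apply: le_trans (BD e N (ltW e0)).
    apply: lee_wpmul2l; first by rewrite lee_fin ltW.
    apply: measure_le => //; first exact: bigcapT_measurable.
    by move=> w; apply.
  - by move=> w /= nk k _; apply: contrapT => Bk; apply: nk; exists k.
have : {ae mu, forall w, forall i : nat, exists k, ~ B i.+1%:R^-1 k w}.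
  by apply/ae_foralln => i; apply: null; rewrite invr_gt0.
apply: filterS => w Hw e e0.
have [i ie] : exists i : nat, i.+1%:R^-1 <= e.
  exists (Num.bound e^-1); rewrite -[leRHS]invrK lef_pV2 ?posrE ?invr_gt0//.
  rewrite ltW// (lt_trans (archi_boundP _)) ?ltr_nat// invr_ge0.
  exact: ltW.
have [k nB] := Hw i; exists k => m j kj; rewrite leNgt; apply/negP => ej.
apply: nB; exists m; first exact: I.
exists (j - k)%N; first exact: I.
by rewrite /= subnKC; [exact: le_lt_trans ie ej|exact: kj].
Qed.

End MaximalMonotone.

(** * Ergodic means and conditional expectations together *)

Section Combination.
Context {d : measure_display} {T : measurableType d} {R : realType}
  {X : completeNormedModType R}.
Variable mu : {finite_measure set T -> \bar R}.
Variables (F : nat -> set (set T)) (Foo : set (set T)).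
Hypothesis subF : forall n, is_sub_sigma_algebra (F n).
Hypothesis limF : increases_to F Foo \/ decreases_to F Foo.
Implicit Types (f g : T -> X) (p : R).

Local Notation SM := (@strongly_measurable d T R X measurable).
Local Notation bint := (bochner_integrable mu).
Local Notation ce f n := (cond_exp mu f (F n)).

Let monoF := monotone_family_of limF.
Let subFoo := is_sub_sigma_algebra_limit subF limF.

Lemma strongly_measurable_cond_exp (G : set (set T)) f : is_sub_sigma_algebra G ->
  bint f -> SM (cond_exp mu f G).
Proof. by move=> subG intf; case: (is_cond_exp_integrable subG (cond_expP subG intf)). Qed.

Lemma moment_cond_expB p (G : set (set T)) f g : 1 <= p -> is_sub_sigma_algebra G ->
  bint f -> bint g ->
  (moment mu p (fun w => cond_exp mu f G w - cond_exp mu g G w)%R <=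
   moment mu p (fun w => f w - g w)%R)%E.
Proof.
move=> p1 subG intf intg; apply: (is_cond_exp_powR_contraction p1 subG).
  exact: bochner_integrableB.
exact: (is_cond_expB subG intf intg (cond_expP subG intf) (cond_expP subG intg)).
Qed.

(** The conditional expectations of a simple function are uniformly bounded,
    and conditional expectations are contractions for the moment. *)
Lemma cond_exp_moment_cvg p f : 1 <= p -> SM f -> (moment mu p f < +oo)%E ->
  moment mu p (fun w => cond_exp mu f Foo w - ce f n w)%R @[n --> \oo] --> 0%E.
Proof.
move=> p1 mf ff; have intf := moment_lty_integrable p1 mf ff.
apply: moment_approx_cvg0 => //.
- by move=> n; exact: strongly_measurable_cond_exp.
- exact: strongly_measurable_cond_exp.
- exact: (cond_exp_cvg subF limF intf).1.
move=> e e0; have [s [fs se]] := simple_approximation_moment p1 mf ff e0.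
have [C sC] := finitely_valued_bounded fs.
have ints := bochner_integrable_simple mu fs.
exists (fun n => ce s n), (cond_exp mu s Foo), C; split.
- by move=> n; exact: strongly_measurable_cond_exp.
- exact: strongly_measurable_cond_exp.
- apply/ae_foralln => n.
  exact: (is_cond_exp_bounded (subF n) ints (cond_expP (subF n) ints) sC).
- exact: (cond_exp_cvg subF limF ints).1.
- by move=> n; apply: le_trans se; exact: moment_cond_expB.
Qed.

Lemma near_filter_prod_nat (P : nat * nat -> Prop) N M :
  (forall n m, (N <= n)%N -> (M <= m)%N -> P (n, m)) ->
  \forall n \near filter_prod \oo \oo, P n.
Proof.
move=> H; exists ([set n | (N <= n)%N], [set n | (M <= n)%N]).
  by split; [exists N|exists M].
by case=> n m [/= Nn Mm]; exact: H.
Qed.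

Variable tau : T -> T.
Hypothesis endo : endomorphism mu tau.

Local Notation S n f := (ergodic_mean tau n f).
Local Notation L f := (ergodic_limit tau f).

(** The two indices are separated at the conditional expectation of the
    ergodic limit on [F n.2]: by contraction the first distance is at most
    that of the ergodic mean to its limit, whatever [n.2], and the second one
    does not involve [n.1]. *)
Lemma moment_cond_exp_ergodic_mean_cvg p f : 1 <= p -> SM f -> (moment mu p f < +oo)%E ->
  moment mu p (fun w => ce (S n.1 f) n.2 w - cond_exp mu (L f) Foo w)%R
    @[n --> filter_prod \oo \oo] --> 0%E.
Proof.
move=> p1 mf ff; have intf := moment_lty_integrable p1 mf ff.
have intl := ergodic_limit_integrable endo intf.
have mS n : bint (S n f) by exact: bochner_integrable_ergodic_mean.
apply/cvge0P => [n|e e0]; first exact: moment_ge0.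
pose c : R := 2 `^ p; have c0 : 0 < c by exact: powR_gt0.
have dl0 : 0 < e / 2 / c by rewrite !divr_gt0.
have /cvge0P := moment_ergodic_mean_cvg endo p1 mf ff.
move=> /(_ (fun n => moment_ge0 _ _ _) _ dl0) [N _ HN].
have lf : (moment mu p (L f) < +oo)%E.
  by apply: le_lt_trans ff; exact: moment_ergodic_limit.
have /cvge0P := cond_exp_moment_cvg p1 intl.1 lf.
move=> /(_ (fun n => moment_ge0 _ _ _) _ dl0) [M _ HM].
apply: (near_filter_prod_nat (N := N) (M := M)) => n m Nn Mm /=.
apply: le_trans (momentB_le mu p1 (strongly_measurable_cond_exp (subF m) (mS n))
  (strongly_measurable_cond_exp (subF m) intl) (strongly_measurable_cond_exp subFoo intl)) _.
rewrite -/c (_ : e = c * (e / 2 / c + e / 2 / c)); last by field; rewrite gt_eqF.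
rewrite EFinM; apply: lee_wpmul2l; first by rewrite lee_fin ltW.
rewrite EFinD; apply: leeD.
  apply: le_trans (moment_cond_expB p1 (subF m) (mS n) intl) _.
  by rewrite momentC; exact: HN.
by rewrite momentC; exact: HM.
Qed.

Lemma moment_cond_exp_ergodic_limit p f : 1 <= p -> bint f ->
  (moment mu p (cond_exp mu (L f) Foo) <= moment mu p f)%E.
Proof.
move=> p1 intf; have intl := ergodic_limit_integrable endo intf.
apply: le_trans (moment_ergodic_limit endo p1 intf).
exact: (is_cond_exp_powR_contraction p1 subFoo intl (cond_expP subFoo intl)).
Qed.

(** The difference between the ergodic means and their limit tends to 0 almost
    everywhere and is dominated by an integrable function, so that its
    conditional expectations tend to 0 uniformly in the second index; to them
    is added the conditional expectation of the limit, a sequence in the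
    second index alone. *)
Lemma cond_exp_ergodic_mean_ae_cvg f : bint f ->
  mu.-integrable setT
    (fun w => ereal_sup [set `|S n f w|%:E | n in [set n | (0 < n)%N]]) ->
  {ae mu, forall w, ce (S n.1 f) n.2 w @[n --> filter_prod \oo \oo]
     --> cond_exp mu (L f) Foo w}.
Proof.
move=> intf isup; have intl := ergodic_limit_integrable endo intf.
have intS n : bint (S n f) by exact: bochner_integrable_ergodic_mean.
(* Shifted, because the supremum of the means starts at index 1. *)
pose u j w := S j.+1 f w - L f w.
have mu_ j : SM (u j) by apply: strongly_measurableB; [case: (intS j.+1)|case: intl].
pose h w := (ereal_sup [set `|S n f w|%:E | n in [set n | (0 < n)%N]] + `|L f w|%:E)%E.
have ih : mu.-integrable setT h.
  apply: integrableD => //; apply/integrableP; split.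
    by apply/measurable_EFinP; apply: strongly_measurable_norm; case: intl.
  have [_] := intl; congr (_ < _)%E; apply: eq_integral => w _.
  by rewrite gee0_abs// lee_fin.
have uh j w : (`|u j w|%:E <= h w)%E.
  apply: (@le_trans _ _ (`|S j.+1 f w|%:E + `|L f w|%:E)%E).
    by rewrite -EFinD lee_fin ler_normB.
  by apply: leeD => //; apply: ereal_sup_ubound; exists j.+1.
have u0 : {ae mu, forall w, u j w @[j --> \oo] --> (0 : X)}.
  apply: filterS (ergodic_limit_ae endo intf) => w Sw.
  rewrite -(subrr (L f w)); apply: cvgB; last exact: cvg_cst.
  by have := Sw; rewrite -(cvg_shiftS (fun n => S n f w)).
have intu j : bint (u j) by exact: bochner_integrableB.
have split_ae : {ae mu, forall w, forall j m, ce (S j.+1 f) m w - ce (L f) m w = ce (u j) m w}.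
  apply/ae_foralln => j; apply/ae_foralln => m.
  apply: (is_cond_exp_uniq (subF m) (intu j)); last exact: cond_expP.
  exact: (is_cond_expB (subF m) (intS _) intl (cond_expP (subF m) (intS _)) (cond_expP (subF m) intl)).
apply: filterS3 (cond_exp_dominated_cvg0 subF monoF mu_ ih uh u0) split_ae
  (cond_exp_cvg subF limF intl).1 => w w1 w2 w3.
apply/cvgrPdist_le => e e0; have e20 : 0 < e / 2 by rewrite divr_gt0.
have [k Hk] := w1 _ e20.
move/cvgrPdist_le : w3 => /(_ _ e20) [M _ HM].
apply: (near_filter_prod_nat (N := k.+1) (M := M)) => -[//|n] m kn Mm /=.
rewrite (_ : _ - _ = (cond_exp mu (L f) Foo w - ce (L f) m w) - ce (u n) m w); last first.
  by rewrite -w2 opprB addrA subrK.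
rewrite (le_trans (ler_normB _ _))// [leRHS](splitr e) lerD//; first exact: HM.
exact: Hk.
Qed.

Lemma bochner_integral_cond_exp f : bint f ->
  bochner_integral mu (cond_exp mu f Foo) = bochner_integral mu f.
Proof.
move=> intf; rewrite -!bochner_integral_onT.
by have [_ _] := cond_expP subFoo intf; apply; exact: sub_sigma_setT.
Qed.

End Combination.

Theorem theorem2p3 (d : measure_display) (T : measurableType d) (R : realType)
    (mu : {finite_measure set T -> \bar R})
    (X : completeNormedModType R) (reflX : reflexive_space X)
    (F : nat -> set (set T)) (Foo : set (set T))
    (subF : forall n, is_sub_sigma_algebra (F n))
    (monF : increases_to F Foo \/ decreases_to F Foo)
    (tau : T -> T) (endo_tau : endomorphism mu tau) :
  (forall (p : R) (f : T -> X), 1 <= p -> Lp_space mu p f ->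
     cvg_in_Lp mu p
       (fun n : nat * nat => cond_exp mu (ergodic_mean tau n.1 f) (F n.2))
       (filter_prod \oo \oo)
       (cond_exp mu (ergodic_limit tau f) Foo) /\
     (Lp_norm mu p (cond_exp mu (ergodic_limit tau f) Foo)
        <= Lp_norm mu p f)%E) /\
  (forall (p : R) (f : T -> X), 1 <= p -> Lp_space mu p f ->
     mu.-integrable [set: T]
       (fun w => ereal_sup
          [set `|ergodic_mean tau n f w|%:E | n in [set n | (0 < n)%N]]) ->
     {ae mu, forall w,
        cond_exp mu (ergodic_mean tau n.1 f) (F n.2) w
          @[n --> filter_prod \oo \oo]
          --> cond_exp mu (ergodic_limit tau f) Foo w} /\
     bochner_integral mu (cond_exp mu (ergodic_limit tau f) Foo)
       = bochner_integral mu f).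
Proof.
have subFoo := is_sub_sigma_algebra_limit subF monF.
split=> p f p1 [mf]; rewrite (Lp_norm_lty mu p1 f) => ff.
  have intf := moment_lty_integrable p1 mf ff.
  have intl := ergodic_limit_integrable endo_tau intf.
  have normle : (Lp_norm mu p (cond_exp mu (ergodic_limit tau f) Foo) <= Lp_norm mu p f)%E.
    apply: (le_Lp_norm p1); exact: moment_cond_exp_ergodic_limit.
  split=> //; split.
  - move=> [n m] /=; have intS := bochner_integrable_ergodic_mean endo_tau n intf.
    split; first exact: strongly_measurable_cond_exp.
    rewrite (Lp_norm_lty mu p1); apply: le_lt_trans ff.
    apply: le_trans (moment_ergodic_mean endo_tau n p1 mf).
    exact: (is_cond_exp_powR_contraction p1 (subF m) intS (cond_expP (subF m) intS)).
  - split; first exact: strongly_measurable_cond_exp.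
    by apply: le_lt_trans normle _; rewrite (Lp_norm_lty mu p1 f).
  - by apply: Lp_norm_cvg0 => //; exact: moment_cond_exp_ergodic_mean_cvg.
move=> isup; have intf := moment_lty_integrable p1 mf ff.
have intl := ergodic_limit_integrable endo_tau intf.
split; first exact: cond_exp_ergodic_mean_ae_cvg.
by rewrite (bochner_integral_cond_exp subF monF intl) (bochner_integral_ergodic_limit endo_tau intf).
Qed.
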